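(* Let $\alpha'\in[0,1)$. There exist a body force $F_0\in C^{\alpha'}((0,2)\times\mathbb T^3)$ and a divergence-free initial datum $v_{\mathrm{in}}\in C^\infty(\mathbb T^3;\mathbb R^3)$ such that the 3d forced Euler equations $$\partial_t v+v\cdot\nabla v+\nabla p=F_0,\qquad\operatorname{div}v=0,\qquad v(0,\cdot)=v_{\mathrm{in}}$$ on $(0,2)\times\mathbb T^3$ admit at least two distinct admissible bounded solutions.
   Context: $\mathbb T^3\simeq\mathbb R^3/\mathbb Z^3$ is the 3-dimensional torus. For $\alpha\in(0,1)$, $C^\alpha((0,2)\times\mathbb T^3)$ denotes functions that are $\alpha$-Hölder continuous jointly in space and time, with the usual norm; $C^0$ denotes continuous functions with the sup norm. Body forces are ($\mathbb R^3$-valued and) divergence-free. Weak solutions are understood in the sense of distributions: with $T=2$, $\operatorname{div}v=0$ and $\int_0^T\int_{\mathbb T^3}(v\cdot\partial_t\varphi+v\otimes v:\nabla\varphi+F_0\cdot\varphi)\,dx\,dt+\int_{\mathbb T^3}v_{\mathrm{in}}\cdot\varphi(0,\cdot)\,dx=0$ for all divergence-free $\varphi\in C^\infty_c([0,T)\times\mathbb T^3;\mathbb R^3)$. Bounded means in $L^\infty((0,2)\times\mathbb T^3)$. A weak solution $v\in L^\infty((0,T);L^2(\mathbb T^3))$ is admissible if $$\int_{\mathbb T^3}|v(x,t)|^2dx\le\int_{\mathbb T^3}|v_{\mathrm{in}}(x)|^2dx+2\int_0^t\int_{\mathbb T^3}F_0(x,s)\cdot v(x,s)\,dx\,ds\qquad\text{for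 a.e. }t\in(0,T).$$ *)

(* Defs.v *)
From HB Require Import structures.
From mathcomp Require Import all_boot all_order all_algebra.
From mathcomp Require Import all_classical all_reals all_analysis.

Set Implicit Arguments.
Unset Strict Implicit.
Unset Printing Implicit Defensive.

Import Order.TTheory GRing.Theory Num.Theory.
Import numFieldNormedType.Exports.

Local Open Scope classical_set_scope.
Local Open Scope ring_scope.

(** [vec3] is the value space of vector fields.  A point of R^3 is a triple
    (rather than a row vector) so that the library's product measures apply;
    the time variable of a point of space-time comes last.
    Functions on the torus T^3 = R^3/Z^3 are Z^3-periodic functions on R^3,
    and integrals over T^3 are integrals over the unit cube. *)
Notation space3 R := (R * R * R)%type.
Notation spacetime R := (R * R * R * R)%type.
Notation vec3 R := 'rV[R]_3.

Section Calculus.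
Context {R : realType}.

Definition unit_vec (i : 'I_3) : space3 R :=
  ((i == 0)%:R, (i == 1)%:R, (i == 2)%:R).

(** Smoothness on the whole space: all iterated directional derivatives
    exist and are differentiable, hence continuous. *)
Definition smooth {V W : normedModType R} (f : V -> W) : Prop :=
  forall (s : seq V) (x : V),
    differentiable (foldr (fun u (g : V -> W) => 'D_u g) f s) x.

Definition dot (u w : vec3 R) : R := \sum_i u 0 i * w 0 i.

Definition space_partial {W : normedModType R} (j : 'I_3)
  (f : spacetime R -> W) : spacetime R -> W := 'D_(unit_vec j, 0) f.

Definition time_partial {W : normedModType R}
  (f : spacetime R -> W) : spacetime R -> W := 'D_(0, 1) f.

Definition grad (f : spacetime R -> R) (z : spacetime R) : vec3 R :=
  \row_j space_partial j f z.

Definition div (f : spacetime R -> vec3 R) (z : spacetime R) : R :=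
  \sum_j (space_partial j f z) 0 j.

(** [periodic f k] is the library's [forall u, f (u + k) = f u]. *)
Definition torus_periodic {W : zmodType} (f : space3 R -> W) : Prop :=
  forall i : 'I_3, periodic f (unit_vec i).

Definition space_periodic {W : zmodType} (f : spacetime R -> W) : Prop :=
  forall t : R, torus_periodic (fun x => f (x, t)).

End Calculus.

Section Euler.
Context {R : realType}.

Definition mu_time : {sigma_finite_measure set (measurableTypeR R) -> \bar R} :=
  @lebesgue_measure R.
Definition mu_space : {measure set
    (measurableTypeR R * measurableTypeR R * measurableTypeR R)%type
    -> \bar R} := (mu_time \x mu_time \x mu_time)%E.
Definition mu_spacetime : {measure set
    (measurableTypeR R * measurableTypeR R * measurableTypeR R
     * measurableTypeR R)%type -> \bar R} := (mu_space \x mu_time)%E.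

Definition cube : set (space3 R) := `[0, 1[ `*` `[0, 1[ `*` `[0, 1[.

Definition torus_int (f : space3 R -> R) : R :=
  (\int[mu_space]_(x in cube) f x)%R.

Definition time_int (a b : R) (f : R -> R) : R :=
  (\int[mu_time]_(t in `]a, b[) f t)%R.

Section Horizon.
Context (T : R).

(** R^3 x (0,T), and [0,1)^3 x (0,T) which represents (0,T) x T^3. *)
Definition cylinder : set (spacetime R) := setT `*` `]0, T[.
Definition torus_cylinder : set (spacetime R) := cube `*` `]0, T[.

(** C^alpha((0,T) x T^3), with C^0 the bounded continuous functions.  A periodic
    function is alpha-Hölder for the distance of the torus iff it is so on R^3,
    with the same constant.  The norms on products and on [vec3] are sup norms,
    equivalent to the Euclidean ones. *)
Definition holder_field (alpha : R) (f : spacetime R -> vec3 R) : Prop :=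
  [/\ space_periodic f,
      exists M : R, forall z, cylinder z -> `|f z| <= M &
      if alpha == 0 then {within cylinder, continuous f}
      else exists C : R, forall z w, cylinder z -> cylinder w ->
             `|f z - f w| <= C * `|z - w| `^ alpha].

(** C_c^oo((0,T) x T^3). *)
Definition test_function (psi : spacetime R -> R) : Prop :=
  [/\ smooth psi, space_periodic psi &
      exists a b : R, [/\ 0 < a, b < T &
        forall t x, ~~ (a <= t <= b) -> psi (x, t) = 0]].

(** Divergence-free elements of C_c^oo([0,T) x T^3; R^3).  Such a function is
    the restriction to [0 <= t] of a smooth function on R x T^3 that vanishes
    near [T <= t]; nothing is required of its divergence for [t < 0]. *)
Definition test_field (phi : spacetime R -> vec3 R) : Prop :=
  [/\ smooth phi, space_periodic phi,
      exists2 b : R, b < T & forall t x, b <= t -> phi (x, t) = 0 &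
      forall t x, 0 <= t < T -> div phi (x, t) = 0].

Definition weakly_div_free (v : spacetime R -> vec3 R) : Prop :=
  forall psi, test_function psi ->
    time_int 0 T (fun t => torus_int (fun x =>
      dot (v (x, t)) (grad psi (x, t)))) = 0.

(** Measurable functions on (0,T) x T^3 (not identified a.e.). *)
Definition measurable_field (v : spacetime R -> vec3 R) : Prop :=
  space_periodic v /\
  forall i, measurable_fun torus_cylinder (fun z => v z 0 i).

(** L^oo((0,T) x T^3) *)
Definition bounded_field (v : spacetime R -> vec3 R) : Prop :=
  measurable_field v /\
  ('N[mu_spacetime]_+oo[(fun z => `|v z|%:E) \_ torus_cylinder] < +oo)%E.

(** L^oo((0,T); L^2(T^3)) *)
Definition energy_class (v : spacetime R -> vec3 R) : Prop :=
  measurable_field v /\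
  ('N[mu_time]_+oo[(fun t =>
     'N[mu_space]_2%:E[(fun x => `|v (x, t)|%:E) \_ cube]) \_ `]0%R, T[] < +oo)%E.

Definition weak_solution (F : spacetime R -> vec3 R) (vin : space3 R -> vec3 R)
    (v : spacetime R -> vec3 R) : Prop :=
  [/\ measurable_field v, weakly_div_free v &
      forall phi, test_field phi ->
        time_int 0 T (fun t => torus_int (fun x =>
            dot (v (x, t)) (time_partial phi (x, t))
          + \sum_i \sum_j
              v (x, t) 0 i * v (x, t) 0 j * space_partial j phi (x, t) 0 i
          + dot (F (x, t)) (phi (x, t))))
        + torus_int (fun x => dot (vin x) (phi (x, 0))) = 0].

Definition admissible (F : spacetime R -> vec3 R) (vin : space3 R -> vec3 R)
    (v : spacetime R -> vec3 R) : Prop :=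
  energy_class v /\
  {ae mu_time, forall t, 0 < t < T ->
     torus_int (fun x => dot (v (x, t)) (v (x, t)))
     <= torus_int (fun x => dot (vin x) (vin x))
        + 2 * time_int 0 t (fun s => torus_int (fun x =>
                dot (F (x, s)) (v (x, s))))}.

Definition admissible_bounded_solution (F : spacetime R -> vec3 R)
    (vin : space3 R -> vec3 R) (v : spacetime R -> vec3 R) : Prop :=
  [/\ weak_solution F vin v, admissible F vin v & bounded_field v].

End Horizon.

(** Divergence-free elements of C^oo(T^3; R^3). *)
Definition smooth_div_free_datum (u : space3 R -> vec3 R) : Prop :=
  [/\ smooth u, torus_periodic u &
      forall x, \sum_j ('D_(unit_vec j) u x) 0 j = 0].

End Euler.

(* Main.v *)
Require Import Defs.
From HB Require Import structures.
From mathcomp Require Import all_boot all_order all_algebra.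
From mathcomp Require Import all_classical all_reals all_analysis.
From mathcomp Require Import measurable_realfun ess_sup_inf ring lra.
Set Implicit Arguments.
Unset Strict Implicit.
Unset Printing Implicit Defensive.
Import Order.TTheory GRing.Theory Num.Theory.
Import numFieldNormedType.Exports.
Local Open Scope classical_set_scope.
Local Open Scope ring_scope.

(** The velocity is [(u, w)] with a horizontal part [u] and a vertical
    component [w], both independent of the third space variable.  Then [w]
    enters no nonlinear term of the equation for [u]: it is a passive scalar,
    transported by [u].  The two solutions have the same [u], the same force
    and the same [w] up to [t = 1]; after that time they differ in [w].

    Time is cut into slabs [tau k.+1 < `|t - 1| <= tau k], [tau k = 2 ^ - k].
    During the slab number [k] the field [u] is a shear along one horizontal
    axis, of a profile [g k] depending on the other one, the two axes
    alternating with [k].  A shear has no self-advection and needs no pressure,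
    so the force is just the time derivative of [u]; its modulation in time
    vanishes with its derivative at the ends of each slab.  The flow before
    [t = 1] is run backwards after it.  Hence the scalar at the outer end of the
    slab [k] is [f \o back_flow g k], where [f] is [f1] before and [f2] after
    the singular time, and the weak formulation holds on every slab up to
    boundary terms ([slab_weak]).  These telescope, and what remains at [t = 1]
    tends to [0] as soon as [(f1 - f2) \o back_flow g k] tends weakly to [0]
    ([solution_weak]).  The shears preserve volume and [w] is transported, and
    the work of the force is the kinetic energy of [u]; the energy inequality
    therefore says that the L^2 norm of [f2] is at most that of [f1]
    ([solution_admissible]).

    It remains to find [f2] different from [f1].  The profiles are chosen so
    that the shear number [k] moves the checkerboard of frequencies [freq k]
    and [freq k.+1] onto the next finer one, outside a set of measure of order
    [2 ^ - k] ([checker_shear], [torus_int_defect]).  Pulled back to the outer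
    time, the checkerboards form a Cauchy sequence in L^1; its limit
    [mixed_sign] takes the values [1] and [- 1], and is close, once transported,
    to finer and finer checkerboards, which tend weakly to [0]
    ([mixed_sign_weak]).  Any multiple of it can serve as [f1 - f2], and
    subtracting from [f1] its orthogonal projection on [mixed_sign] lowers the
    norm ([projection_energy_le]).  The projection is not zero, because the
    smooth datum [f1], a cosine, is correlated with the coarsest checkerboard
    ([init_wave_mixed_sign_gt0]).

    As for the force, with [freq k = K ^ k] for [0 < k] the displacement in the
    slab [k] is of order [K ^ - k] while its slope is of order [2 ^ k], so the
    force is of order [4 ^ k * K ^ - k] with Lipschitz constant of order [8 ^ k].
    Interpolating, it is Hölder with exponent [al] once [K ^ (1 - al) >= 8]
    ([holder_interpolation], [force_holder]).  For the exponent [0] one takes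
    [al = 1 / 2]. *)

(** * Lebesgue measure on the plane and on space; translations *)

Notation mR R := (measurableTypeR R).

Lemma product_sigma_finite d1 d2 (T1 : measurableType d1)
    (T2 : measurableType d2) (R : realType)
    (m1 : {sigma_finite_measure set T1 -> \bar R})
    (m2 : {sigma_finite_measure set T2 -> \bar R}) :
  sigma_finite setT (m1 \x m2)%E.
Proof.
have /sigma_finiteP[F [UF ndF finF]] := sigma_finiteT m1.
have /sigma_finiteP[G [UG ndG finG]] := sigma_finiteT m2.
exists (fun n => F n `*` G n).
  apply/seteqP; split=> // -[x y] _.
  have [n _ Fx] : (\bigcup_n F n) x by rewrite -UF.
  have [k _ Gy] : (\bigcup_n G n) y by rewrite -UG.
  exists (maxn n k) => //; split => /=.
    by move: x Fx; exact/subsetPset/ndF/leq_maxl.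
  by move: y Gy; exact/subsetPset/ndG/leq_maxr.
move=> n; have [mF oF] := finF n; have [mG oG] := finG n.
split; first exact: measurableX.
by rewrite product_measure1E// lte_mul_pinfty// ge0_fin_numE.
Qed.

Section Plane.
Context {R : realType}.

(** The product measures used to define [mu_space] and [mu_spacetime] come
    without the sigma-finiteness that Tonelli and Fubini require; [mu_plane] and
    [mu_solid] are the same measures with that structure. *)
Definition mu_plane : set (mR R * mR R)%type -> \bar R :=
  (@mu_time R \x @mu_time R)%E.
HB.instance Definition _ := Measure.on mu_plane.
HB.instance Definition _ := Measure_isSigmaFinite.Build _ _ _ mu_plane
  (product_sigma_finite (@mu_time R) (@mu_time R)).

Definition mu_solid : set (mR R * mR R * mR R)%type -> \bar R :=
  (mu_plane \x @mu_time R)%E.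
HB.instance Definition _ := Measure.on mu_solid.
HB.instance Definition _ := Measure_isSigmaFinite.Build _ _ _ mu_solid
  (product_sigma_finite mu_plane (@mu_time R)).

Lemma space_tonelli (f : R * R * R -> \bar R) :
  measurable_fun [set: R * R * R] f -> (forall x, 0 <= f x)%E ->
  (\int[mu_space]_x f x
   = \int[mu_time]_z \int[mu_time]_y \int[mu_time]_x f (x, y, z))%E.
Proof.
move=> mf f0.
rewrite -[LHS]/(\int[mu_plane \x mu_time]_x f x)%E.
rewrite fubini_tonelli2//; apply: eq_integral => z _.
apply: (fubini_tonelli2 (m1 := mu_time) (m2 := mu_time)
  (fun xy => f (xy, z))) => //.
exact: measurableT_comp.
Qed.

End Plane.

Section Shift.
Context {R : realType}.
Local Notation mu1 := (@mu_time R).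

Lemma periodic_intmul (V : zmodType) (U : Type) (f : V -> U) (e : V) :
  (forall x, f (x + e) = f x) -> forall (z : int) x, f (x + e *~ z) = f x.
Proof.
move=> fe.
have fn n x : f (x + e *+ n) = f x.
  by elim: n x => [|n IH] x; rewrite ?mulr0n ?addr0// mulrS addrA IH fe.
case=> n x; first by rewrite -pmulrn fn.
by rewrite NegzE mulrNz -pmulrn -[in RHS](subrK (e *+ n.+1) x) fn.
Qed.

(** Both measures agree on intervals. *)
Lemma lebesgue_measure_shift (a : R) (A : set R) : measurable A ->
  pushforward mu1 ((fun y => y + a) : mR R -> mR R) A = mu1 A.
Proof.
have ma : measurable_fun [set: mR R] ((fun y => y + a) : mR R -> mR R).
  by apply: measurable_funD => //; exact: measurable_cst.
pose mf := isMeasurableFun.Build _ _ _ _ _ ma.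
pose phi : {mfun _ >-> _} := HB.pack ((fun y => y + a) : mR R -> mR R) mf.
move=> mA; apply/esym.
apply: (@lebesgue_measure_unique _ (pushforward mu1 phi)) => //= _ [[x y]] _ <-.
rewrite /pushforward/= /mu_time.
rewrite (_ : _ @^-1` _ = `]x - a, y - a]%classic); last first.
  by apply/seteqP; split=> t /=; rewrite !in_itv/= ltrBlDr lerBrDr.
rewrite !lebesgue_measure_itv/= !lte_fin ltrD2r.
by case: ifP => // _; rewrite -!EFinB; congr EFin; ring.
Qed.

Local Open Scope ereal_scope.

Lemma integral_itv_shift (G : R -> \bar R) (a b c : R) :
  measurable_fun [set: R] G -> (forall x, 0 <= G x) ->
  \int[mu1]_(y in `[a, b[) G (y + c)%R
  = \int[mu1]_(y in `[(a + c)%R, (b + c)%R[) G y.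
Proof.
move=> mG G0.
pose phi := ((fun y => y + c)%R : mR R -> mR R).
have mphi : measurable_fun [set: mR R] phi.
  by apply: measurable_funD => //; exact: measurable_cst.
rewrite (_ : `[a, b[%classic = phi @^-1` `[(a + c)%R, (b + c)%R[); last first.
  by apply/seteqP; split=> t /=; rewrite !in_itv/= lerD2r ltrD2r.
rewrite -(ge0_integral_pushforward (phi := phi) mphi)//.
- by apply: eq_measure_integral => A mA _; exact: lebesgue_measure_shift.
- exact: measurable_funS mG.
Qed.

(** The shifted interval [a, 1 + a[ is cut at [1], and the part beyond [1] is
    a translate of [0, a[. *)
Lemma integral_period_shift (G : R -> \bar R) (a : R) :
  measurable_fun [set: R] G -> (forall x, 0 <= G x) ->
  (forall x, G (x + 1)%R = G x) ->
  \int[mu1]_(y in `[0%R, 1%R[) G (y + a)%R = \int[mu1]_(y in `[0%R, 1%R[) G y.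
Proof.
move=> mG G0 G1.
wlog /andP[a0 a1] : a / (0 <= a <= 1)%R.
  move=> H; rewrite -[RHS](H (a - (Num.floor a)%:~R)%R).
    apply: eq_integral => y _.
    by rewrite -[RHS](periodic_intmul G1 (Num.floor a)) -addrA subrK.
  rewrite subr_ge0 Num.Theory.floor_le/= lerBlDl.
  have /ltW := Num.Theory.floorD1_gt a; by rewrite intrD addrC.
have split0 (x y z : R) : (x <= y)%R -> (y <= z)%R ->
    \int[mu1]_(t in `[x, z[) G t
    = \int[mu1]_(t in `[x, y[) G t + \int[mu1]_(t in `[y, z[) G t.
  move=> xy yz; rewrite -ge0_integral_setU//=.
  - by rewrite -itv_bndbnd_setU ?bnd_simp.
  - exact: measurable_funS mG.
  - apply/disj_setPS => t [/=]; rewrite !in_itv/= => /andP[_ ty] /andP[yt _].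
    by move: (lt_le_trans ty yt); rewrite ltxx.
rewrite integral_itv_shift// add0r (split0 _ 1%R)//; last first.
  by rewrite lerDl.
rewrite addeC [in RHS](split0 _ a)//; congr (_ + _).
rewrite -[X in `[X, _[](add0r 1%R) [X in `[_, X[](addrC 1%R).
rewrite -integral_itv_shift//.
by apply: eq_integral => y _; rewrite G1.
Qed.

End Shift.

(** * Coordinates, and shears of the unit cube *)

Section CoordinateShift.
Context {R : realType}.
Local Notation mu1 := (@mu_time R).
Local Notation S := (space3 R).

(** Each axis is treated through [coord] and [set_coord], so that the same
    argument serves the three directions. *)
Definition coord (j : 'I_3) (x : S) : R :=
  match val j with 0%N => x.1.1 | 1%N => x.1.2 | _ => x.2 end.

Definition set_coord (j : 'I_3) (x : S) (s : R) : S :=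
  match val j with
  | 0%N => (s, x.1.2, x.2) | 1%N => (x.1.1, s, x.2) | _ => (x.1, s)
  end.

Lemma ord3P (P : 'I_3 -> Prop) : P 0 -> P 1 -> P 2%:R -> forall j, P j.
Proof.
move=> P0 P1 P2 [[|[|[|j]]] ij] //.
- by rewrite (_ : Ordinal ij = 0)//; exact: val_inj.
- by rewrite (_ : Ordinal ij = 1)//; exact: val_inj.
- by rewrite (_ : Ordinal ij = 2%:R)//; exact: val_inj.
Qed.

Lemma shiftE j (x : S) a : x + a *: unit_vec j = set_coord j x (coord j x + a).
Proof.
case: x => -[x y] z.
transitivity ((x + a * (j == 0)%:R, y + a * (j == 1)%:R, z + a * (j == 2)%:R)).
  by [].
by elim/ord3P: j; rewrite /set_coord /coord/= ?mulr1 ?mulr0 ?addr0.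
Qed.

Lemma measurable_coord j : measurable_fun [set: S] (coord j).
Proof.
elim/ord3P: j; rewrite /coord/=.
- exact: measurableT_comp.
- exact: measurableT_comp.
- exact: measurable_snd.
Qed.

Lemma measurable_set_coord j d (T : measurableType d) (f : T -> S) (g : T -> R) :
  measurable_fun [set: T] f -> measurable_fun [set: T] g ->
  measurable_fun [set: T] (fun x => set_coord j (f x) (g x)).
Proof.
move=> mf mg; have m1 : measurable_fun [set: T] (fun x => (f x).1).
  exact: measurableT_comp.
have m2 : measurable_fun [set: T] (fun x => (f x).2) by exact: measurableT_comp.
have m11 : measurable_fun [set: T] (fun x => (f x).1.1).
  exact: measurableT_comp m1.
have m12 : measurable_fun [set: T] (fun x => (f x).1.2).
  exact: measurableT_comp m1.
elim/ord3P: j; rewrite /set_coord/=.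
- by apply: measurable_fun_pair => //; apply: measurable_fun_pair.
- by apply: measurable_fun_pair => //; apply: measurable_fun_pair.
- by apply: measurable_fun_pair.
Qed.

Lemma measurable_shift j d (T : measurableType d) (f : T -> S) (g : T -> R) :
  measurable_fun [set: T] f -> measurable_fun [set: T] g ->
  measurable_fun [set: T] (fun x => f x + g x *: unit_vec j).
Proof.
move=> mf mg; under eq_fun do rewrite shiftE.
apply: measurable_set_coord => //; apply: measurable_funD => //.
exact: measurableT_comp (measurable_coord j) mf.
Qed.

Lemma measurable_cube : measurable (@cube R).
Proof. by do 2?apply: measurableX; exact: measurable_itv. Qed.

Local Open Scope ereal_scope.

(** Tonelli, with the variable number [j] integrated first. *)
Lemma eq_cube_integral j (f g : S -> \bar R) :
  measurable_fun [set: S] f -> measurable_fun [set: S] g ->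
  (forall x, 0 <= f x) -> (forall x, 0 <= g x) ->
  (forall x, \int[mu1]_(s in `[0%R, 1%R[) f (set_coord j x s)
           = \int[mu1]_(s in `[0%R, 1%R[) g (set_coord j x s)) ->
  \int[mu_space]_(x in cube) f x = \int[mu_space]_(x in cube) g x.
Proof.
move=> mf mg f0 g0 fg; rewrite integral_mkcond [RHS]integral_mkcond.
have mcube (h : S -> \bar R) : measurable_fun [set: S] h ->
    measurable_fun [set: S] (h \_ cube).
  move=> mh; apply/(measurable_restrictT _ measurable_cube).
  exact: measurable_funS mh.
have cube0 (h : S -> \bar R) : (forall x, 0 <= h x) ->
    forall x, 0 <= (h \_ cube) x.
  by move=> h0 x; rewrite patchE; case: ifPn.
have line (x : S) : \int[mu1]_s (f \_ cube) (set_coord j x s)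
                  = \int[mu1]_s (g \_ cube) (set_coord j x s).
  pose D : Prop := match val j with
    | 0%N => (0 <= x.1.2 < 1)%R /\ (0 <= x.2 < 1)%R
    | 1%N => (0 <= x.1.1 < 1)%R /\ (0 <= x.2 < 1)%R
    | _ => (0 <= x.1.1 < 1)%R /\ (0 <= x.1.2 < 1)%R end.
  have inE' s : cube (set_coord j x s) <-> D /\ (0 <= s < 1)%R.
    rewrite /D /cube; elim/ord3P: (j); rewrite /set_coord/= !in_itv/=; tauto.
  have eqh (h : S -> \bar R) : \int[mu1]_s (h \_ cube) (set_coord j x s) =
      if `[< D >] then \int[mu1]_(s in `[0%R, 1%R[) h (set_coord j x s) else 0.
    case: ifPn => /asboolP hD.
      rewrite [RHS]integral_mkcond; apply: eq_integral => s _; rewrite !patchE.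
      congr (if _ then _ else _); apply/idP/idP; rewrite !inE /= in_itv/= inE';
        tauto.
    apply: integral0_eq => s _; rewrite patchE memNset// inE'; tauto.
  by rewrite !eqh fg.
move: (mcube _ mf) (mcube _ mg) (cube0 _ f0) (cube0 _ g0) line => {mf mg f0 g0 fg}.
move: (f \_ cube) (g \_ cube) => {}f {}g mf mg f0 g0.
move: j {mcube cube0}; apply: ord3P; rewrite /set_coord/= => fg.
- rewrite (space_tonelli mf f0) (space_tonelli mg g0); apply: eq_integral => z _;
  apply: eq_integral => y _.
  exact: (fg (0%R, y, z)).
- rewrite (space_tonelli mf f0) (space_tonelli mg g0); apply: eq_integral => z _.
  have sw (h : S -> \bar R) : measurable_fun [set: S] h ->
      (forall x, 0 <= h x) -> \int[mu1]_y \int[mu1]_x h (x, y, z)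
      = \int[mu1]_x \int[mu1]_y h (x, y, z).
    move=> mh h0; apply/esym.
    apply: (fubini_tonelli (m1 := mu1) (m2 := mu1) (fun u => h (u, z))) => //.
    exact: measurableT_comp.
  by rewrite (sw f)// (sw g)//; apply: eq_integral => x _; exact: (fg (x, 0%R, z)).
- have sw (h : S -> \bar R) : measurable_fun [set: S] h ->
      (forall x, 0 <= h x) ->
      \int[mu_space]_x h x = \int[mu_plane]_u \int[mu1]_z h (u, z).
    by move=> mh h0; exact: (fubini_tonelli1 (m1 := mu_plane) (m2 := mu1) h).
  by rewrite (sw f)// (sw g)//; apply: eq_integral => u _; exact: (fg (u, 0%R)).
Qed.

(** On each line in the direction [j] the displacement [a] is constant, so
    the shear acts there as a translation of a periodic function. *)
Lemma ge0_cube_integral_shift j (a : S -> R) (G : S -> \bar R) :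
  measurable_fun [set: S] a -> (forall x s, a (set_coord j x s) = a x) ->
  measurable_fun [set: S] G -> (forall x, 0 <= G x) ->
  (forall x, G (x + unit_vec j)%R = G x) ->
  \int[mu_space]_(x in cube) G (x + a x *: unit_vec j)%R
  = \int[mu_space]_(x in cube) G x.
Proof.
move=> ma aj mG G0 G1.
have mS : measurable_fun [set: S] (fun x => (x + a x *: unit_vec j)%R).
  exact: measurable_shift.
have set2 x s t : set_coord j (set_coord j x s) t = set_coord j x t.
  by case: x => -[? ?] ?; elim/ord3P: j {ma aj mG G0 G1 mS}.
have coords x s : coord j (set_coord j x s) = s.
  by case: x => -[? ?] ?; elim/ord3P: j {ma aj mG G0 G1 mS set2}.
apply: (@eq_cube_integral j) => //; first exact: measurableT_comp.
move=> x; under eq_integral do rewrite shiftE aj set2 coords.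
apply: (@integral_period_shift R (fun s => G (set_coord j x s))) => //.
  by apply: measurableT_comp => //; apply: measurable_set_coord.
move=> s; rewrite -[in RHS]G1 -[unit_vec j]scale1r shiftE set2 coords.
by [].
Qed.

End CoordinateShift.

(** * Integrals of bounded functions on sets of finite measure *)

Section BoundedIntegrals.
Context d (T : measurableType d) (R : realType).
Variable mu : {measure set T -> \bar R}.
Implicit Types (f g : T -> R) (M : R).
Variables (A : set T).
Hypothesis mA : measurable A.
Hypothesis finA : (mu A < +oo)%E.

Lemma integrable_bound f M : measurable_fun A f ->
  (forall x, A x -> `|f x| <= M) -> mu.-integrable A (EFin \o f).
Proof.
move=> mf fM; apply: measurable_bounded_integrable => //.
exists M; split; first exact: num_real.
by move=> N MN x /fM /le_trans; apply; exact: ltW.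
Qed.

Lemma Rintegral_bound f M : measurable_fun A f ->
  (forall x, A x -> `|f x| <= M) ->
  `|\int[mu]_(x in A) f x| <= M * fine (mu A).
Proof.
move=> mf fM; have intf := integrable_bound mf fM.
apply: le_trans (le_normr_Rintegral _ _) _ => //.
rewrite -Rintegral_cst//; apply: le_Rintegral => //.
- apply: (@integrable_bound _ M); first exact: measurableT_comp.
  by move=> x /fM; rewrite normr_id.
- by apply: (@integrable_bound _ `|M|) => //; exact: measurable_cst.
Qed.

End BoundedIntegrals.

Section BoundedFubini.
Context d1 d2 (T1 : measurableType d1) (T2 : measurableType d2) (R : realType).
Variable m1 : {sigma_finite_measure set T1 -> \bar R}.
Variable m2 : {sigma_finite_measure set T2 -> \bar R}.
Variables (A : set T1) (B : set T2).
Hypotheses (mA : measurable A) (mB : measurable B).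
Hypotheses (finA : (m1 A < +oo)%E) (finB : (m2 B < +oo)%E).
Variables (H : T1 * T2 -> R) (M : R).
Hypothesis mH : measurable_fun [set: T1 * T2] H.
Hypothesis HM : forall x y, A x -> B y -> `|H (x, y)| <= M.

Let mAB : measurable (A `*` B). Proof. exact: measurableX. Qed.
Let K : T1 * T2 -> \bar R := (EFin \o H) \_ (A `*` B).

Let intK : (m1 \x m2)%E.-integrable setT K.
Proof.
apply/(integrable_mkcond (EFin \o H) mAB).
apply: (@integrable_bound _ _ _ (m1 \x m2)%E _ _ _ _ M) => //.
- rewrite [ltLHS](product_measure1E m1 m2 mA mB).
  by rewrite lte_mul_pinfty// ge0_fin_numE.
- exact: measurable_funS mH.
- by case=> x y [] /=; exact: HM.
Qed.

Let mH1 x : measurable_fun [set: T2] (fun y => H (x, y)).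
Proof. exact: measurableT_comp. Qed.

Let mH2 y : measurable_fun [set: T1] (fun x => H (x, y)).
Proof. exact: measurableT_comp. Qed.

Let KE1 x : (\int[m2]_y K (x, y))%E = ((fun x => \int[m2]_(y in B) H (x, y))%R
  \_ A x)%:E.
Proof.
rewrite patchE; case: ifPn => [|] xA.
  move/set_mem in xA; rewrite /Rintegral fineK; last first.
    apply: integrable_fin_num => //.
    apply: (@integrable_bound _ _ _ _ _ _ _ _ M) => //.
      exact: measurable_funS (mH1 x).
    by move=> y By; exact: HM.
  rewrite [RHS]integral_mkcond; apply: eq_integral => y _.
  rewrite /K !patchE; congr (if _ then _ else _).
  by apply/idP/idP; rewrite !inE => //= -[].
apply: integral0_eq => y _; rewrite /K patchE memNset//= => -[].
by move/mem_set; rewrite (negbTE xA).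
Qed.

Let KE2 y : (\int[m1]_x K (x, y))%E = ((fun y => \int[m1]_(x in A) H (x, y))%R
  \_ B y)%:E.
Proof.
rewrite patchE; case: ifPn => [|] yB.
  move/set_mem in yB; rewrite /Rintegral fineK; last first.
    apply: integrable_fin_num => //.
    apply: (@integrable_bound _ _ _ _ _ _ _ _ M) => //.
      exact: measurable_funS (mH2 y).
    by move=> x Ax; exact: HM.
  rewrite [RHS]integral_mkcond; apply: eq_integral => x _.
  rewrite /K !patchE; congr (if _ then _ else _).
  by apply/idP/idP; rewrite !inE => //= -[].
apply: integral0_eq => x _; rewrite /K patchE memNset//= => -[_].
by move/mem_set; rewrite (negbTE yB).
Qed.

Lemma measurable_fun_Rintegral2 :
  measurable_fun B (fun y => \int[m1]_(x in A) H (x, y)).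
Proof.
apply/(measurable_restrictT _ mB)/measurable_EFinP.
rewrite [X in measurable_fun _ X](_ : _ = fubini_G m1 K).
  exact: (measurable_fubini_G intK).
by apply/funext => y; rewrite /fubini_G KE2.
Qed.

(** Restricted to [A `*` B], a bounded function is integrable for the
    product measure. *)
Lemma bounded_Fubini :
  \int[m2]_(y in B) (\int[m1]_(x in A) H (x, y))
  = \int[m1]_(x in A) (\int[m2]_(y in B) H (x, y)).
Proof.
rewrite Rintegral_mkcond [RHS]Rintegral_mkcond /Rintegral; congr fine.
under eq_integral do rewrite -KE2.
under [RHS]eq_integral do rewrite -KE1.
by rewrite (Fubini intK).
Qed.

End BoundedFubini.

(** * Integrals over the torus and over time intervals *)

Section TorusIntegral.
Context {R : realType}.
Local Notation S := (space3 R).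
Implicit Types (f g : S -> R) (M c : R).

Definition bounded_meas (f : S -> R) :=
  measurable_fun [set: S] f /\ exists M : R, forall x, `|f x| <= M.

Lemma bounded_meas_cst c : bounded_meas (fun=> c).
Proof. by split; [exact: measurable_cst|exists `|c|]. Qed.

Lemma bounded_measD f g : bounded_meas f -> bounded_meas g ->
  bounded_meas (fun x => f x + g x).
Proof.
move=> [mf [M fM]] [mg [N gN]]; split; first exact: measurable_funD.
by exists (M + N) => x; rewrite (le_trans (ler_normD _ _))// lerD.
Qed.

Lemma bounded_measM f g : bounded_meas f -> bounded_meas g ->
  bounded_meas (fun x => f x * g x).
Proof.
move=> [mf [M fM]] [mg [N gN]]; split; first exact: measurable_funM.
by exists (M * N) => x; rewrite normrM ler_pM.
Qed.

Lemma bounded_measN f : bounded_meas f -> bounded_meas (fun x => - f x).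
Proof.
move=> [mf [M fM]]; split; first exact: measurable_funN.
by exists M => x; rewrite normrN.
Qed.

Lemma bounded_measB f g : bounded_meas f -> bounded_meas g ->
  bounded_meas (fun x => f x - g x).
Proof. by move=> bf bg; apply: bounded_measD => //; exact: bounded_measN. Qed.

Lemma bounded_meas_norm f : bounded_meas f -> bounded_meas (fun x => `|f x|).
Proof.
move=> [mf [M fM]]; split; first exact: measurableT_comp.
by exists M => x; rewrite normr_id.
Qed.

Lemma bounded_meas_comp f (g : S -> S) : measurable_fun [set: S] g ->
  bounded_meas f -> bounded_meas (fun x => f (g x)).
Proof.
move=> mg [mf [M fM]]; split; first exact: (measurableT_comp mf mg).
by exists M.
Qed.

Lemma mu_cube : mu_space (@cube R) = 1%E.
Proof.
rewrite -[LHS]/((mu_plane \x mu_time)%E _) /cube.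
rewrite product_measure1E//=; last exact: measurableX.
rewrite -[X in (X * _)%E]/((mu_time \x mu_time)%E _) product_measure1E//=.
by rewrite /mu_time/= lebesgue_measure_itv/= lte_fin ltr01 -EFinB subr0 !mule1.
Qed.

Lemma mu_cube_fin : (mu_space (@cube R) < +oo)%E.
Proof. by rewrite mu_cube ltry. Qed.

Lemma torus_integrable f : bounded_meas f ->
  mu_space.-integrable cube (EFin \o f).
Proof.
move=> [mf [M fM]]; apply: (@integrable_bound _ _ _ _ _ _ _ _ M) => //.
- exact: measurable_cube.
- exact: mu_cube_fin.
- exact: measurable_funS mf.
Qed.

Lemma eq_torus_int f g : f =1 g -> torus_int f = torus_int g.
Proof. by move=> fg; apply: eq_Rintegral => x _; exact: fg. Qed.

Lemma torus_intD f g : bounded_meas f -> bounded_meas g ->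
  torus_int (fun x => f x + g x) = torus_int f + torus_int g.
Proof.
by move=> bf bg; apply: RintegralD; [exact: measurable_cube|
  exact: torus_integrable..].
Qed.

Lemma torus_intB f g : bounded_meas f -> bounded_meas g ->
  torus_int (fun x => f x - g x) = torus_int f - torus_int g.
Proof.
by move=> bf bg; apply: RintegralB; [exact: measurable_cube|
  exact: torus_integrable..].
Qed.

Lemma torus_intZ c f : bounded_meas f ->
  torus_int (fun x => c * f x) = c * torus_int f.
Proof.
by move=> bf; apply: RintegralZl; [exact: measurable_cube|
  exact: torus_integrable].
Qed.

Lemma torus_int_cst c : torus_int (fun=> c) = c.
Proof.
rewrite /torus_int Rintegral_cst ?mu_cube/= ?mulr1//; exact: measurable_cube.
Qed.

Lemma le_torus_int f g : bounded_meas f -> bounded_meas g ->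
  (forall x, f x <= g x) -> torus_int f <= torus_int g.
Proof.
by move=> bf bg fg; apply: le_Rintegral; [exact: measurable_cube|
  exact: torus_integrable..|move=> x _].
Qed.

Lemma normr_torus_int f : bounded_meas f ->
  `|torus_int f| <= torus_int (fun x => `|f x|).
Proof.
by move=> bf; apply: le_normr_Rintegral; [exact: measurable_cube|
  exact: torus_integrable].
Qed.

Lemma torus_int_bound f M : measurable_fun [set: S] f ->
  (forall x, `|f x| <= M) -> `|torus_int f| <= M.
Proof.
move=> mf fM; have bf : bounded_meas f by split=> //; exists M.
apply: le_trans (normr_torus_int bf) _; rewrite -[leRHS]torus_int_cst.
by apply: le_torus_int => //; [exact: bounded_meas_norm|
  exact: bounded_meas_cst].
Qed.

(** Volume preservation by shears. *)
Lemma torus_int_shift j (a : S -> R) (G : S -> R) :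
  measurable_fun [set: S] a -> (forall x s, a (set_coord j x s) = a x) ->
  measurable_fun [set: S] G -> (forall x, G (x + unit_vec j) = G x) ->
  torus_int (fun x => G (x + a x *: unit_vec j)) = torus_int G.
Proof.
move=> ma aj mG G1; rewrite /torus_int /Rintegral; congr fine.
rewrite integralE [RHS]integralE.
congr (_ - _)%E.
- have E := @ge0_cube_integral_shift _ j a (fun x => maxe (G x)%:E 0%E) ma aj.
  rewrite (eq_integral _ _ (fun x _ => funeposE _ x)).
  rewrite (eq_integral _ _ (fun x _ => funeposE _ x)); apply: E.
  + by apply: measurable_maxe => //; exact/measurable_EFinP.
  + by move=> x; rewrite le_max lexx orbT.
  + by move=> x; rewrite G1.
- have E := @ge0_cube_integral_shift _ j a (fun x => maxe (- (G x)%:E)%E 0%E) ma aj.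
  rewrite (eq_integral _ _ (fun x _ => funenegE _ x)).
  rewrite (eq_integral _ _ (fun x _ => funenegE _ x)); apply: E.
  + apply: measurable_maxe => //; apply: measurableT_comp => //.
    exact/measurable_EFinP.
  + by move=> x; rewrite le_max lexx orbT.
  + by move=> x; rewrite G1.
Qed.

End TorusIntegral.

Section TimeIntegral.
Context {R : realType}.
Local Notation S := (space3 R).
Implicit Types (a b c : R) (f g F : R -> R) (M N : R).

Lemma mu_time_itv a b : (@mu_time R `]a, b[%classic < +oo)%E.
Proof.
by rewrite /mu_time/= lebesgue_measure_itv/=; case: ifP => // _; rewrite ltry.
Qed.

Lemma eq_time_int a b f g : (forall t, a < t < b -> f t = g t) ->
  time_int a b f = time_int a b g.
Proof.
move=> fg; apply: eq_Rintegral => t; rewrite inE/= in_itv/=; exact: fg.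
Qed.

Lemma time_int_bound a b f M : a <= b -> measurable_fun `]a, b[ f ->
  (forall t, a < t < b -> `|f t| <= M) -> `|time_int a b f| <= M * (b - a).
Proof.
move=> ab mf fM.
have := @Rintegral_bound _ _ _ (@mu_time R) `]a, b[%classic _ (mu_time_itv a b)
  f M mf.
rewrite {2}/mu_time/= lebesgue_measure_itv/= lte_fin.
rewrite (_ : fine _ = b - a); last first.
  case: ltP => [//|ba]; have -> : a = b by apply/eqP; rewrite eq_le ab ba.
  by rewrite subrr.
by apply => // t; rewrite /= in_itv/=; exact: fM.
Qed.

Lemma time_integrable a b f M : measurable_fun `]a, b[ f ->
  (forall t, a < t < b -> `|f t| <= M) ->
  mu_time.-integrable `]a, b[ (EFin \o f).
Proof.
by move=> mf fM; apply: (@integrable_bound _ _ _ _ _ _ (mu_time_itv a b) _ M).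
Qed.

Lemma time_int_split a b c f M : a <= b -> b <= c ->
  measurable_fun `]a, c[ f -> (forall t, a < t < c -> `|f t| <= M) ->
  time_int a c f = time_int a b f + time_int b c f.
Proof.
move=> ab bc mf fM.
have [->|anb] := eqVneq a b.
  by rewrite /time_int [X in X + _](_ : _ = 0) ?add0r// set_itv_ge
    ?Rintegral_set0 ?bnd_simp ?ltxx.
have [->|bnc] := eqVneq b c.
  by rewrite /time_int [X in _ + X](_ : _ = 0) ?addr0// set_itv_ge
    ?Rintegral_set0 ?bnd_simp ?ltxx.
have {}ab : a < b by rewrite lt_neqAle anb.
have {}bc : b < c by rewrite lt_neqAle bnc.
have intf := time_integrable mf fM.
have := @Rintegral_itvB _ f (BRight a) (BLeft c) b intf.
rewrite !bnd_simp => /(_ (ltW ab) bc).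
rewrite -(@Rintegral_itv_bndo_bndc _ (BRight a) b f); last first.
  by apply: integrableS intf => //; apply: subset_itvl; rewrite bnd_simp ltW.
move=> E; have {}E : time_int a c f - time_int a b f = time_int b c f by [].
by rewrite -E addrC subrK.
Qed.

Lemma time_intD a b f g M N : measurable_fun `]a, b[ f ->
  (forall t, a < t < b -> `|f t| <= M) -> measurable_fun `]a, b[ g ->
  (forall t, a < t < b -> `|g t| <= N) ->
  time_int a b (fun t => f t + g t) = time_int a b f + time_int a b g.
Proof.
move=> mf fM mg gN; apply: RintegralD => //; first exact: (time_integrable mf fM).
exact: (time_integrable mg gN).
Qed.

Lemma time_int_FTC a b f F : a <= b -> continuous f ->
  (forall t : R, is_derive t (1 : R) F (f t)) -> time_int a b f = F b - F a.
Proof.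
rewrite le_eqVlt => /predU1P[->|ab] cf dF.
  by rewrite /time_int set_itv_ge ?Rintegral_set0 ?bnd_simp ?ltxx// subrr.
have cF : continuous F.
  by move=> t; apply: differentiable_continuous; apply/derivable1_diffP.
have := @continuous_FTC2 _ f F a b ab (continuous_subspaceT cf).
rewrite /time_int /Rintegral => H.
rewrite integral_itv_bndo_bndc; last first.
  by apply/measurable_EFinP; apply: measurable_funS (continuous_measurable_fun cf).
rewrite integral_itv_obnd_cbnd; last first.
  by apply/measurable_EFinP; apply: measurable_funS (continuous_measurable_fun cf).
rewrite H//.
- split.
  + by move=> t _.
  + by apply: cvg_at_right_filter; exact: cF.
  + by apply: cvg_at_left_filter; exact: cF.
- by move=> t _; rewrite derive1E derive_val.
Qed.

(** The last two conclusions make the inner integral itself a legitimate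
    integrand. *)
Lemma torus_time_Fubini a b (H : S * R -> R) M : measurable_fun [set: S * R] H ->
  (forall x t, a < t < b -> `|H (x, t)| <= M) ->
  [/\ time_int a b (fun t => torus_int (fun x => H (x, t)))
      = torus_int (fun x => time_int a b (fun t => H (x, t))),
      measurable_fun `]a, b[ (fun t => torus_int (fun x => H (x, t))) &
      forall t, a < t < b -> `|torus_int (fun x => H (x, t))| <= M].
Proof.
move=> mH HM.
have HM' x t : cube x -> `]a, b[%classic t -> `|H (x, t)| <= M.
  by move=> _; rewrite /= in_itv/=; exact: HM.
split.
- exact: (bounded_Fubini (m1 := mu_solid) (m2 := mu_time) measurable_cube _
    mu_cube_fin (mu_time_itv a b) mH HM').
- exact: (measurable_fun_Rintegral2 (m1 := mu_solid) (m2 := mu_time)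
    measurable_cube _ mu_cube_fin (mu_time_itv a b) mH HM').
- move=> t abt; apply: torus_int_bound; last by move=> x; exact: HM.
  exact: measurableT_comp.
Qed.

End TimeIntegral.

(** * Measurability of continuous functions of space and time *)

Section Caratheodory.
Context {R : realType}.

(** By continuity in [t], the function is the pointwise limit of the
    functions obtained by rounding [t] down to a multiple of [1 / n.+1]; these
    are measurable since [t] then takes countably many values. *)
Lemma caratheodory_measurable d (T : measurableType d) (g : T * R -> R) :
  (forall t, measurable_fun [set: T] (fun x => g (x, t))) ->
  (forall x, continuous (fun t => g (x, t))) ->
  measurable_fun [set: T * R] g.
Proof.
move=> mg cg.
pose q n (t : R) : R := (Num.floor (n.+1%:R * t))%:~R / n.+1%:R.
apply: (@measurable_fun_cvg _ _ _ _ (fun n z => g (z.1, q n z.2))) => [n|[x t] _].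
  move=> _ Y mY; rewrite setTI.
  rewrite (_ : _ @^-1` Y = \bigcup_(k : int)
    (((fun x => g (x, k%:~R / n.+1%:R)) @^-1` Y) `*`
     [set t | Num.floor (n.+1%:R * t) = k])); last first.
    apply/seteqP; split=> [[x t] /= Yg|[x t] [k _ [/= + E]]]; last by rewrite /q E.
    by exists (Num.floor (n.+1%:R * t)).
  apply: countable_bigcupT_measurable => [|k]; first exact: countableP.
  apply: measurableX.
    by rewrite -[X in measurable X]setTI; exact: mg.
  rewrite (_ : [set t | _] = ( *%R n.+1%:R) @^-1` `[k%:~R, (k + 1)%:~R[).
    by rewrite -[X in measurable X]setTI; apply: mulrl_measurable => //.
  apply/seteqP; split=> t /=; rewrite in_itv/=.
    by move=> <-; rewrite Num.Theory.floor_le Num.Theory.floorD1_gt.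
  by move/Num.Theory.floor_def.
have qt : q n t @[n --> \oo] --> t.
  apply: (squeeze_cvgr (f := fun n => t - n.+1%:R^-1) (h := fun=> t)).
  - near=> n; have n0 : 0 < n.+1%:R :> R by rewrite ltr0n.
    have lo := Num.Theory.floor_le (n.+1%:R * t).
    have := Num.Theory.floorD1_gt (n.+1%:R * t); rewrite intrD => hi.
    rewrite /q ler_pdivrMr// ler_pdivlMr// mulrBl mulVf ?gt_eqF//.
    by rewrite [t * _]mulrC lo andbT lerBlDr ltW.
  - rewrite -[X in _ --> X]subr0; apply: cvgB; first exact: cvg_cst.
    exact: cvg_harmonic.
  - exact: cvg_cst.
exact: (cvg_comp _ _ qt (cg x t)).
Unshelve. all: by end_near. Qed.

Lemma continuous_slice (V : topologicalType) (f : V * R -> R) :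
  continuous f -> (forall t, continuous (fun x => f (x, t))) /\
                  (forall x, continuous (fun t => f (x, t))).
Proof.
move=> cf; split=> [t x|x t].
- apply: (@cvg_comp _ _ _ (fun u => (u, t)) f _ _ _ _ (cf (x, t))).
  exact: (@cvg_pair _ _ _ _ (nbhs x) (nbhs t) _ _ _ id (fun=> t) cvg_id
    (cvg_cst t)).
- apply: (@cvg_comp _ _ _ (fun u => (x, u)) f _ _ _ _ (cf (x, t))).
  exact: (@cvg_pair _ _ _ _ (nbhs x) (nbhs t) _ _ _ (fun=> x) id (cvg_cst x)
    cvg_id).
Qed.

Lemma continuous_measurable_spacetime (f : R * R * R * R -> R) :
  continuous f -> measurable_fun [set: R * R * R * R] f.
Proof.
move=> /continuous_slice[f4 f4']; apply: caratheodory_measurable => // t.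
have [f3 f3'] := continuous_slice (f4 t).
apply: caratheodory_measurable => // z.
have [f2 f2'] := continuous_slice (f3 z).
apply: caratheodory_measurable => // y.
exact: continuous_measurable_fun (f2 y).
Qed.

End Caratheodory.

(** * Scalar test functions *)

Section TestFunctions.
Context {R : realType}.
Local Notation S := (space3 R).
Local Notation ST := (spacetime R).
Implicit Types psi : ST -> R.

(** All that the weak formulation uses of a test function.  Working with
    first derivatives only keeps the class closed under taking components. *)
Definition C1_periodic psi :=
  [/\ forall z, differentiable psi z, forall u : ST, continuous ('D_u psi) &
      space_periodic psi].

Lemma smooth_C1 psi : smooth psi -> space_periodic psi -> C1_periodic psi.
Proof.
move=> sm per; split=> // [z|u z]; first exact: (sm [::]).
exact: differentiable_continuous (sm [:: u] z).
Qed.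

Lemma smooth_derive_coord (phi : ST -> vec3 R) (i : 'I_3) (u z : ST) :
  smooth phi -> ('D_u phi z) 0 i = 'D_u (fun z => phi z 0 i) z.
Proof.
by move=> sm; rewrite derive_mx ?mxE//; apply: diff_derivable; exact: (sm [::]).
Qed.

Lemma smooth_coord_C1 (phi : ST -> vec3 R) (i : 'I_3) :
  smooth phi -> space_periodic phi -> C1_periodic (fun z => phi z 0 i).
Proof.
move=> sm per; split=> [z|u z|t j x].
- apply: (@differentiable_comp _ _ _ _ phi (fun M : vec3 R => M 0 i)).
    exact: (sm [::]).
  exact: differentiable_coord.
- rewrite (_ : 'D_u _ = fun z => ('D_u phi z) 0 i); last first.
    by apply/funext => w; rewrite smooth_derive_coord.
  apply: (@cvg_comp _ _ _ ('D_u phi) (fun M : vec3 R => M 0 i)).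
    exact: differentiable_continuous (sm [:: u] z).
  exact: coord_continuous.
- by rewrite (per t j x).
Qed.

Lemma C1_continuous psi : C1_periodic psi -> continuous psi.
Proof. by case=> dpsi _ _ z; exact: differentiable_continuous. Qed.

Lemma derive_space_periodic psi u : space_periodic psi ->
  space_periodic ('D_u psi).
Proof.
move=> per t j x; rewrite /derive.
suff -> : (fun h => h^-1 *: (psi (h *: u + (x + unit_vec j, t)) -
    psi (x + unit_vec j, t))) =
  (fun h => h^-1 *: (psi (h *: u + (x, t)) - psi (x, t))) by [].
apply/funext => h; rewrite (per t j x).
have -> : h *: u + (x + unit_vec j, t) = (h *: u.1 + x + unit_vec j, h *: u.2 + t).
  by rewrite -addrA.
by rewrite (per _ j _).
Qed.

(** Periodicity brings the point into the compact [0, 1]^3 x [a, b]. *)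
Lemma space_periodic_bounded psi (a b : R) : continuous psi ->
  space_periodic psi ->
  exists M : R, forall x t, a <= t <= b -> `|psi (x, t)| <= M.
Proof.
move=> cpsi per.
have : compact (`[0, 1]%classic `*` `[0, 1]%classic `*` `[0, 1]%classic
    `*` `[a, b]%classic : set ST).
  by do !apply: compact_setX; exact: segment_compact.
move=> /(continuous_compact (continuous_subspaceT cpsi))/compact_bounded[M [_ HM]].
exists (M + 1) => x t abt.
pose red j (x : S) : S := x + unit_vec j *~ (- Num.floor (coord j x)).
have redE j y : psi (red j y, t) = psi (y, t).
  exact: (periodic_intmul (f := fun x => psi (x, t)) (per t j)).
have redS j y : red j y = set_coord j y (coord j y - (Num.floor (coord j y))%:~R).
  by rewrite /red -scaler_int shiftE intrN.
have frac01 (s : R) : 0 <= s - (Num.floor s)%:~R <= 1.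
  rewrite subr_ge0 Num.Theory.floor_le/= lerBlDl.
  by have /ltW := Num.Theory.floorD1_gt s; rewrite intrD.
rewrite -(redE 0) -(redE 1) -(redE 2%:R).
apply: (HM (M + 1)); first by rewrite ltrDl.
exists (red 2%:R (red 1 (red 0 x)), t) => //.
rewrite !redS /set_coord /coord/=.
by do ![split]; rewrite /= in_itv/=.
Qed.

Lemma C1_bounded psi u (a b : R) : C1_periodic psi ->
  exists M : R, forall x t, a <= t <= b ->
    `|psi (x, t)| <= M /\ `|'D_u psi (x, t)| <= M.
Proof.
move=> Cpsi; have cpsi := C1_continuous Cpsi; case: Cpsi => _ cd per.
have [M HM] := space_periodic_bounded a b cpsi per.
have [N HN] := space_periodic_bounded a b (cd u) (derive_space_periodic u per).
exists (Num.max M N) => x t abt; rewrite !le_max HM//= HN//; split=> //.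
by rewrite orbT.
Qed.

(** Chain rule along the trajectory of a particle moved by a shear. *)
Lemma is_derive_path (V : normedModType R) (psi : V * R -> R) (y e : V)
    (th : R -> R) (t dth g : R) :
  (forall z, differentiable psi z) -> is_derive t (1 : R) th dth ->
  is_derive t (1 : R) (fun t => psi (y + (th t * g) *: e, t))
   (dth * g * 'D_(e, 0) psi (y + (th t * g) *: e, t)
    + 'D_(0, 1) psi (y + (th t * g) *: e, t)).
Proof.
move=> dpsi dth'.
pose k := fun t : R => th t * g.
have Dk : is_derive t (1 : R) k (dth * g).
  by apply: is_derive_eq; rewrite scaler0 add0r mulrC.
have dk : differentiable k t by apply/derivable1_diffP.
have kE : 'd k t = (fun h => h *: (dth * g)) :> (R -> R).
  by rewrite diff1E// derive1E derive_val.
have IZ : is_diff t (fun t => k t *: e) (fun h => (h *: (dth * g)) *: e).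
  apply: DiffDef; first exact: differentiableZl.
  by rewrite diffZl// kE.
pose gam := fun t : R => (y + k t *: e, t) : V * R.
have Igam : is_diff t gam (fun h => (0 + (h *: (dth * g)) *: e, h)).
  by apply: is_diff_pair; exact: is_diffD.
have dgam : differentiable gam t by [].
have gamE : 'd gam t 1 = ((dth * g) *: e, 1).
  by rewrite diff_val scale1r add0r.
have -> : (fun t => psi (y + (th t * g) *: e, t)) = psi \o gam by [].
apply: DeriveDef.
  by apply/derivable1_diffP; exact: differentiable_comp.
rewrite deriveE; last exact: differentiable_comp.
rewrite diff_comp//= gamE !deriveE// -linearZ -linearD; congr ('d psi _ _).
rewrite -[(dth * g) *: (e, 0)]/((dth * g) *: e, (dth * g) *: (0 : R)) scaler0.
by rewrite -[RHS]/(_ + 0, 0 + 1) addr0 add0r.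
Qed.

End TestFunctions.

(** * Transport of a scalar by one shear *)

Section Transport.
Context {R : realType}.
Local Notation S := (space3 R).
Local Notation ST := (spacetime R).
Implicit Types (psi : ST -> R) (f g : S -> R).

(** A coefficient that does not depend on the variable [j] is constant along
    a shear in the direction [j]. *)
Definition coord_free j (U : Type) (g : S -> U) :=
  forall x s, g (set_coord j x s) = g x.

Lemma coord_free_shift j U (g : S -> U) x s : coord_free j g ->
  g (x + s *: unit_vec j) = g x.
Proof. by move=> gj; rewrite shiftE gj. Qed.

Lemma continuous_segment_bound (f : R -> R) a b : continuous f ->
  exists M : R, forall t, a <= t <= b -> `|f t| <= M.
Proof.
move=> cf.
have := @segment_compact R a b.
move=> /(continuous_compact (continuous_subspaceT cf))/compact_bounded[M [_ HM]].
exists (M + 1) => t abt; apply: (HM (M + 1)); first by rewrite ltrDl.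
by exists t => //=; rewrite in_itv/=.
Qed.

(** Exchange the integrals and apply the fundamental theorem of calculus
    at each point of space. *)
Lemma time_int_torus_FTC (a b M : R) f (K H : S * R -> R) : a <= b ->
  bounded_meas f -> measurable_fun [set: S * R] K ->
  (forall x t, a < t < b -> `|K (x, t)| <= M) ->
  (forall x, continuous (fun t => K (x, t))) ->
  (forall x (t : R), is_derive t (1 : R) (fun t => H (x, t)) (K (x, t))) ->
  time_int a b (fun t => torus_int (fun x => f x * K (x, t)))
  = torus_int (fun x => f x * (H (x, b) - H (x, a))).
Proof.
move=> ab [mf [N fN]] mK KM cK dH.
have [|x t abt| E _ _] := @torus_time_Fubini _ a b (fun z => f z.1 * K z) (N * M).
- by apply: measurable_funM => //; exact: measurableT_comp.
- by rewrite normrM ler_pM//; exact: KM.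
rewrite /= in E; rewrite E; apply: eq_torus_int => x.
rewrite -(@time_int_FTC _ a b _ (fun t => H (x, t)) ab (cK x) (dH x)).
rewrite /time_int RintegralZl//.
apply: (@time_integrable _ a b _ M) => [|t abt]; last exact: KM.
exact: measurable_funS (continuous_measurable_fun (cK x)).
Qed.

Lemma is_derive_line (V : normedModType R) (psi : V -> R) (z u : V) (s : R) :
  (forall z, differentiable psi z) ->
  is_derive s (1 : R) (fun s => psi (z + s *: u)) ('D_u psi (z + s *: u)).
Proof.
move=> dpsi; have := diff_derivable (v := u) (dpsi (z + s *: u)).
have E : (fun h : R => h^-1 *: (psi (z + (h *: (1 : R) + s) *: u) - psi (z + s
  *: u)))
  = (fun h : R => h^-1 *: (psi (h *: u + (z + s *: u)) - psi (z + s *: u))).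
  apply/funext => h; congr (_ *: (psi _ - _)).
  by rewrite [h *: 1]mulr1 scalerDl addrCA.
by move=> dz; apply: DeriveDef; rewrite /derivable /derive /= E.
Qed.

Lemma is_derive_time psi (x : S) (t : R) : C1_periodic psi ->
  is_derive t (1 : R) (fun t => psi (x, t)) ('D_(0, 1) psi (x, t)).
Proof.
move=> [dpsi _ _].
have lineE r : (x, r) = (x, 0) + r *: (0, 1) :> ST.
  by rewrite -[RHS]/(x + r *: 0, 0 + r * 1) scaler0 addr0 add0r mulr1.
under [X in is_derive _ _ X]eq_fun do rewrite lineE.
by rewrite lineE; exact: is_derive_line.
Qed.

(** Since [a] ignores the variable [j], the integral is the same for all the
    translates of [psi] along [j]; averaged over a period of translations it is
    that of [a x] times the increment of [psi] over a period, which is [0]. *)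
Lemma torus_int_partial_eq0 j (a : S -> R) psi (t : R) : C1_periodic psi ->
  bounded_meas a -> coord_free j a ->
  torus_int (fun x => a x * 'D_(unit_vec j, 0) psi (x, t)) = 0.
Proof.
move=> Cpsi ba aj; have [dpsi cd per] := Cpsi.
have [M HM] := C1_bounded (unit_vec j, 0) t t Cpsi.
have mD : measurable_fun [set: ST] ('D_(unit_vec j, 0) psi).
  exact: continuous_measurable_spacetime.
have mline : measurable_fun [set: S * R]
    (fun z : S * R => (z.1 + z.2 *: unit_vec j, t) : ST).
  apply: measurable_fun_pair => //; first exact: measurable_shift.
have dline x (s : R) : is_derive s (1 : R)
    (fun s => psi (x + s *: unit_vec j, t))
    ('D_(unit_vec j, 0) psi (x + s *: unit_vec j, t)).
  have lineE r : (x + r *: unit_vec j, t) = (x, t) + r *: (unit_vec j, 0) :> ST.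
    by rewrite -[RHS]/(_, t + r *: (0 : R)) scaler0 addr0.
  under [X in is_derive _ _ X]eq_fun do rewrite lineE.
  by rewrite lineE; exact: is_derive_line.
have E : time_int 0 1 (fun s => torus_int (fun x =>
    a x * 'D_(unit_vec j, 0) psi (x + s *: unit_vec j, t))) = 0.
  rewrite (@time_int_torus_FTC 0 1 M a
    (fun z => 'D_(unit_vec j, 0) psi (z.1 + z.2 *: unit_vec j, t))
    (fun z => psi (z.1 + z.2 *: unit_vec j, t)) ler01 ba _ _ _ dline)/=.
  - under eq_torus_int.
      move=> x; rewrite scale1r scale0r addr0 (per t j x) subrr mulr0; over.
    by rewrite torus_int_cst.
  - exact: (measurableT_comp mD mline).
  - by move=> x s _; apply: (HM _ _ _).2; rewrite lexx.
  - move=> x s; apply: (@cvg_comp _ _ _ (fun s : R => (x + s *: unit_vec j, t))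
      ('D_(unit_vec j, 0) psi)); last exact: cd.
    apply: (@cvg_pair _ _ _ _ (nbhs (x + s *: unit_vec j)) (nbhs t)).
      apply: cvgD; first exact: cvg_cst.
      by apply: cvgZl; exact: cvg_id.
    exact: cvg_cst.
rewrite -[RHS]E (@eq_time_int _ _ _ _ (fun=> torus_int (fun x =>
    a x * 'D_(unit_vec j, 0) psi (x, t)))).
  rewrite /time_int Rintegral_cst//= /mu_time lebesgue_measure_itv/= lte_fin ltr01.
  by rewrite -EFinB subr0 mulr1.
move=> s _.
rewrite -(@torus_int_shift _ j (fun=> s) (fun x =>
    a x * 'D_(unit_vec j, 0) psi (x, t))).
- by apply: eq_torus_int => x; rewrite /= (coord_free_shift x s aj).
- exact: measurable_cst.
- by [].
- apply: measurable_funM; first by case: ba.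
  apply: (measurableT_comp mD); apply: measurable_fun_pair => //.
- move=> x; rewrite -[in LHS](scale1r (unit_vec j)) (coord_free_shift x 1 aj)
  scale1r.
  by rewrite (derive_space_periodic _ per).
Qed.

(** Volume preservation turns the left-hand integrand at time [t] into [f x]
    times the time derivative of [psi] along the trajectory
    [x + (th t * g x) *: unit_vec j], and the integral in time is a difference
    of end values.  This is the weak form of the transport equation, for a
    scalar [f] with no regularity. *)
Lemma shear_weak_identity j (a b : R) f g psi (th th1 : R -> R) : a <= b ->
  bounded_meas f -> (forall x, f (x + unit_vec j) = f x) ->
  bounded_meas g -> coord_free j g -> C1_periodic psi ->
  (forall t : R, is_derive t (1 : R) th (th1 t)) -> continuous th1 ->
  time_int a b (fun t => torus_int (fun x =>
    f (x - (th t * g x) *: unit_vec j) *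
    (th1 t * g x * 'D_(unit_vec j, 0) psi (x, t) + 'D_(0, 1) psi (x, t))))
  = torus_int (fun x => f (x - (th b * g x) *: unit_vec j) * psi (x, b))
  - torus_int (fun x => f (x - (th a * g x) *: unit_vec j) * psi (x, a)).
Proof.
move=> ab bf fper bg gj Cpsi dth cth1; have [dpsi cd per] := Cpsi.
have [mf [Mf fM]] := bf; have [mg [Mg gM]] := bg.
have cth : continuous th.
  by move=> t; apply: differentiable_continuous; apply/derivable1_diffP.
have [Mx HMx] := C1_bounded (unit_vec j, 0) a b Cpsi.
have [Mt HMt] := C1_bounded (0, 1) a b Cpsi.
have [Mth HMth] := continuous_segment_bound a b cth1.
have mD u : measurable_fun [set: ST] ('D_u psi).
  exact: continuous_measurable_spacetime.
have mpsi : measurable_fun [set: ST] psi.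
  exact: continuous_measurable_spacetime (C1_continuous Cpsi).
have gshift x s : g (x + s *: unit_vec j) = g x by exact: (coord_free_shift x s gj).
have gper x : g (x + unit_vec j) = g x.
  by rewrite -[unit_vec j]scale1r gshift.
pose path t (x : S) := x + (th t * g x) *: unit_vec j.
have unshear t (X : S -> R) : measurable_fun [set: S] X ->
    (forall x, X (x + unit_vec j) = X x) ->
    torus_int (fun x => f (x - (th t * g x) *: unit_vec j) * X x)
    = torus_int (fun x => f x * X (path t x)).
  move=> mX Xper.
  rewrite -(@torus_int_shift _ j (fun x => th t * g x)).
  - by apply: eq_torus_int => x; rewrite gshift addrK.
  - by apply: measurable_funM => //; exact: measurable_cst.
  - by move=> x s; rewrite gj.
  - apply: measurable_funM => //; apply: (measurableT_comp mf).
    under eq_fun do rewrite -scaleNr.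
    apply: measurable_shift => //; apply: measurable_funN.
    by apply: measurable_funM => //; exact: measurable_cst.
  - by move=> x; rewrite gper Xper addrAC fper.
pose K := fun z : S * R => th1 z.2 * g z.1 *
  'D_(unit_vec j, 0) psi (path z.2 z.1, z.2) + 'D_(0, 1) psi (path z.2 z.1, z.2).
pose H := fun z : S * R => psi (path z.2 z.1, z.2).
have mg1 : measurable_fun [set: S * R] (fun z : S * R => g z.1).
  exact: measurableT_comp.
have mth2 (h : R -> R) : continuous h ->
    measurable_fun [set: S * R] (fun z : S * R => h z.2).
  by move=> ch; apply: (measurableT_comp (continuous_measurable_fun ch)).
have mpath : measurable_fun [set: S * R] (fun z : S * R => (path z.2 z.1, z.2)
  : ST).
  apply: measurable_fun_pair => //; apply: measurable_shift => //.
  by apply: measurable_funM => //; exact: mth2.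
have slice (X : ST -> R) t : measurable_fun [set: ST] X ->
    measurable_fun [set: S] (fun x => X (x, t)).
  move=> mX; apply: (measurableT_comp mX); apply: measurable_fun_pair => //.
have mpatht t : measurable_fun [set: S] (path t).
  by apply: measurable_shift => //; apply: measurable_funM => //;
    exact: measurable_cst.
have bH t : a <= t <= b -> bounded_meas (fun x => f x * psi (path t x, t)).
  move=> abt; apply: bounded_measM => //; split.
    exact: measurableT_comp (slice _ t mpsi) (mpatht t).
  by exists Mx => x; have [] := HMx (path t x) t abt.
have dH x (t : R) : is_derive t (1 : R) (fun t => H (x, t)) (K (x, t)).
  exact: is_derive_path.
have := fun mK KM cK =>
  @time_int_torus_FTC a b (Mth * Mg * Mx + Mt) f K H ab bf mK KM cK dH.
have -> : torus_int (fun x => f x * (H (x, b) - H (x, a))) =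
    torus_int (fun x => f (x - (th b * g x) *: unit_vec j) * psi (x, b))
  - torus_int (fun x => f (x - (th a * g x) *: unit_vec j) * psi (x, a)).
  rewrite unshear; [|exact: slice|by move=> x; rewrite (per b)].
  rewrite unshear; [|exact: slice|by move=> x; rewrite (per a)].
  rewrite -torus_intB; [|by apply: bH; rewrite ab lexx..].
  by apply: eq_torus_int => x; rewrite /H mulrBr.
move=> <-.
- apply: eq_time_int => t abt.
  rewrite unshear//.
  + by apply: eq_torus_int => x; rewrite /path gshift.
  + apply: measurable_funD; last exact: (slice _ t (mD _)).
    apply: measurable_funM; last exact: (slice _ t (mD _)).
    by apply: measurable_funM => //; exact: measurable_cst.
  + by move=> x; rewrite gper !(derive_space_periodic _ per).
- apply: measurable_funD; last exact: (measurableT_comp (mD _) mpath).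
  apply: measurable_funM; last exact: (measurableT_comp (mD _) mpath).
  by apply: measurable_funM => //; exact: mth2.
- move=> x t /andP[/ltW at_ /ltW tb]; have abt : a <= t <= b by rewrite at_.
  rewrite /K/= (le_trans (ler_normD _ _))// lerD//; last first.
    by have [] := HMt (path t x) t abt.
  rewrite !normrM; apply: ler_pM => //.
    by apply: ler_pM => //; exact: HMth.
  by have [] := HMx (path t x) t abt.
- move=> x t.
  have cpath : (path s x, s) @[s --> t] --> nbhs ((path t x, t) : ST).
    apply: (@cvg_pair _ _ _ _ (nbhs (path t x)) (nbhs t)); last exact: cvg_id.
    apply: cvgD; first exact: cvg_cst.
    by apply: cvgZl; apply: cvgM; [exact: cth|exact: cvg_cst].
  apply: cvgD; last exact: (cvg_comp _ _ cpath (cd _ _)).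
  apply: cvgM; last exact: (cvg_comp _ _ cpath (cd _ _)).
  by apply: cvgM; [exact: cth1|exact: (cvg_cst (g x))].
Qed.

End Transport.

(** * The forced Euler equations during one shear *)

Section SlabIdentity.
Context {R : realType}.
Local Notation S := (space3 R).
Local Notation ST := (spacetime R).
Implicit Types (psi : ST -> R) (f g : S -> R).

Definition basis_vec (i : 'I_3) : vec3 R := delta_mx 0 i.

Lemma one_basisE j (a : R) i : (a *: basis_vec j) 0 i = a * (i == j)%:R.
Proof. by rewrite !mxE eqxx. Qed.

Lemma two_basisE j k (a b : R) i :
  (a *: basis_vec j + b *: basis_vec k) 0 i = a * (i == j)%:R + b * (i == k)%:R.
Proof. by rewrite mxE !one_basisE. Qed.

Lemma dot_two j k (a b : R) (u : vec3 R) :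
  dot (a *: basis_vec j + b *: basis_vec k) u = a * u 0 j + b * u 0 k.
Proof.
rewrite /dot.
transitivity (\sum_i (a * ((i == j)%:R * u 0 i) + b * ((i == k)%:R * u 0 i))).
  by apply: eq_bigr => i _; rewrite !mxE/= !mulrA mulrDl.
rewrite big_split/= -!mulr_sumr.
rewrite (bigD1 j)//= eqxx mul1r big1 ?addr0; last first.
  by move=> i /negbTE ->; rewrite mul0r.
rewrite (bigD1 k)//= eqxx mul1r big1 ?addr0//.
by move=> i /negbTE ->; rewrite mul0r.
Qed.

Lemma dot_one j (a : R) (u : vec3 R) : dot (a *: basis_vec j) u = a * u 0 j.
Proof. by have := dot_two j j a 0 u; rewrite scale0r addr0 mul0r addr0. Qed.

Lemma quadratic_two j k (a b : R) (v : vec3 R) (X : 'I_3 -> vec3 R) :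
  v = a *: basis_vec j + b *: basis_vec k ->
  \sum_i \sum_l v 0 i * v 0 l * X l 0 i =
  a * (a * X j 0 j + b * X k 0 j) + b * (a * X j 0 k + b * X k 0 k).
Proof.
move=> vE.
transitivity (dot v (\row_i dot v (\row_l X l 0 i))).
  rewrite /dot; apply: eq_bigr => i _; rewrite mxE mulr_sumr.
  by apply: eq_bigr => l _; rewrite mxE mulrA.
by rewrite vE !dot_two !mxE !dot_two !mxE.
Qed.

Lemma C1_slice psi u (t : R) : C1_periodic psi ->
  bounded_meas (fun x => psi (x, t)) /\ bounded_meas (fun x => 'D_u psi (x, t)).
Proof.
move=> Cpsi; have [dpsi cd per] := Cpsi.
have [M HM] := C1_bounded u t t Cpsi.
have m (X : ST -> R) : continuous X -> measurable_fun [set: S] (fun x => X (x, t)).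
  move=> cX; apply: (measurableT_comp (continuous_measurable_spacetime cX)).
  exact: measurable_fun_pair.
split; split.
- by apply: (m psi); exact: C1_continuous.
- by exists M => x; have [] := HM x t; rewrite ?lexx.
- exact: (m ('D_u psi)).
- by exists M => x; have [] := HM x t; rewrite ?lexx.
Qed.

Lemma set_coordC j (x : S) (s c : R) : j != 2%:R ->
  set_coord j (set_coord 2%:R x s) (coord j (set_coord 2%:R x s) + c)
  = set_coord 2%:R (set_coord j x (coord j x + c)) s.
Proof. by case: x => -[? ?] ?; elim/ord3P: j; rewrite ?eqxx. Qed.

Variables (j : 'I_3) (a b : R) (f g : S -> R) (th th1 th2 : R -> R).
Hypotheses (j2 : j != 2%:R) (ab : a <= b).
Hypotheses (bf : bounded_meas f) (fper : forall x, f (x + unit_vec j) = f x).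
Hypotheses (f2 : coord_free 2%:R f).
Hypotheses (bg : bounded_meas g) (gj : coord_free j g) (g2 : coord_free 2%:R g).
Hypothesis dth : forall t : R, is_derive t (1 : R) th (th1 t).
Hypothesis dth1 : forall t : R, is_derive t (1 : R) th1 (th2 t).
Hypothesis cth2 : continuous th2.

Definition shear_scalar (x : S) (t : R) := f (x - (th t * g x) *: unit_vec j).

(** A shear flow in the direction [j], with the scalar that it transports as
    vertical component. *)
Definition shear_field (x : S) (t : R) : vec3 R :=
  (th1 t * g x) *: basis_vec j + shear_scalar x t *: basis_vec 2%:R.
Definition shear_force (x : S) (t : R) : vec3 R := (th2 t * g x) *: basis_vec j.

Let cth1 : continuous th1.
Proof. by move=> t; apply: differentiable_continuous; apply/derivable1_diffP. Qed.

Let cth : continuous th.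
Proof. by move=> t; apply: differentiable_continuous; apply/derivable1_diffP. Qed.

Lemma shear_scalar_coord_free t : coord_free 2%:R (shear_scalar ^~ t).
Proof.
have E y : shear_scalar y t = f (set_coord j y (coord j y - th t * g y)).
  by rewrite /shear_scalar -scaleNr shiftE.
move=> x s; rewrite !E g2.
have -> : set_coord j (set_coord 2%:R x s)
    (coord j (set_coord 2%:R x s) - th t * g x) =
  set_coord 2%:R (set_coord j x (coord j x - th t * g x)) s.
  exact: set_coordC.
by rewrite f2.
Qed.

Lemma bounded_shear_scalar t : bounded_meas (shear_scalar ^~ t).
Proof.
apply: bounded_meas_comp bf; under eq_fun do rewrite -scaleNr.
apply: measurable_shift => //; apply: measurable_funN; case: bg => mg _.
by apply: measurable_funM => //; exact: measurable_cst.
Qed.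

(** Expand the quadratic term.  The products in which the derivative falls on
    a direction that their coefficient ignores integrate to [0]; the other ones
    are the transport of the vertical component ([shear_weak_identity]) and the
    time derivative of [th1 t * g], which the force balances. *)
Lemma slab_weak (phi : ST -> vec3 R) : smooth phi -> space_periodic phi ->
  time_int a b (fun t => torus_int (fun x =>
      dot (shear_field x t) (time_partial phi (x, t))
    + \sum_i \sum_k shear_field x t 0 i * shear_field x t 0 k
        * space_partial k phi (x, t) 0 i
    + dot (shear_force x t) (phi (x, t))))
  = torus_int (fun x => dot (shear_field x b) (phi (x, b)))
  - torus_int (fun x => dot (shear_field x a) (phi (x, a))).
Proof.
move=> sm per.
pose ph i := fun z => phi z 0 i.
have Cph i : C1_periodic (ph i) by exact: smooth_coord_C1.
have DE u i z : ('D_u phi z) 0 i = 'D_u (ph i) z by exact: smooth_derive_coord.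
have [mf [Mf fM]] := bf; have [mg [Mg gM]] := bg.
pose P1 := fun z : S * R => th1 z.2 * 'D_(0, 1) (ph j) z + th2 z.2 * ph j z.
pose P2 := fun z : S * R => shear_scalar z.1 z.2 *
  (th1 z.2 * g z.1 * 'D_(unit_vec j, 0) (ph 2%:R) z + 'D_(0, 1) (ph 2%:R) z).
have slice i u t := C1_slice u t (Cph i).
have bZ (c : R) (X : S -> R) : bounded_meas X -> bounded_meas (fun x => c * X x).
  by apply: bounded_measM; exact: bounded_meas_cst.
have bP1 t : bounded_meas (fun x => g x * P1 (x, t)).
  apply: bounded_measM => //; apply: bounded_measD.
    exact: (bZ (th1 t) _ (slice j (0, 1) t).2).
  exact: (bZ (th2 t) _ (slice j (0, 1) t).1).
have bw t := bounded_shear_scalar t.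
have bP2 t : bounded_meas (fun x => P2 (x, t)).
  apply: bounded_measM; first exact: bw.
  apply: bounded_measD; last exact: (slice 2%:R (0, 1) t).2.
  by apply: bounded_measM;
    [exact: (bZ (th1 t) _ bg)|exact: (slice 2%:R (unit_vec j, 0) t).2].
have bthg (h : R -> R) t : bounded_meas (fun x => h t * g x).
  exact: (bZ (h t) _ bg).
have spaceE t : torus_int (fun x =>
      dot (shear_field x t) (time_partial phi (x, t))
    + \sum_i \sum_k shear_field x t 0 i * shear_field x t 0 k
        * space_partial k phi (x, t) 0 i
    + dot (shear_force x t) (phi (x, t)))
  = torus_int (fun x => g x * P1 (x, t)) + torus_int (fun x => P2 (x, t)).
  (* These coefficients come with a derivative in a direction that they ignore. *)
  pose c3 x := (th1 t * g x) * (th1 t * g x).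
  pose c4 x := (th1 t * g x) * shear_scalar x t.
  pose c5 x := shear_scalar x t * shear_scalar x t.
  have alg x (A C : vec3 R) (B : 'I_3 -> vec3 R) :
      dot (shear_field x t) A
      + \sum_i \sum_k shear_field x t 0 i * shear_field x t 0 k * B k 0 i
      + dot (shear_force x t) C =
      (g x * (th1 t * A 0 j + th2 t * C 0 j)
       + shear_scalar x t * (th1 t * g x * B j 0 2%:R + A 0 2%:R))
      + (c3 x * B j 0 j + c4 x * B 2%:R 0 j + c5 x * B 2%:R 0 2%:R).
    rewrite (@quadratic_two j 2%:R (th1 t * g x) (shear_scalar x t)
      (shear_field x t) B erefl) dot_two dot_one /c3 /c4 /c5.
    ring.
  transitivity (torus_int (fun x => (g x * P1 (x, t) + P2 (x, t)) +
     ((c3 x * 'D_(unit_vec j, 0) (ph j) (x, t)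
       + c4 x * 'D_(unit_vec 2%:R, 0) (ph j) (x, t))
      + c5 x * 'D_(unit_vec 2%:R, 0) (ph 2%:R) (x, t)))).
    apply: eq_torus_int => x.
    rewrite (alg x (time_partial phi (x, t)) (phi (x, t))
      (fun l => space_partial l phi (x, t))).
    by congr (_ * (_ * _ + _ * _) + _ * (_ * _ + _)
              + (_ * _ + _ * _ + _ * _)); exact: DE.
  have b3 : bounded_meas c3 by exact: bounded_measM.
  have b4 : bounded_meas c4 by exact: bounded_measM.
  have b5 : bounded_meas c5 by exact: bounded_measM.
  have bD k i c : bounded_meas c ->
      bounded_meas (fun x => c x * 'D_(unit_vec k, 0) (ph i) (x, t)).
    by move=> bc; exact: bounded_measM bc (slice i (unit_vec k, 0) t).2.
  have w2 := shear_scalar_coord_free t.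
  pose q k i c x := c x * 'D_(unit_vec k, 0) (ph i) (x, t).
  have q3 : torus_int (q j j c3) = 0.
    by apply: torus_int_partial_eq0 => // x s; rewrite /c3 gj.
  have q4 : torus_int (q 2%:R j c4) = 0.
    by apply: torus_int_partial_eq0 => // x s; rewrite /c4 w2 g2.
  have q5 : torus_int (q 2%:R 2%:R c5) = 0.
    by apply: torus_int_partial_eq0 => // x s; rewrite /c5 w2.
  have bq34 := bounded_measD (bD j j c3 b3) (bD 2%:R j c4 b4).
  have Dq := torus_intD bq34 (bD 2%:R 2%:R c5 b5).
  have Dq34 := torus_intD (bD j j c3 b3) (bD 2%:R j c4 b4).
  apply: etrans (torus_intD (bounded_measD (bP1 t) (bP2 t))
    (bounded_measD bq34 (bD 2%:R 2%:R c5 b5))) _.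
  rewrite Dq Dq34 [X in X + _ + _]q3 [X in _ + X + _]q4 [X in _ + _ + X]q5 !addr0.
  exact: torus_intD.
rewrite (eq_time_int (g := fun t => torus_int (fun x => g x * P1 (x, t))
   + torus_int (fun x => P2 (x, t)))); last by move=> t _; exact: spaceE.
have [M1 HM1] := continuous_segment_bound a b cth1.
have [M2 HM2] := continuous_segment_bound a b cth2.
have [N1 HN1] := C1_bounded (0, 1) a b (Cph j).
have [N2 HN2] := C1_bounded (0, 1) a b (Cph 2%:R).
have [N3 HN3] := C1_bounded (unit_vec j, 0) a b (Cph 2%:R).
have mD u i : measurable_fun [set: ST] ('D_u (ph i)).
  by apply: continuous_measurable_spacetime; case: (Cph i).
have mph i : measurable_fun [set: ST] (ph i).
  exact: continuous_measurable_spacetime (C1_continuous (Cph i)).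
have mg1 : measurable_fun [set: S * R] (fun z : S * R => g z.1).
  exact: measurableT_comp.
have mt (h : R -> R) : continuous h ->
    measurable_fun [set: S * R] (fun z : S * R => h z.2).
  by move=> ch; apply: (measurableT_comp (continuous_measurable_fun ch)).
have mw : measurable_fun [set: S * R] (fun z : S * R => shear_scalar z.1 z.2).
  apply: (measurableT_comp mf); under eq_fun do rewrite -scaleNr.
  apply: measurable_shift => //; apply: measurable_funN.
  by apply: measurable_funM => //; exact: mt.
have mP1 : measurable_fun [set: S * R] P1.
  by apply: measurable_funD; apply: measurable_funM => //; exact: mt.
have mP2 : measurable_fun [set: S * R] P2.
  apply: measurable_funM => //; apply: measurable_funD; last exact: mD.
  by apply: measurable_funM; [apply: measurable_funM => //; exact: mt|exact: mD].
have ooE t : a < t < b -> a <= t <= b by move=> /andP[/ltW -> /ltW ->].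
have P1M x t : a < t < b -> `|P1 (x, t)| <= M1 * N1 + M2 * N1.
  move=> /ooE abt; have [? ?] := HN1 x t abt.
  rewrite (le_trans (ler_normD _ _))//= !normrM lerD// ler_pM//.
  - exact: HM1.
  - exact: HM2.
have P2M x t : a < t < b -> `|P2 (x, t)| <= Mf * (M1 * Mg * N3 + N2).
  move=> /ooE abt; have [? ?] := HN2 x t abt; have [? ?] := HN3 x t abt.
  rewrite normrM ler_pM// ?fM//.
  rewrite (le_trans (ler_normD _ _))//= lerD// !normrM; apply: ler_pM => //.
  by apply: ler_pM => //; exact: HM1.
have [||_ mI1 bI1] := @torus_time_Fubini _ a b (fun z => g z.1 * P1 z)
    (Mg * (M1 * N1 + M2 * N1)).
- by apply: measurable_funM.
- by move=> x t abt; rewrite normrM ler_pM// P1M.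
have [||_ mI2 bI2] := @torus_time_Fubini _ a b P2 (Mf * (M1 * Mg * N3 + N2)) => //.
rewrite (time_intD mI1 bI1 mI2 bI2).
rewrite (@shear_weak_identity _ j a b f g (ph 2%:R) th th1)//.
have dH x (t : R) : is_derive t (1 : R) (fun t => th1 t * ph j (x, t)) (P1 (x, t)).
  have D := is_derive_time x t (Cph j).
  apply: is_derive_eq; rewrite /P1/=.
  by rewrite -[_ *: _]/(_ * _) -[X in _ + X]/(_ * _) [ph j _ * _]mulrC.
rewrite (@time_int_torus_FTC _ a b (M1 * N1 + M2 * N1) g P1
  (fun z => th1 z.2 * ph j z) ab bg mP1 P1M _ dH); last first.
  move=> x t; have ct X : continuous X -> continuous (fun t : R => X (x, t) : R).
    by move=> cX; have [_] := continuous_slice cX; exact.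
  apply: cvgD; apply: cvgM.
  - exact: cth1.
  - by apply: (ct ('D_(0, 1) (ph j))); case: (Cph j).
  - exact: cth2.
  - by apply: (ct (ph j)); exact: C1_continuous.
rewrite [X in X + _](_ : _ = torus_int (fun x => th1 b * g x * ph j (x, b)) -
   torus_int (fun x => th1 a * g x * ph j (x, a))); last first.
  have bt t : bounded_meas (fun x => th1 t * g x * ph j (x, t)).
    by apply: bounded_measM (slice j (0, 1) t).1; exact: bthg.
  rewrite -torus_intB//; apply: eq_torus_int => x /=; ring.
have BE t : torus_int (fun x => dot (shear_field x t) (phi (x, t))) =
   torus_int (fun x => th1 t * g x * ph j (x, t))
   + torus_int (fun x => shear_scalar x t * ph 2%:R (x, t)).
  rewrite -torus_intD.
  - by apply: eq_torus_int => x; rewrite dot_two.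
  - by apply: bounded_measM (slice j (0, 1) t).1; exact: bthg.
  - exact: bounded_measM (bw t) (slice 2%:R (0, 1) t).1.
rewrite !BE /shear_scalar; ring.
Qed.

End SlabIdentity.

(** * Dyadic slabs around the singular time *)

Section Dyadic.
Context {R : realType}.

(** Half-widths of the slabs [tau k.+1 < `|t - 1| <= tau k]. *)
Definition tau (m : nat) : R := 2^-1 ^+ m.

Lemma tau_gt0 m : 0 < tau m. Proof. by rewrite exprn_gt0// invr_gt0. Qed.

Lemma tauS m : tau m = tau m.+1 + tau m.+1.
Proof. by rewrite /tau exprS; field. Qed.

Lemma tau_le m : tau m.+1 <= tau m.
Proof. by rewrite [leRHS]tauS lerDl ltW ?tau_gt0. Qed.

Lemma tau0 : tau 0 = 1. Proof. by []. Qed.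

Lemma tau_le1 m : tau m <= 1.
Proof. by elim: m => [|m IH]; rewrite ?tau0// (le_trans (tau_le m)). Qed.

Lemma tau_homo m n : (m <= n)%N -> tau n <= tau m.
Proof.
move/subnK => <-; elim: (n - m)%N => [//|k IH].
by rewrite addSn; apply: le_trans (tau_le _) IH.
Qed.

Lemma cvg_tau : tau m @[m --> \oo] --> (0 : R).
Proof.
by apply: cvg_expr; rewrite ger0_norm ?invr_ge0// invf_lt1// ltr1n.
Qed.

Lemma eq0_le_cvg0 (x : R) (u : nat -> R) : (forall m, `|x| <= u m) ->
  u m @[m --> \oo] --> (0 : R) -> x = 0.
Proof.
move=> xu u0; apply/eqP; rewrite -normr_le0 -(cvg_lim _ u0)//.
by apply: limr_ge; [apply/cvg_ex; exists 0|near=> n; exact: xu].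
Unshelve. all: by end_near. Qed.

(** Telescoping on both sides of [1].  The contribution of the remaining
    middle interval tends to [0] since [G] is bounded, and the two telescoping
    sums fit together in the limit because [BL k - BR k] tends to [0]. *)
Lemma time_int_dyadic (G : R -> R) (M : R) (BL BR : nat -> R) (n : nat) :
  measurable_fun `]0, (2 : R)[ G -> (forall t : R, 0 < t < 2 -> `|G t| <= M) ->
  (forall k, time_int (1 - tau k) (1 - tau k.+1) G = BL k.+1 - BL k) ->
  (forall k, time_int (1 + tau k.+1) (1 + tau k) G = BR k - BR k.+1) ->
  BL k - BR k @[k --> \oo] --> (0 : R) ->
  (forall m, time_int 0 (1 - tau m) G = BL m - BL 0%N) /\
  time_int 0 (1 + tau n) G = BR n - BL 0%N.
Proof.
move=> mG GM HL HR lim.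
have sub (a b : R) : 0 <= a -> b <= 2 ->
    measurable_fun `]a, b[ G /\ forall t, a < t < b -> `|G t| <= M.
  move=> a0 b2; split.
    apply: measurable_funS mG => //; apply: subset_itv; rewrite bnd_simp//.
  by move=> t /andP[at_ tb]; apply: GM;
    rewrite (le_lt_trans a0 at_) (lt_le_trans tb b2).
have split3 (a b c : R) : 0 <= a -> a <= b -> b <= c -> c <= 2 ->
    time_int a c G = time_int a b G + time_int b c G.
  move=> a0 ab bc c2; have [mg gM] := sub a c a0 c2.
  exact: time_int_split ab bc mg gM.
have t1 m := tau_le1 m; have t0 m := tau_gt0 m.
have left m : time_int 0 (1 - tau m) G = BL m - BL 0%N.
  elim: m => [|m IH].
    by rewrite tau0 subrr /time_int set_itv_ge ?bnd_simp ?ltxx// Rintegral_set0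
      subrr.
  have := t1 m; have := t0 m; have := t0 m.+1; have := tau_le m => ? ? ? ?.
  by rewrite (split3 0 (1 - tau m)) ?IH ?HL; [lra|lra..].
have right m : time_int (1 + tau (n + m)) (1 + tau n) G = BR n - BR (n + m)%N.
  elim: m => [|m IH].
    by rewrite addn0 /time_int set_itv_ge ?bnd_simp ?ltxx// Rintegral_set0 subrr.
  have := t1 n; have := t0 (n + m).+1; have := tau_le (n + m).
  have := tau_homo (leq_addr m n) => ? ? ? ?; rewrite addnS.
  by rewrite (split3 _ (1 + tau (n + m))) ?IH ?HR; [lra|lra..].
split=> //; apply/eqP; rewrite -subr_eq0; apply/eqP.
(* The difference of the two sides does not depend on m, while its bound,
   obtained by leaving out the middle interval of half-width tau (n + m), does. *)
apply: (@eq0_le_cvg0 _ (fun m => M * (tau (n + m) + tau (n + m)) +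
    `|BL (n + m)%N - BR (n + m)%N|)) => [m|].
  set k := (n + m)%N; have := t1 n; have := t1 k; have := t0 k.
  have : tau k <= tau n by exact/tau_homo/leq_addr.
  move=> ? ? ? ?.
  have [mg gM] := sub (1 - tau k) (1 + tau k) ltac:(lra) ltac:(lra).
  have := time_int_bound (a := 1 - tau k) (b := 1 + tau k) ltac:(lra) mg gM.
  rewrite (_ : 1 + tau k - (1 - tau k) = tau k + tau k); last lra.
  move=> mid.
  rewrite (split3 0 (1 + tau k)); [|lra..].
  rewrite (split3 0 (1 - tau k)); [|lra..].
  rewrite left right.
  rewrite (_ : _ - _ = time_int (1 - tau k) (1 + tau k) G + (BL k - BR k));
    last lra.
  by rewrite (le_trans (ler_normD _ _))// lerD.
have ct : tau (n + m) @[m --> \oo] --> (0 : R).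
  have -> : (fun m => tau (n + m)) = [sequence tau (m + n)%N]_m.
    by apply/funext => m; rewrite addnC.
  by rewrite (cvg_shiftn n tau); exact: cvg_tau.
have cB : BL (n + m)%N - BR (n + m)%N @[m --> \oo] --> (0 : R).
  have -> : (fun m => BL (n + m)%N - BR (n + m)%N) =
      [sequence BL (m + n)%N - BR (m + n)%N]_m.
    by apply/funext => m; rewrite addnC.
  by rewrite (cvg_shiftn n (fun k => BL k - BR k)).
rewrite -[X in _ --> X]addr0 -[X in _ --> X + _](mulr0 M); apply: cvgD.
  by apply: cvgMr; rewrite -[X in _ --> X]addr0; exact: cvgD.
exact/norm_cvg0P.
Qed.

(** The largest [k] with [2 ^ k <= 1 / `|t - 1|]. *)
Definition slab (t : R) : nat := trunc_log 2 (Num.truncn (`|t - 1|^-1)).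

Lemma slab_itv (t : R) : t != 1 -> `|t - 1| <= 1 ->
  tau (slab t).+1 < `|t - 1| <= tau (slab t).
Proof.
move=> t1 le1; have pos : 0 < `|t - 1| by rewrite normr_gt0 subr_eq0.
have ge1 : 1 <= `|t - 1|^-1 by rewrite invf_ge1.
have := Num.Theory.truncn_itv (ltW (lt_le_trans ltr01 ge1)) => /andP[lo hi].
set N := Num.truncn _ in lo hi *.
have N0 : (0 < N)%N by rewrite Num.Theory.truncn_gt0.
rewrite /slab -/N.
have /andP[lo2 hi2] := trunc_log_bounds (isT : (1 < 2)%N) N0.
rewrite /tau !exprVn -[X in _ < X <= _](invrK).
rewrite ltf_pV2 ?lef_pV2 ?posrE ?exprn_gt0 ?invr_gt0//.
rewrite -!natrX; apply/andP; split.
  by apply: lt_le_trans hi _; rewrite ler_nat.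
by apply: le_trans lo; rewrite ler_nat.
Qed.

Lemma slabE (t : R) k : tau k.+1 < `|t - 1| <= tau k -> slab t = k.
Proof.
move=> /andP[lo hi]; have pos := lt_trans (tau_gt0 k.+1) lo.
have t1 : t != 1 by rewrite -subr_eq0 -normr_gt0.
have /andP[lo' hi'] := slab_itv t1 (le_trans hi (tau_le1 k)).
apply/eqP; rewrite eqn_leq; apply/andP; split; rewrite leqNgt; apply/negP => lt.
  by have := le_lt_trans hi' (le_lt_trans (tau_homo lt) lo); rewrite ltxx.
by have := le_lt_trans hi (le_lt_trans (tau_homo lt) lo'); rewrite ltxx.
Qed.

End Dyadic.

(** * Flow maps of the alternating shears *)

Section FlowMaps.
Context {R : realType}.
Local Notation S := (space3 R).

(** Consecutive shears are orthogonal. *)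
Definition dirn (k : nat) : 'I_3 := if odd k then 0 else 1.

Lemma dirn_neq2 k : dirn k != 2%:R.
Proof. by rewrite /dirn; case: odd. Qed.

(** The horizontal coordinate on which the shear number [k] depends. *)
Definition perp k (x : S) : R := coord (dirn k.+1) x.

Lemma perp_shift k (x : S) c : perp k (x + c *: unit_vec (dirn k)) = perp k x.
Proof.
by rewrite shiftE /perp /dirn /=; case: odd; case: x => -[].
Qed.

Lemma coord_unit_vec i j (x : S) :
  coord i (x + unit_vec j) = coord i x + (i == j)%:R.
Proof.
rewrite -[unit_vec j]scale1r shiftE.
by case: x => -[? ?] ?; elim/ord3P: i; elim/ord3P: j; rewrite /coord/= ?addr0.
Qed.

Variable g : nat -> R -> R.
Hypothesis g1 : forall k y, g k (y + 1) = g k y.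
Hypothesis mg : forall k, measurable_fun [set: R] (g k).

Definition disp k (x : S) : R := g k (perp k x).

Lemma disp_free k : coord_free (dirn k) (disp k).
Proof.
by move=> x s; rewrite /disp /perp /dirn /=; case: odd; case: x => -[].
Qed.

Lemma disp_free2 k : coord_free 2%:R (disp k).
Proof.
by move=> x s; rewrite /disp /perp /dirn /=; case: odd; case: x => -[].
Qed.

Lemma disp_periodic k j (x : S) : disp k (x + unit_vec j) = disp k x.
Proof.
by rewrite /disp /perp coord_unit_vec; case: eqP => _; rewrite ?addr0// g1.
Qed.

Lemma measurable_disp k : measurable_fun [set: S] (disp k).
Proof. exact: (measurableT_comp (mg k) (measurable_coord (dirn k.+1))). Qed.

Definition shear k (c : R) (x : S) : S := x + (c * disp k x) *: unit_vec (dirn k).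

Lemma shearK k c : cancel (shear k c) (shear k (- c)).
Proof.
move=> x; rewrite /shear (coord_free_shift _ _ (disp_free k)) mulNr scaleNr.
by rewrite addrK.
Qed.

Lemma shear_periodic k c j x : shear k c (x + unit_vec j) = shear k c x +
  unit_vec j.
Proof. by rewrite /shear disp_periodic addrAC. Qed.

Lemma measurable_shear k c : measurable_fun [set: S] (shear k c).
Proof.
apply: measurable_shift => //; apply: measurable_funM; last exact: measurable_disp.
exact: measurable_cst.
Qed.

Lemma shear_free2 k c (U : Type) (f : S -> U) : coord_free 2%:R f ->
  coord_free 2%:R (f \o shear k c).
Proof.
move=> f2 x s; rewrite /= /shear disp_free2 !shiftE.
by rewrite set_coordC ?dirn_neq2// f2.
Qed.

(** [back_flow k] brings a particle from the outer end of the slab number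
    [k] back to the first shear. *)
Fixpoint back_flow k (x : S) : S :=
  if k is k'.+1 then back_flow k' (shear k' (- 1) x) else x.

Fixpoint flow k (x : S) : S := if k is k'.+1 then shear k' 1 (flow k' x) else x.

Lemma back_flowK k : cancel (back_flow k) (flow k).
Proof.
elim: k => [//|k IH] x /=; rewrite IH.
by have := shearK k (- 1); rewrite opprK; exact.
Qed.

Lemma back_flow_periodic k j x : back_flow k (x + unit_vec j) = back_flow k x +
  unit_vec j.
Proof. by elim: k x => [//|k IH] x /=; rewrite shear_periodic IH. Qed.

Lemma flow_periodic k j x : flow k (x + unit_vec j) = flow k x + unit_vec j.
Proof. by elim: k x => [//|k IH] x /=; rewrite IH shear_periodic. Qed.

Lemma measurable_back_flow k : measurable_fun [set: S] (back_flow k).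
Proof.
elim: k => [|k IH] //=; exact: (measurableT_comp IH (measurable_shear k (- 1))).
Qed.

Lemma measurable_flow k : measurable_fun [set: S] (flow k).
Proof.
elim: k => [|k IH] //=; exact: (measurableT_comp (measurable_shear k 1) IH).
Qed.

Lemma back_flow_free2 k (U : Type) (f : S -> U) : coord_free 2%:R f ->
  coord_free 2%:R (f \o back_flow k).
Proof.
elim: k f => [//|k IH] f f2 x s /=.
by have := shear_free2 k (- 1) (IH f f2) x s.
Qed.

Lemma torus_int_shear k c (f : S -> R) : measurable_fun [set: S] f ->
  torus_periodic f -> torus_int (f \o shear k c) = torus_int f.
Proof.
move=> mf fper.
apply: (@torus_int_shift _ (dirn k) (fun x => c * disp k x)) => //.
- apply: measurable_funM; last exact: measurable_disp.
  exact: measurable_cst.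
- by move=> x s; rewrite disp_free.
- by move=> x; exact: fper.
Qed.

Lemma torus_int_back_flow k (f : S -> R) : measurable_fun [set: S] f ->
  torus_periodic f -> torus_int (f \o back_flow k) = torus_int f.
Proof.
move=> mf fper; elim: k => [//|k IH].
rewrite -[in RHS]IH.
apply: (@torus_int_shear k (- 1) (f \o back_flow k)).
  exact: (measurableT_comp mf (measurable_back_flow k)).
by move=> j x /=; rewrite back_flow_periodic fper.
Qed.

End FlowMaps.

(** * Modulation in time of a shear *)

Section Profile.
Context {R : realType}.

(** Quintic smooth step from [0] to [1]: its first two derivatives vanish at
    both ends, so the force is continuous across the slabs. *)
Definition step (s : R) : R := 10 * s ^+ 3 - 15 * s ^+ 4 + 6 * s ^+ 5.
Definition step1 (s : R) : R := 30 * (s * (1 - s)) ^+ 2.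
Definition step2 (s : R) : R := 60 * (s * (1 - s)) * (1 - 2 * s).

Lemma is_derive_step (s : R) : is_derive s (1 : R) step (step1 s).
Proof.
pose p : {poly R} := 10 *: 'X^3 - 15 *: 'X^4 + 6 *: 'X^5.
have -> : step = horner p by apply/funext => x;
  rewrite /step /p !(hornerD, hornerN, hornerZ, hornerMn, hornerXn, hornerX,
  hornerC).
apply: is_derive_eq.
rewrite /p !(derivD, derivN, derivZ, derivXn, derivC, derivX) !(hornerD,
  hornerN, hornerZ, hornerMn, hornerXn, hornerX, hornerC)/= /step1; ring.
Qed.

Lemma is_derive_step1 (s : R) : is_derive s (1 : R) step1 (step2 s).
Proof.
pose p : {poly R} := 30 *: 'X^2 - 60 *: 'X^3 + 30 *: 'X^4.
have -> : step1 = horner p.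
  apply/funext => x; rewrite /step1 /p !(hornerD, hornerN, hornerZ, hornerMn,
    hornerXn, hornerX, hornerC). ring.
apply: is_derive_eq.
rewrite /p !(derivD, derivN, derivZ, derivXn, derivC, derivX) !(hornerD,
  hornerN, hornerZ, hornerMn, hornerXn, hornerX, hornerC)/= /step2. ring.
Qed.

Lemma continuous_step2 : continuous step2.
Proof.
pose p : {poly R} := 60 *: 'X - 180 *: 'X^2 + 120 *: 'X^3.
have -> : step2 = horner p.
  by apply/funext => x; rewrite /step2 /p !(hornerD, hornerN, hornerZ,
    hornerMn, hornerXn, hornerX, hornerC); ring.
exact: continuous_horner.
Qed.

Lemma is_derive_affine (c d s : R) : is_derive s (1 : R) (fun s => d + c * s) c.
Proof.
pose p : {poly R} := d%:P + c *: 'X.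
have -> : (fun s => d + c * s) = horner p by apply/funext => x;
  rewrite /p !(hornerD, hornerN, hornerZ, hornerMn, hornerXn, hornerX, hornerC).
by apply: is_derive_eq; rewrite /p derivD derivC derivZ derivX !hornerE.
Qed.

Lemma continuous_deriv (h h1 : R -> R) :
  (forall t : R, is_derive t (1 : R) h (h1 t)) -> continuous h.
Proof. by move=> dh t; apply: differentiable_continuous;
  apply/derivable1_diffP. Qed.

(** Progress of the shear number [k], from [0] at the outer end of its slab
    to [1] at the inner end, frozen outside of the slab. *)
Definition phase (k : nat) (t : R) : R :=
  Num.min 1 (Num.max 0 (2 - `|t - 1| / tau k.+1)).

(** The reversal of the velocity at [t = 1]. *)
Definition side (t : R) : R := if t < 1 then 1 else - 1.

Lemma phase01 k t : 0 <= phase k t <= 1.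
Proof. by rewrite /phase le_min ler01 le_max lexx/= ge_min lexx. Qed.

Lemma phaseE k t : tau k.+1 <= `|t - 1| <= tau k ->
  phase k t = 2 - `|t - 1| / tau k.+1.
Proof.
move=> /andP[lo hi]; have t0 : 0 < tau k.+1 :> R := tau_gt0 k.+1.
have : 1 <= `|t - 1| / tau k.+1 <= 2.
  apply/andP; split; first by rewrite ler_pdivlMr// mul1r.
  by rewrite ler_pdivrMr// mulrDl mul1r -tauS.
move=> /andP[? ?]; rewrite /phase.
by rewrite max_r ?subr_ge0// min_r//; lra.
Qed.

Lemma step_bound (s : R) : 0 <= s <= 1 -> 0 <= step1 s <= 30 /\ `|step2 s| <= 60.
Proof.
move=> /andP[s0 s1]; split; rewrite /step1 /step2.
  have : 0 <= s * (1 - s) <= 1 by nra.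
  by move=> /andP[? ?]; nra.
have ? : 0 <= s * (1 - s) <= 1 by nra.
by rewrite ler_norml; nra.
Qed.

End Profile.

(** * The force and the solutions *)

Section SlabMeasurability.
Context {R : realType}.

Lemma slabS (t : R) k : slab t = k.+1 <-> tau k.+2 < `|t - 1| <= tau k.+1.
Proof.
split=> [E|]; last exact: slabE.
have t1 : t != 1.
  apply/eqP => t1; move: E.
  by rewrite /slab t1 subrr normr0 invr0 Num.Theory.truncn0.
have [le1|gt1] := leP `|t - 1| 1; first by rewrite -E slab_itv.
move: E; rewrite /slab.
rewrite (_ : Num.truncn _ = 0%N)//; apply/eqP.
rewrite -leqn0 leqNgt Num.Theory.truncn_gt0 -ltNge invf_lt1//.
exact: lt_trans gt1.
Qed.

Lemma measurable_slab_set k : measurable [set t : R | slab t = k].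
Proof.
have mS n : measurable [set t : R | slab t = n.+1].
  rewrite (_ : [set _ | _] = (fun t => `|t - 1|) @^-1` `]tau n.+2, tau n.+1]).
    rewrite -[X in measurable X]setTI.
    suff mf : measurable_fun [set: R] (fun t : R => `|t - 1|) by exact: mf.
    by apply: measurableT_comp => //; apply: measurable_funB.
  by apply/seteqP; split=> t /=; rewrite in_itv/= -slabS.
case: k => [|k]; last exact: mS.
rewrite (_ : [set _ | _] = ~` \bigcup_n [set t : R | slab t = n.+1]).
  by apply: measurableC; exact: bigcupT_measurable.
apply/seteqP; split=> [t /= t0 [n _ /=]|t /= nt]; first by rewrite t0.
by case E : (slab t) => [//|n]; case: nt; exists n.
Qed.

(** Countably many slabs. *)
Lemma measurable_slabwise d (T : measurableType d) (Phi : nat -> T * R -> R) :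
  (forall k, measurable_fun [set: T * R] (Phi k)) ->
  measurable_fun [set: T * R] (fun z => Phi (slab z.2) z).
Proof.
move=> mPhi _ Y mY; rewrite setTI.
rewrite (_ : _ @^-1` Y = \bigcup_k
   ((Phi k @^-1` Y) `&` ([set: T] `*` [set t | slab t = k]))); last first.
  apply/seteqP; split=> [z /= Yz|z [k _ [/= ? [_ /= ->]]]]//.
  by exists (slab z.2).
apply: bigcupT_measurable => k; apply: measurableI.
  by rewrite -[X in measurable X]setTI; exact: mPhi.
by apply: measurableX => //; exact: measurable_slab_set.
Qed.

Lemma measurable_side : measurable_fun [set: R] (@side R).
Proof.
apply: measurable_fun_ifT => //; apply: measurable_fun_ltr => //.
Qed.

Lemma measurable_phase k : measurable_fun [set: R] (@phase R k).
Proof.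
apply: measurable_minr => //; apply: measurable_maxr => //.
apply: measurable_funB => //; apply: measurable_funM => //.
by apply: measurableT_comp => //; exact: measurable_funB.
Qed.

End SlabMeasurability.

Section Fields.
Context {R : realType}.
Local Notation S := (space3 R).
Local Notation ST := (spacetime R).
Variable g : nat -> R -> R.
Hypothesis g1 : forall k y, g k (y + 1) = g k y.
Hypothesis mg : forall k, measurable_fun [set: R] (g k).
Hypothesis gB : forall k y, `|g k y| <= tau k.+1 ^+ 2.

(** The states of the scalar at the outer times [0] and [2]. *)
Definition datum (f : S -> R) :=
  [/\ bounded_meas f, torus_periodic f & coord_free 2%:R f].

(** The time derivative of [step (phase k t)] times the displacement. *)
Definition vel_at k (z : ST) : R :=
  side z.2 / tau k.+1 * step1 (phase k z.2) * disp g k z.1.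

Definition force_at k (z : ST) : R :=
  (tau k.+1 ^+ 2)^-1 * step2 (phase k z.2) * disp g k z.1.

(** The state [f] transported by the first [k] shears and by the completed
    part of the shear number [k]. *)
Definition scalar_at (f1 f2 : S -> R) k (z : ST) : R :=
  (if z.2 < 1 then f1 else f2)
    (back_flow g k (shear g k (- step (phase k z.2)) z.1)).

Definition velocity (z : ST) : vec3 R :=
  vel_at (slab z.2) z *: basis_vec (dirn (slab z.2)).

Definition force (z : ST) : vec3 R :=
  force_at (slab z.2) z *: basis_vec (dirn (slab z.2)).

Definition scalar f1 f2 (z : ST) : R := scalar_at f1 f2 (slab z.2) z.

Definition solution f1 f2 (z : ST) : vec3 R :=
  velocity z + scalar f1 f2 z *: basis_vec 2%:R.

Let mfst d1 d2 (T1 : measurableType d1) (T2 : measurableType d2) d3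
    (T3 : measurableType d3) (f : T1 -> T3) :
  measurable_fun [set: T1] f -> measurable_fun [set: T1 * T2] (fun z => f z.1).
Proof. by move=> mf; exact: measurableT_comp. Qed.

Let msnd d1 d2 (T1 : measurableType d1) (T2 : measurableType d2) d3
    (T3 : measurableType d3) (f : T2 -> T3) :
  measurable_fun [set: T2] f -> measurable_fun [set: T1 * T2] (fun z => f z.2).
Proof. by move=> mf; exact: measurableT_comp. Qed.

Let mcont (h : R -> R) k : continuous h ->
  measurable_fun [set: ST] (fun z : ST => h (phase k z.2)).
Proof.
move=> ch; apply: (msnd (f := fun t => h (phase k t))).
exact: (measurableT_comp (continuous_measurable_fun ch) (measurable_phase k)).
Qed.

Lemma measurable_vel_at k : measurable_fun [set: ST] (vel_at k).
Proof.
apply: measurable_funM; last exact: mfst (measurable_disp mg k).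
apply: measurable_funM; last first.
  exact: mcont (continuous_deriv is_derive_step1).
by apply: measurable_funM => //; exact: msnd measurable_side.
Qed.

Lemma measurable_force_at k : measurable_fun [set: ST] (force_at k).
Proof.
apply: measurable_funM; last exact: mfst (measurable_disp mg k).
by apply: measurable_funM => //; exact: mcont continuous_step2.
Qed.

Lemma measurable_scalar_at f1 f2 k : datum f1 -> datum f2 ->
  measurable_fun [set: ST] (scalar_at f1 f2 k).
Proof.
move=> [[mf1 _] _ _] [[mf2 _] _ _].
have ms : measurable_fun [set: ST]
    (fun z : ST => back_flow g k (shear g k (- step (phase k z.2)) z.1)).
  apply: (measurableT_comp (measurable_back_flow mg k)).
  apply: measurable_shift => //; apply: measurable_funM.
    apply: measurable_funN; exact: mcont (continuous_deriv is_derive_step).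
  exact: mfst (measurable_disp mg k).
rewrite (_ : scalar_at f1 f2 k = fun z : ST => if z.2 < 1
  then f1 (back_flow g k (shear g k (- step (phase k z.2)) z.1))
  else f2 (back_flow g k (shear g k (- step (phase k z.2)) z.1))); last first.
  by apply/funext => z; rewrite /scalar_at; case: ifP.
apply: measurable_fun_ifT.
- by apply: measurable_fun_ltr => //.
- exact: (measurableT_comp mf1 ms).
- exact: (measurableT_comp mf2 ms).
Qed.

Lemma measurable_solution f1 f2 i : datum f1 -> datum f2 ->
  measurable_fun [set: ST] (fun z => solution f1 f2 z 0 i).
Proof.
move=> d1 d2.
have -> : (fun z => solution f1 f2 z 0 i) = (fun z : ST =>
    (fun k (z : ST) => vel_at k z * (basis_vec (dirn k) : vec3 R) 0 i
      + scalar_at f1 f2 k z * (basis_vec 2%:R : vec3 R) 0 i) (slab z.2) z).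
  by apply/funext => z; rewrite !mxE.
apply: (@measurable_slabwise _ _ S (fun k (z : ST) =>
  vel_at k z * (basis_vec (dirn k) : vec3 R) 0 i
  + scalar_at f1 f2 k z * (basis_vec 2%:R : vec3 R) 0 i)) => k.
apply: measurable_funD; apply: measurable_funM => //.
  exact: (measurable_vel_at k).
exact: (measurable_scalar_at k d1 d2).
Qed.

Lemma measurable_force i : measurable_fun [set: ST] (fun z => force z 0 i).
Proof.
have -> : (fun z => force z 0 i) = (fun z : ST =>
    (fun k (z : ST) => force_at k z * (basis_vec (dirn k) : vec3 R) 0 i) (slab
      z.2) z).
  by apply/funext => z; rewrite !mxE.
apply: (@measurable_slabwise _ _ S (fun k (z : ST) =>
  force_at k z * (basis_vec (dirn k) : vec3 R) 0 i)) => k.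
apply: measurable_funM => //.
exact: (measurable_force_at k).
Qed.

(** The smallness of the displacement compensates the shortness of the slabs. *)
Lemma vel_at_bound k z : `|vel_at k z| <= 30.
Proof.
have [/andP[s0 s30] _] := step_bound (phase01 k z.2).
have t0 : 0 < tau k.+1 :> R := tau_gt0 k.+1.
have t1 : tau k.+1 <= 1 :> R := tau_le1 k.+1.
rewrite /vel_at; move: (step1 _) s0 s30 => s s0 s30;
  rewrite !normrM (_ : `|side z.2| = 1); last first.
  by rewrite /side; case: ifP; rewrite ?normrN normr1.
rewrite mul1r normfV (ger0_norm (ltW t0)) (ger0_norm s0).
have gb : `|disp g k z.1| <= tau k.+1 * tau k.+1 by rewrite -expr2 gB.
rewrite -mulrA ler_pdivrMl//.
apply: le_trans (_ : 30 * (tau k.+1 * tau k.+1) <= _).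
  by apply: ler_pM.
by nra.
Qed.

Lemma force_at_bound k z : `|force_at k z| <= 60.
Proof.
have [_ s60] := step_bound (phase01 k z.2).
have t0 : 0 < tau k.+1 ^+ 2 :> R by rewrite exprn_gt0// tau_gt0.
rewrite /force_at; move: (step2 _) s60 => s s60;
  rewrite !normrM normfV (ger0_norm (ltW t0)).
rewrite -mulrA ler_pdivrMl// mulrC.
by apply: ler_pM => //; exact: gB.
Qed.

Lemma scalar_bound f1 f2 : datum f1 -> datum f2 ->
  exists M : R, forall z, `|scalar f1 f2 z| <= M.
Proof.
move=> [[_ [M1 fM1]] _ _] [[_ [M2 fM2]] _ _].
exists (Num.max M1 M2) => z; rewrite /scalar /scalar_at le_max.
by case: ifP; rewrite ?fM1 ?fM2 ?orbT.
Qed.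

Lemma basis_vec_norm i : `|basis_vec i : vec3 R| <= 1.
Proof.
rewrite /Num.Def.normr/= mx_normrE; apply: bigmax_le => // -[a b] _ /=.
by rewrite !mxE; case: (_ && _); rewrite ?normr1 ?normr0.
Qed.

Lemma normr_basis_le (a M : R) i : `|a| <= M -> `|a *: basis_vec i| <= M.
Proof.
by move=> aM; rewrite normrZ -[leRHS]mulr1; apply: ler_pM => //;
  exact: basis_vec_norm.
Qed.

Lemma solution_bound f1 f2 : datum f1 -> datum f2 ->
  exists M : R, forall z, `|solution f1 f2 z| <= M.
Proof.
move=> d1 d2; have [M HM] := scalar_bound d1 d2.
exists (30 + M) => z; apply: le_trans (ler_normD _ _) _; apply: lerD.
  by apply: normr_basis_le; exact: vel_at_bound.
exact: normr_basis_le.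
Qed.

Lemma force_bound z : `|force z| <= 60.
Proof. by apply: normr_basis_le; exact: force_at_bound. Qed.

Lemma solution_periodic f1 f2 : datum f1 -> datum f2 ->
  space_periodic (solution f1 f2).
Proof.
move=> [_ p1 _] [_ p2 _] t j x.
rewrite /solution /velocity /vel_at /scalar /scalar_at /= disp_periodic//.
rewrite shear_periodic// back_flow_periodic//.
by case: ifP; rewrite ?p1 ?p2.
Qed.

Lemma force_periodic : space_periodic force.
Proof. by move=> t j x; rewrite /force /force_at /= disp_periodic. Qed.

End Fields.

(** * Weak divergence, and the momentum density *)

Section VectorNorm.
Context {R : realType}.

Lemma vec_coord_le (w : vec3 R) i : `|w 0 i| <= `|w|.
Proof.
by rewrite [leRHS]/Num.Def.normr/= mx_normrE; apply: (le_bigmax _ _ (0, i)).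
Qed.

Lemma vec_norm_le (w : vec3 R) (B : R) :
  0 <= B -> (forall i, `|w 0 i| <= B) -> `|w| <= B.
Proof.
move=> B0 wB; rewrite [leLHS]/Num.Def.normr/= mx_normrE.
by apply: bigmax_le => // -[a i] _ /=; rewrite (ord1 a).
Qed.

End VectorNorm.

Section WeakSolution.
Context {R : realType}.
Local Notation S := (space3 R).
Local Notation ST := (spacetime R).
Variable g : nat -> R -> R.
Hypothesis g1 : forall k y, g k (y + 1) = g k y.
Hypothesis mg : forall k, measurable_fun [set: R] (g k).
Hypothesis gB : forall k y, `|g k y| <= tau k.+1 ^+ 2.

Lemma bounded_disp k : bounded_meas (disp g k).
Proof.
split; first exact: measurable_disp.
by exists (tau k.+1 ^+ 2) => x; exact: gB.
Qed.

Lemma datum_back_flow (f : S -> R) k : datum f -> datum (f \o back_flow g k).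
Proof.
move=> [bf fper f2]; split.
- exact: (bounded_meas_comp (measurable_back_flow mg k) bf).
- by move=> j x /=; rewrite back_flow_periodic// fper.
- exact: back_flow_free2.
Qed.

Lemma datum_shear (f : S -> R) k c : datum f -> datum (f \o shear g k c).
Proof.
move=> [bf fper f2]; split.
- exact: (bounded_meas_comp (measurable_shear mg k c) bf).
- by move=> j x /=; rewrite shear_periodic// fper.
- exact: shear_free2.
Qed.

Lemma datum_scalar_at f1 f2 k t : datum f1 -> datum f2 ->
  datum (fun x => scalar_at g f1 f2 k (x, t)).
Proof.
move=> d1 d2; have d : datum (if t < 1 then f1 else f2) by case: ifP.
exact: (datum_shear k (- step (phase k t)) (datum_back_flow k d)).
Qed.

Lemma bounded_vel_at k t : bounded_meas (fun x => vel_at g k (x, t)).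
Proof.
exact: (bounded_measM (bounded_meas_cst (side t / tau k.+1 * step1 (phase k t)))
  (bounded_disp k)).
Qed.

Lemma bounded_force_at k t : bounded_meas (fun x => force_at g k (x, t)).
Proof.
exact: (bounded_measM (bounded_meas_cst ((tau k.+1 ^+ 2)^-1 * step2 (phase k t)))
  (bounded_disp k)).
Qed.

Lemma test_C1 (T : R) psi : test_function T psi -> C1_periodic psi.
Proof. by case=> sm per _; exact: smooth_C1. Qed.

(** At each time every component is independent of its own variable. *)
Lemma solution_weakly_div_free f1 f2 : datum f1 -> datum f2 ->
  weakly_div_free 2 (solution g f1 f2).
Proof.
move=> d1 d2 psi /test_C1 Cpsi.
rewrite (@eq_time_int _ _ _ _ (fun=> 0)).
  by rewrite /time_int Rintegral_cst// mul0r.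
move=> t _; set k := slab t.
have [bw _ w2] := datum_scalar_at k t d1 d2.
have bD j : bounded_meas (fun x => 'D_(unit_vec j, 0) psi (x, t)).
  exact: (C1_slice _ _ Cpsi).2.
have v0 : torus_int (fun x => vel_at g k (x, t) * 'D_(unit_vec (dirn k), 0) psi
  (x, t)) = 0.
  apply: torus_int_partial_eq0 => //; first exact: bounded_vel_at.
  by move=> x s; rewrite /vel_at /= disp_free.
have w0 := torus_int_partial_eq0 t Cpsi bw w2.
have sumE := torus_intD (bounded_measM (bounded_vel_at k t) (bD (dirn k)))
  (bounded_measM bw (bD 2%:R)).
apply: etrans (etrans sumE (etrans (congr2 +%R v0 w0) (addr0 0))).
by apply: eq_torus_int => x; rewrite /solution /velocity dot_two !mxE.
Qed.

Lemma force_weakly_div_free : weakly_div_free 2 (force g).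
Proof.
move=> psi /test_C1 Cpsi.
rewrite (@eq_time_int _ _ _ _ (fun=> 0)).
  by rewrite /time_int Rintegral_cst// mul0r.
move=> t _; set k := slab t.
have v0 : torus_int (fun x => force_at g k (x, t) * 'D_(unit_vec (dirn k), 0)
  psi (x, t)) = 0.
  apply: torus_int_partial_eq0 => //; first exact: bounded_force_at.
  by move=> x s; rewrite /force_at /= disp_free.
apply: etrans v0.
by apply: eq_torus_int => x; rewrite /force dot_one !mxE.
Qed.

Definition momentum_density (F v phi : ST -> vec3 R) (z : ST) : R :=
  dot (v z) (time_partial phi z)
  + \sum_i \sum_j v z 0 i * v z 0 j * space_partial j phi z 0 i
  + dot (F z) (phi z).

Lemma measurable_dot d (T : measurableType d) (u w : T -> vec3 R) :
  (forall i, measurable_fun [set: T] (fun z => u z 0 i)) ->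
  (forall i, measurable_fun [set: T] (fun z => w z 0 i)) ->
  measurable_fun [set: T] (fun z => dot (u z) (w z)).
Proof.
move=> mu mw; rewrite /dot.
under eq_fun do rewrite !big_ord_recl big_ord0 addr0.
by do !apply: measurable_funD => //; apply: measurable_funM.
Qed.

Lemma dot_bound (u w : vec3 R) (M N : R) : `|u| <= M -> `|w| <= N ->
  `|dot u w| <= 3 * (M * N).
Proof.
move=> uM wN; have ent := @vec_coord_le R.
rewrite /dot; apply: le_trans (ler_norm_sum _ _ _) _.
apply: le_trans (_ : \sum_(i < 3) M * N <= _); last first.
  by rewrite sumr_const card_ord -[leLHS]mulr_natl.
apply: ler_sum => i _; rewrite normrM; apply: ler_pM => //.
  exact: le_trans (ent u i) uM.
exact: le_trans (ent w i) wN.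
Qed.

Lemma momentum_density_measurable (F v phi : ST -> vec3 R) (M N : R) :
  smooth phi -> space_periodic phi ->
  (forall i, measurable_fun [set: ST] (fun z => F z 0 i)) ->
  (forall i, measurable_fun [set: ST] (fun z => v z 0 i)) ->
  (forall z, `|F z| <= M) -> (forall z, `|v z| <= N) ->
  measurable_fun [set: ST] (momentum_density F v phi) /\
  exists B : R, forall x t, 0 < t < 2 -> `|momentum_density F v phi (x, t)| <= B.
Proof.
move=> sm per mF mv FM vN.
have Cph i := smooth_coord_C1 i sm per.
have mph i : measurable_fun [set: ST] (fun z => phi z 0 i).
  exact: continuous_measurable_spacetime (C1_continuous (Cph i)).
have mD u i : measurable_fun [set: ST] (fun z => ('D_u phi z) 0 i).
  under eq_fun do rewrite smooth_derive_coord//.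
  by apply: continuous_measurable_spacetime; case: (Cph i).
have entB (u : ST) (i : 'I_3) : exists B : R, forall x t, 0 < t < 2 ->
    `|phi (x, t) 0 i| <= B /\ `|('D_u phi (x, t)) 0 i| <= B.
  have [B HB] := C1_bounded u 0 2 (Cph i); exists B => x t /andP[t0 t2].
  by rewrite smooth_derive_coord//; apply: HB; rewrite !ltW.
have ent := @vec_coord_le R.
have rowB (u : ST) : exists B : R, forall x t, 0 < t < 2 ->
    `|phi (x, t)| <= B /\ `|'D_u phi (x, t)| <= B.
  have [B0 H0] := entB u 0; have [B1 H1] := entB u 1; have [B2 H2] := entB u 2%:R.
  exists (`|B0| + `|B1| + `|B2|) => x t t02.
  have all3 (w : vec3 R) : `|w 0 0| <= B0 -> `|w 0 1| <= B1 ->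
      `|w 0 2%:R| <= B2 -> `|w| <= `|B0| + `|B1| + `|B2|.
    move=> w0 w1 w2; apply: vec_norm_le => [|i]; first by do 2?apply: addr_ge0.
    have := ler_norm B0; have := ler_norm B1; have := ler_norm B2.
    have := normr_ge0 B0; have := normr_ge0 B1; have := normr_ge0 B2.
    move: i; apply: ord3P => *; lra.
  have [? ?] := H0 x t t02; have [? ?] := H1 x t t02; have [? ?] := H2 x t t02.
  by split; exact: all3.
split.
  apply: measurable_funD; last exact: measurable_dot.
  apply: measurable_funD.
    by apply: measurable_dot => // i; exact: mD.
  apply: (@measurable_sum _ _ _ _ _ _ (fun i z => \sum_k v z 0 i * v z 0 k
    * space_partial k phi z 0 i)) => i.
  apply: (@measurable_sum _ _ _ _ _ _ (fun k z => v z 0 i * v z 0 k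
    * space_partial k phi z 0 i)) => k.
  by apply: measurable_funM; [exact: measurable_funM|exact: (mD (unit_vec k, 0))].
have [Bt Ht] := rowB (0, 1).
have [Bs Hs] : exists B : R, forall j x t, 0 < t < 2 ->
    `|space_partial j phi (x, t)| <= B.
  have [B0 H0] := rowB (unit_vec 0, 0); have [B1 H1] := rowB (unit_vec 1, 0).
  have [B2 H2] := rowB (unit_vec 2%:R, 0).
  exists (Num.max B0 (Num.max B1 B2)) => j x t t02; rewrite !le_max.
  move: j; apply: ord3P; rewrite /space_partial.
  - by have [_ ->] := H0 x t t02.
  - by have [_ ->] := H1 x t t02; rewrite orbT.
  - by have [_ ->] := H2 x t t02; rewrite !orbT.
exists (3 * (N * Bt) + 9 * (N * N * Bs) + 3 * (M * Bt)) => x t t02.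
have [phB DtB] := Ht x t t02.
rewrite /momentum_density; apply: le_trans (ler_normD _ _) _; apply: lerD;
  last first.
  exact: dot_bound.
apply: le_trans (ler_normD _ _) _; apply: lerD; first exact: dot_bound.
apply: le_trans (ler_norm_sum _ _ _) _.
apply: le_trans (_ : \sum_(i < 3) \sum_(j < 3) N * N * Bs <= _); last first.
  by rewrite !sumr_const card_ord -mulrnA -[leLHS]mulr_natl.
apply: ler_sum => i _; apply: le_trans (ler_norm_sum _ _ _) _.
apply: ler_sum => j _; rewrite !normrM; apply: ler_pM => //.
  apply: ler_pM => //; exact: le_trans (ent _ _) (vN _).
exact: le_trans (ent _ _) (Hs j x t t02).
Qed.

End WeakSolution.

(** * Weak formulation across the singular time *)

Section GlobalWeak.
Context {R : realType}.
Local Notation S := (space3 R).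
Local Notation ST := (spacetime R).
Variable g : nat -> R -> R.
Hypothesis g1 : forall k y, g k (y + 1) = g k y.
Hypothesis mg : forall k, measurable_fun [set: R] (g k).
Hypothesis gB : forall k y, `|g k y| <= tau k.+1 ^+ 2.

(** [phase k] on one half of its slab, where it is affine: [sg = 1] before
    the singular time and [sg = - 1] after it. *)
Definition ramp (sg : R) k (t : R) : R := 2 - sg / tau k.+1 + sg / tau k.+1 * t.
Definition prof sg k t : R := step (ramp sg k t).
Definition prof1 sg k t : R := step1 (ramp sg k t) * (sg / tau k.+1).
Definition prof2 sg k t : R := step2 (ramp sg k t) * (sg / tau k.+1) * (sg /
  tau k.+1).

Lemma is_derive_ramp (h h1 : R -> R) sg k (t : R) :
  (forall s : R, is_derive s (1 : R) h (h1 s)) ->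
  is_derive t (1 : R) (fun t => h (ramp sg k t)) (h1 (ramp sg k t) * (sg / tau
    k.+1)).
Proof.
move=> dh; have da := is_derive_affine (sg / tau k.+1) (2 - sg / tau k.+1) t.
exact: (is_derive1_comp (dh _) da).
Qed.

Lemma is_derive_prof sg k (t : R) :
  is_derive t (1 : R) (prof sg k) (prof1 sg k t).
Proof. exact: is_derive_ramp is_derive_step. Qed.

Lemma is_derive_prof1 sg k (t : R) :
  is_derive t (1 : R) (prof1 sg k) (prof2 sg k t).
Proof.
have d := is_derive_ramp (h := step1) sg k t is_derive_step1.
have -> : prof1 sg k = (sg / tau k.+1) *: (fun t => step1 (ramp sg k t)).
  by apply/funext => s; rewrite /prof1 mulrC.
by apply: is_derive_eq; rewrite /prof2 -[LHS]/(_ * _) mulrC.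
Qed.

Lemma continuous_prof2 sg k : continuous (prof2 sg k).
Proof.
have cr : continuous (ramp sg k).
  exact: continuous_deriv (is_derive_affine (sg / tau k.+1) (2 - sg / tau k.+1)).
move=> t; apply: cvgM; last exact: (cvg_cst (sg / tau k.+1)).
apply: cvgM; last exact: (cvg_cst (sg / tau k.+1)).
by apply: (@cvg_comp _ _ _ (ramp sg k) step2 _ _ _ (cr t)); exact: continuous_step2.
Qed.

Definition in_slab sg k (a b : R) := forall t, a < t < b ->
  [/\ slab t = k, side t = sg & phase k t = ramp sg k t].

Lemma in_slab_left k : in_slab 1 k (1 - tau k) (1 - tau k.+1).
Proof.
move=> t /andP[lo hi]; have t0 : 0 < tau k.+1 :> R := tau_gt0 k.+1.
have tn : `|t - 1| = 1 - t by rewrite ltr0_norm; lra.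
have lo' : tau k.+1 < `|t - 1| by rewrite tn; lra.
have hi' : `|t - 1| <= tau k by rewrite tn; lra.
split; first by apply: slabE; rewrite lo'.
  by rewrite /side ifT//; lra.
by rewrite phaseE ?(ltW lo')// tn /ramp; field; rewrite gt_eqF.
Qed.

Lemma in_slab_right k : in_slab (- 1) k (1 + tau k.+1) (1 + tau k).
Proof.
move=> t /andP[lo hi]; have t0 : 0 < tau k.+1 :> R := tau_gt0 k.+1.
have tn : `|t - 1| = t - 1 by rewrite gtr0_norm; lra.
have lo' : tau k.+1 < `|t - 1| by rewrite tn; lra.
have hi' : `|t - 1| <= tau k by rewrite tn; lra.
split; first by apply: slabE; rewrite lo'.
  by rewrite /side ifF//; apply/negbTE; rewrite -leNgt; lra.
by rewrite phaseE ?(ltW lo')// tn /ramp; field; rewrite gt_eqF.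
Qed.

Lemma step0 : step (0 : R) = 0. Proof. by rewrite /step !expr0n/=; ring. Qed.
Lemma step_1 : step (1 : R) = 1. Proof. by rewrite /step !expr1n; ring. Qed.

(** At the outer end of its slab a shear has not begun; at the inner end it
    is completed and at rest. *)
Lemma prof_ends k :
  [/\ prof 1 k (1 - tau k) = 0, prof1 1 k (1 - tau k) = 0,
      prof 1 k (1 - tau k.+1) = 1 & prof1 1 k (1 - tau k.+1) = 0] /\
  [/\ prof (- 1) k (1 + tau k) = 0, prof1 (- 1) k (1 + tau k) = 0,
      prof (- 1) k (1 + tau k.+1) = 1 & prof1 (- 1) k (1 + tau k.+1) = 0].
Proof.
have tn : tau k.+1 != 0 :> R by rewrite gt_eqF// tau_gt0.
have r1 : ramp 1 k (1 - tau k) = 0 by rewrite /ramp (tauS k); field.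
have r2 : ramp 1 k (1 - tau k.+1) = 1 by rewrite /ramp; field.
have r3 : ramp (- 1) k (1 + tau k) = 0 by rewrite /ramp (tauS k); field.
have r4 : ramp (- 1) k (1 + tau k.+1) = 1 by rewrite /ramp; field.
have s10 : step1 (0 : R) = 0 by rewrite /step1; ring.
have s11 : step1 (1 : R) = 0 by rewrite /step1; ring.
by rewrite /prof /prof1 r1 r2 r3 r4 step0 step_1 s10 s11 !mul0r.
Qed.

Variables f1 f2 : S -> R.
Hypotheses (d1 : datum f1) (d2 : datum f2).

Lemma slab_solution sg k (a b : R) (phi : ST -> vec3 R) :
  a <= b -> sg ^+ 2 = 1 -> in_slab sg k a b -> smooth phi -> space_periodic phi ->
  let f := if sg == 1 then f1 else f2 in
  let v t (x : S) := shear_field (dirn k) (f \o back_flow g k) (disp g k)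
    (prof sg k) (prof1 sg k) x t in
  time_int a b (fun t => torus_int (fun x =>
    momentum_density (force g) (solution g f1 f2) phi (x, t)))
  = torus_int (fun x => dot (v b x) (phi (x, b)))
  - torus_int (fun x => dot (v a x) (phi (x, a))).
Proof.
move=> ab sg2 ins sm per f v.
have df : datum f by rewrite /f; case: ifP.
have [bF pF F2] := datum_back_flow g1 mg k df.
rewrite -(@slab_weak _ (dirn k) a b (f \o back_flow g k) (disp g k) (prof sg k)
  (prof1 sg k) (prof2 sg k) (dirn_neq2 k) ab bF (pF _) F2 (bounded_disp mg gB k)
  (disp_free g k) (disp_free2 g k) (is_derive_prof sg k) (is_derive_prof1 sg k)
  (@continuous_prof2 sg k) _ sm per).
apply: eq_time_int => t /ins[sk sd ph]; apply: eq_torus_int => x.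
have tn : tau k.+1 != 0 :> R by rewrite gt_eqF// tau_gt0.
rewrite /momentum_density.
have -> : solution g f1 f2 (x, t) = v t x.
  rewrite /solution /velocity /scalar /v /shear_field /= sk;
    congr (_ *: _ + _ *: _).
    by rewrite /vel_at /= sd ph /prof1 [X in X * _]mulrC.
  rewrite /scalar_at /shear_scalar /= ph /shear mulNr scaleNr.
  suff -> : (if t < 1 then f1 else f2) = f by [].
  by rewrite /f -sd /side; case: ifP; rewrite ?eqxx// eqNr oner_eq0.
suff -> : force g (x, t) = shear_force (dirn k) (disp g k) (prof2 sg k) x t by [].
rewrite /force /shear_force /= sk; congr (_ *: _).
rewrite /force_at /= ph /prof2 -[X in (X * _) * _]mulr1 -sg2.
by congr (_ * _); field.
Qed.

Hypothesis mix : forall psi : ST -> R, C1_periodic psi ->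
  torus_int (fun x => (f1 (back_flow g k x) - f2 (back_flow g k x)) * psi (x, 1
    + tau k))
    @[k --> \oo] --> (0 : R).

(** The inner boundary term of a slab is the outer one of the next slab.
    What is left at [t = 1] is the pairing of [f1 \o back_flow g k] with the test
    function at time [1 - tau k], minus that of [f2 \o back_flow g k] at time
    [1 + tau k]: replacing the first time by the second costs [O(tau k)], and
    then [mix] applies. *)
Lemma solution_weak (phi : ST -> vec3 R) : test_field 2 phi ->
  time_int 0 2 (fun t => torus_int (fun x =>
    momentum_density (force g) (solution g f1 f2) phi (x, t)))
  + torus_int (fun x => dot (f1 x *: basis_vec 2%:R) (phi (x, 0))) = 0.
Proof.
move=> [sm per [T T2 phT] _].
have [MS HS] := solution_bound gB d1 d2.
have [mm [B HB]] := momentum_density_measurable sm per (measurable_force mg)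
  (fun i => measurable_solution mg i d1 d2) (force_bound gB) HS.
have [_ mG GB] := torus_time_Fubini mm HB.
pose ph := fun z => phi z 0 2%:R.
have Cph : C1_periodic ph by exact: smooth_coord_C1.
pose BL k := torus_int (fun x => f1 (back_flow g k x) * ph (x, 1 - tau k)).
pose BR k := torus_int (fun x => f2 (back_flow g k x) * ph (x, 1 + tau k)).
have restE f k (t : R) sg : prof1 sg k t = 0 -> prof sg k t = 0 ->
   torus_int (fun x => dot (shear_field (dirn k) (f \o back_flow g k) (disp g k)
      (prof sg k) (prof1 sg k) x t) (phi (x, t)))
   = torus_int (fun x => f (back_flow g k x) * ph (x, t)).
  move=> p1 p0; apply: eq_torus_int => x.
  by rewrite /shear_field dot_two p1 !mul0r add0r /shear_scalar p0 mul0r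
    scale0r subr0.
have endE f k (t : R) sg : prof1 sg k t = 0 -> prof sg k t = 1 ->
   torus_int (fun x => dot (shear_field (dirn k) (f \o back_flow g k) (disp g k)
      (prof sg k) (prof1 sg k) x t) (phi (x, t)))
   = torus_int (fun x => f (back_flow g k.+1 x) * ph (x, t)).
  move=> p1 p0; apply: eq_torus_int => x.
  rewrite /shear_field dot_two p1 !mul0r add0r /shear_scalar p0 mul1r /=.
  by rewrite /shear mulN1r scaleNr.
have tS k : tau k.+1 <= tau k :> R by exact: tau_le.
have N1 : (- 1 == 1 :> R) = false by rewrite eqNr oner_eq0.
have [|||_ E] := @time_int_dyadic R _ B BL BR 0 mG GB.
- move=> k; have [[p1 p2 p3 p4] _] := prof_ends k.
  rewrite (@slab_solution 1 k) ?expr1n//; [|by have := tS k;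
    lra|exact: in_slab_left].
  by rewrite eqxx (endE _ _ _ _ p4 p3) (restE _ _ _ _ p2 p1).
- move=> k; have [_ [p1 p2 p3 p4]] := prof_ends k.
  rewrite (@slab_solution (- 1) k) ?sqrrN ?expr1n//; [|by have := tS k;
    lra|exact: in_slab_right].
  by rewrite N1 (endE _ _ _ _ p4 p3) (restE _ _ _ _ p2 p1).
- have [N HN] := C1_bounded (0, 1) 0 2 Cph.
  have [b1 pp1 _] := d1; have [bf1 [M1 HM1]] := b1.
  have cD x : continuous (fun t : R => 'D_(0, 1) ph (x, t)).
    by have [_ cd _] := Cph; have [_] := continuous_slice (cd (0, 1)); exact.
  have slice t := (C1_slice (0, 1) t Cph).1.
  have bfl f k : bounded_meas f -> bounded_meas (f \o back_flow g k).
    exact: (bounded_meas_comp (measurable_back_flow mg k)).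
  have [b2 _ _] := d2.
  (* Compare both states with the test function at the same time 1 + tau k. *)
  pose u k := torus_int (fun x => f1 (back_flow g k x) *
    (ph (x, 1 - tau k) - ph (x, 1 + tau k))).
  have -> : (fun k => BL k - BR k) = (fun k => u k + torus_int (fun x =>
      (f1 (back_flow g k x) - f2 (back_flow g k x)) * ph (x, 1 + tau k))).
    apply/funext => k.
    rewrite -torus_intD.
    + rewrite -torus_intB.
      * by apply: eq_torus_int => x; ring.
      * exact: bounded_measM (bfl _ k b1) (slice _).
      * exact: bounded_measM (bfl _ k b2) (slice _).
    + exact: bounded_measM (bfl _ k b1) (bounded_measB (slice _) (slice _)).
    + exact: bounded_measM (bounded_measB (bfl _ k b1) (bfl _ k b2)) (slice _).
  rewrite -[X in _ --> X]addr0; apply: cvgD; last exact: mix.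
  have uB k : `|u k| <= M1 * (N * (tau k + tau k)).
    apply: torus_int_bound.
      by have [] := bounded_measM (bfl _ k b1)
        (bounded_measB (slice (1 - tau k)) (slice (1 + tau k))).
    move=> x; rewrite normrM; apply: ler_pM => //.
    have k0 : 0 < tau k :> R := tau_gt0 k; have k1 : tau k <= 1 :> R := tau_le1 k.
    have -> : ph (x, 1 - tau k) - ph (x, 1 + tau k) =
        - time_int (1 - tau k) (1 + tau k) (fun t => 'D_(0, 1) ph (x, t)).
      have le1 : 1 - tau k <= 1 + tau k :> R by lra.
      by rewrite (@time_int_FTC _ _ _ _ (fun t => ph (x, t)) le1 (cD x)
        (fun t => is_derive_time x t Cph)) opprB.
    rewrite normrN (_ : tau k + tau k = 1 + tau k - (1 - tau k)); last ring.
    apply: time_int_bound; first lra.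
      exact: measurable_funS (continuous_measurable_fun (cD x)).
    move=> t /andP[lo hi]; apply: (HN _ _ _).2; lra.
  apply/norm_cvg0P.
  apply: (squeeze_cvgr (f := fun=> 0) (h := fun k => M1 * (N * (tau k + tau k)))).
  + by near=> k; rewrite normr_ge0 uB.
  + exact: cvg_cst.
  + rewrite -(mulr0 M1) -(mulr0 N) -(addr0 0); apply: cvgM; first exact: cvg_cst.
    apply: cvgM; first exact: cvg_cst.
    by apply: cvgD; exact: cvg_tau.
have phT' x : phi (x, 2) = 0 by apply: phT; exact: ltW.
rewrite tau0 in E; rewrite -[2]/(1 + 1) E /BR /BL tau0 /=.
rewrite (_ : torus_int _ = 0); last first.
  rewrite -[RHS](torus_int_cst 0); apply: eq_torus_int => x.
  by rewrite /ph phT' mxE mulr0.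
rewrite sub0r subrr; apply/eqP; rewrite addrC subr_eq0; apply/eqP.
by apply: eq_torus_int => x; rewrite dot_one.
Unshelve. all: by end_near. Qed.

End GlobalWeak.

(** * Bounded fields *)

Section Boundedness.
Context {R : realType}.
Local Notation S := (space3 R).
Local Notation ST := (spacetime R).
Variables (v : ST -> vec3 R) (M : R).
Hypothesis per : space_periodic v.
Hypothesis mv : forall i, measurable_fun [set: ST] (fun z => v z 0 i).
Hypothesis vM : forall z, `|v z| <= M.

Lemma bounded_measurable_field T : measurable_field T v.
Proof. by split=> // i; exact: measurable_funS (mv i). Qed.

Lemma ess_sup_lty d (T : measurableType d) (mu : {measure set T -> \bar R})
    (f : T -> \bar R) (C : \bar R) : (C < +oo)%E -> (forall x, `|f x| <= C)%E ->
  ('N[mu]_+oo[f] < +oo)%E.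
Proof.
move=> C1 fC; rewrite unlock /Lnorm; case: ifPn => // _.
by apply: le_lt_trans C1; apply/ess_supP; apply: nearW.
Qed.

Let M0 : 0 <= M. Proof. exact: le_trans (normr_ge0 (v 0)) (vM 0). Qed.

Lemma bounded_bounded_field T : bounded_field T v.
Proof.
split; first exact: bounded_measurable_field.
apply: (@ess_sup_lty _ _ _ _ M%:E); first exact: ltry.
move=> z; rewrite patchE; case: ifP => _; first by rewrite /= normr_id lee_fin.
by rewrite abse0 lee_fin.
Qed.

Lemma vec_normE (w : vec3 R) :
  `|w| = Num.max `|w 0 0| (Num.max `|w 0 1| `|w 0 2%:R|).
Proof.
apply/eqP; rewrite eq_le; apply/andP; split; last first.
  by rewrite !ge_max !vec_coord_le.
apply: vec_norm_le; first by rewrite le_max normr_ge0.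
by apply: ord3P; rewrite !le_max lexx ?orbT.
Qed.

(** The torus has volume [1], so the L^2 norm of a slice is at most the
    bound [M]. *)
Lemma bounded_energy_class T : energy_class T v.
Proof.
split; first exact: bounded_measurable_field.
pose C := ((M `^ 2)%:E `^ 2^-1)%E.
have Cfin : (C < +oo)%E by apply: poweR_lty; exact: ltry.
have mn t : measurable_fun [set: S] (fun x => `|v (x, t)|).
  have mvt i : measurable_fun [set: S] (fun x => `|v (x, t) 0 i|).
    apply: measurableT_comp => //; apply: (measurableT_comp (mv i)).
    exact: measurable_fun_pair.
  under eq_fun do rewrite vec_normE.
  by apply: measurable_maxr => //; exact: measurable_maxr.
have bnd t : ('N[mu_space]_2%:E[(fun x => `|v (x, t)|%:E) \_ cube] <= C)%E.
  rewrite unlock /Lnorm; apply: gt0_ler_poweR; rewrite ?invr_ge0//.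
  - by rewrite in_itv/= leey andbT; apply: integral_ge0 => x _; exact: poweR_ge0.
  - by rewrite in_itv/= leey andbT lee_fin powR_ge0.
  apply: le_trans (_ : (\int[mu_space]_(x in cube) (M `^ 2)%:E <= _)%E); last first.
    by rewrite integral_cst ?mu_cube ?mule1//; exact: measurable_cube.
  rewrite (_ : (\int[mu_space]_x _)%E =
      (\int[mu_space]_(x in cube) (`|v (x, t)| `^ 2)%:E)%E); last first.
    rewrite [RHS]integral_mkcond; apply: eq_integral => x _; rewrite !patchE.
    by case: ifP => _; [rewrite /= normr_id|rewrite abse0 poweR0r].
  apply: ge0_le_integral => //.
  - exact: measurable_cube.
  - apply/measurable_EFinP; apply: (@measurable_funS _ _ _ _ setT) => //.
    exact: (measurableT_comp (measurable_powR 2) (mn t)).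
  - by move=> x _; rewrite lee_fin ge0_ler_powR// ?nnegrE.
apply: (@ess_sup_lty _ _ _ _ C) => // t; rewrite patchE.
case: ifP => _; last by rewrite abse0 poweR_ge0.
by rewrite gee0_abs ?Lnorm_ge0 ?bnd.
Qed.

End Boundedness.

(** * Energy balance *)

Section Energy.
Context {R : realType}.
Local Notation S := (space3 R).
Local Notation ST := (spacetime R).
Variable g : nat -> R -> R.
Hypothesis g1 : forall k y, g k (y + 1) = g k y.
Hypothesis mg : forall k, measurable_fun [set: R] (g k).
Hypothesis gB : forall k y, `|g k y| <= tau k.+1 ^+ 2.
Variables f1 f2 : S -> R.
Hypotheses (d1 : datum f1) (d2 : datum f2).

Definition disp_energy k : R := torus_int (fun x => disp g k x * disp g k x).

Definition at_slab sg k (t : R) := [/\ slab t = k, side t = sg & phase k t =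
  ramp sg k t].

(** Transport by volume-preserving maps keeps the L^2 norm. *)
Lemma torus_int_datum_sqr f k t : datum f ->
  torus_int (fun x => scalar_at g f f k (x, t) * scalar_at g f f k (x, t))
  = torus_int (fun x => f x * f x).
Proof.
move=> df; have [[mf _] fper _] := df.
pose q x := f x * f x.
have mq : measurable_fun [set: S] q by exact: measurable_funM.
have qper : torus_periodic q by move=> j x; rewrite /q fper.
rewrite -[RHS](torus_int_back_flow g1 mg k mq qper).
rewrite -[RHS](@torus_int_shear _ g mg k (- step (phase k t)))//.
- by apply: eq_torus_int => x; rewrite /scalar_at /q /=; case: ifP.
- exact: (measurableT_comp mq (measurable_back_flow mg k)).
- by move=> j x /=; rewrite back_flow_periodic// qper.
Qed.

Lemma solution_energy sg k t : at_slab sg k t ->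
  torus_int (fun x => dot (solution g f1 f2 (x, t)) (solution g f1 f2 (x, t)))
  = prof1 sg k t ^+ 2 * disp_energy k
    + torus_int (fun x => (if t < 1 then f1 else f2) x * (if t < 1 then f1 else
      f2) x).
Proof.
move=> [sk sd ph]; set f := if t < 1 then f1 else f2.
have df : datum f by rewrite /f; case: ifP.
have bd := bounded_disp mg gB k.
have [bw _ _] := datum_scalar_at g1 mg k t df df.
rewrite -(torus_int_datum_sqr k t df) /disp_energy -torus_intZ;
  last exact: bounded_measM.
rewrite -torus_intD; [|by apply: bounded_measM (bounded_meas_cst _)
  (bounded_measM bd bd)
                      |exact: bounded_measM].
apply: eq_torus_int => x.
have E : solution g f1 f2 (x, t) = (prof1 sg k t * disp g k x) *: basis_vec (dirn k)
    + scalar_at g f f k (x, t) *: basis_vec 2%:R.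
  rewrite /solution /velocity /scalar /= sk; congr (_ *: _ + _ *: _).
    by rewrite /vel_at /= sd ph /prof1 [X in X * _]mulrC.
  by rewrite /scalar_at /= -/f; case: ifP.
have n2 := negbTE (dirn_neq2 k).
have n2' : (2%:R == dirn k) = false by rewrite eq_sym.
rewrite E dot_two !two_basisE !eqxx n2 n2'.
by rewrite mulr1 mulr0 addr0 mulr1 mulr0 add0r; ring.
Qed.

Definition power (t : R) : R :=
  torus_int (fun x => dot (force g (x, t)) (solution g f1 f2 (x, t))).

Lemma powerE sg k t : sg ^+ 2 = 1 -> at_slab sg k t ->
  power t = disp_energy k * (prof2 sg k t * prof1 sg k t).
Proof.
move=> sg2 [sk sd ph]; have bd := bounded_disp mg gB k.
rewrite mulrC /power /disp_energy -torus_intZ; last exact: bounded_measM.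
apply: eq_torus_int => x.
rewrite /force dot_one /solution /velocity /= sk two_basisE eqxx.
rewrite (negbTE (dirn_neq2 k)) mulr0 addr0 mulr1.
rewrite /force_at /vel_at /= ph sd /prof2 /prof1 -[X in X * _ * _ * _]mulr1 -sg2.
by field; rewrite gt_eqF ?tau_gt0.
Qed.

(** The force is the time derivative of the horizontal velocity, and is
    orthogonal to the vertical one. *)
Lemma power_integral sg k (a b : R) : a <= b -> sg ^+ 2 = 1 -> in_slab sg k a b ->
  time_int a b power =
  disp_energy k / 2 * (prof1 sg k b ^+ 2 - prof1 sg k a ^+ 2).
Proof.
move=> ab sg2 ins.
rewrite (eq_time_int (g := fun t => disp_energy k * (prof2 sg k t * prof1 sg k t))).
  have dF (t : R) : is_derive t (1 : R)
      (fun t => disp_energy k / 2 * (prof1 sg k t * prof1 sg k t))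
      (disp_energy k * (prof2 sg k t * prof1 sg k t)).
    have := is_derive_prof1 sg k t => d.
    by apply: is_derive_eq; rewrite -![_ *: _]/(_ * _); field.
  have cf : continuous (fun t => disp_energy k * (prof2 sg k t * prof1 sg k t)).
    move=> s; apply: cvgM; first exact: cvg_cst.
    apply: cvgM; first exact: continuous_prof2.
    exact: (@continuous_deriv _ (prof1 sg k) (prof2 sg k) (is_derive_prof1 sg k) s).
  rewrite (@time_int_FTC _ _ _ _ _ ab cf dF).
  by ring.
by move=> t /ins; exact: powerE.
Qed.

Lemma power_measurable_bounded : measurable_fun `]0, (2 : R)[ power /\
  exists B : R, forall t, 0 < t < 2 -> `|power t| <= B.
Proof.
have [M HM] := solution_bound gB d1 d2.
have mH : measurable_fun [set: ST] (fun z => dot (force g z) (solution g f1 f2 z)).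
  apply: measurable_dot => i; first exact: measurable_force.
  exact: measurable_solution.
have bH x t : 0 < t < 2 ->
    `|dot (force g (x, t)) (solution g f1 f2 (x, t))| <= 3 * (60 * M).
  by move=> _; apply: dot_bound; [exact: force_bound|exact: HM].
by have [_ mP bP] := torus_time_Fubini mH bH; split=> //; exists (3 * (60 * M)).
Qed.

(** Each complete half-slab starts and ends at rest, so it contributes
    nothing; only the one that contains [t] does. *)
Lemma time_int_power (t : R) : 0 < t < 2 -> t != 1 ->
  exists sg k, at_slab sg k t /\
    time_int 0 t power = disp_energy k / 2 * prof1 sg k t ^+ 2.
Proof.
move=> /andP[t0 t2] t1; set k := slab t.
have [mP [B PB]] := power_measurable_bounded.
have ta : `|t - 1| <= 1 by rewrite ler_norml; lra.
have /andP[lo hi] := slab_itv t1 ta; rewrite -/k in lo hi.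
have tS n : tau n.+1 <= tau n :> R by exact: tau_le.
have tp n : 0 < tau n :> R by exact: tau_gt0.
have tl n : tau n <= 1 :> R by exact: tau_le1.
have tk0 : tau k.+1 != 0 :> R by rewrite gt_eqF.
have [left right] : (forall m, time_int 0 (1 - tau m) power = 0) /\
    time_int 0 (1 + tau k.+1) power = 0.
  have [|||H1 H2] := @time_int_dyadic R power B (fun=> 0) (fun=> 0) k.+1 mP PB.
  - move=> n; have [[_ p2 _ p4] _] := prof_ends (R := R) n.
    rewrite (@power_integral 1 n) ?expr1n//; [|by have := tS n;
      lra|exact: in_slab_left].
    by rewrite p2 p4; ring.
  - move=> n; have [_ [_ p2 _ p4]] := prof_ends (R := R) n.
    rewrite (@power_integral (- 1) n) ?sqrrN ?expr1n//;
      [|by have := tS n; lra|exact: in_slab_right].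
    by rewrite p2 p4; ring.
  - by under eq_fun do rewrite subrr; exact: cvg_cst.
  by split=> [m|]; rewrite ?H1 ?H2 subrr.
have split3 b : 0 <= b -> b <= t ->
    time_int 0 t power = time_int 0 b power + time_int b t power.
  move=> b0 bt; apply: (@time_int_split R 0 b t power B) => //.
    by apply: measurable_funS mP => //; apply: subset_itvl; rewrite bnd_simp ltW.
  by move=> s /andP[s0 st]; apply: PB; rewrite s0 (lt_trans st).
have [lt1|gt1] := ltP t 1.
- have tn : `|t - 1| = 1 - t by rewrite ltr0_norm; lra.
  exists 1, k; split.
    split=> //; first by rewrite /side lt1.
    by rewrite phaseE ?(ltW lo)// tn /ramp; field.
  rewrite (split3 (1 - tau k)); [|have := tl k; lra|lra].
  rewrite left add0r (@power_integral 1 k) ?expr1n//; [|lra|].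
    have [[_ -> _ _] _] := prof_ends (R := R) k; ring.
  move=> s /andP[s1 s2]; apply: in_slab_left; rewrite s1/=; lra.
- have {}gt1 : 1 < t by rewrite lt_neqAle eq_sym t1.
  have tn : `|t - 1| = t - 1 by rewrite gtr0_norm; lra.
  exists (- 1), k; split.
    split=> //; first by rewrite /side ltNge (ltW gt1).
    by rewrite phaseE ?(ltW lo)// tn /ramp; field.
  rewrite (split3 (1 + tau k.+1)); [|have := tp k.+1; lra|lra].
  rewrite right add0r (@power_integral (- 1) k) ?sqrrN ?expr1n//; [|lra|].
    have [_ [_ _ _ ->]] := prof_ends (R := R) k; ring.
  move=> s /andP[s1 s2]; apply: in_slab_right; rewrite s1/=; lra.
Qed.

Hypothesis energy_le : torus_int (fun x => f2 x * f2 x) <= torus_int (fun x =>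
  f1 x * f1 x).

(** The work of the force is exactly the horizontal kinetic energy
    ([solution_energy], [time_int_power]), so the inequality reduces to the one
    between the energies of [f1] and [f2]. *)
Lemma solution_admissible :
  admissible 2 (force g) (fun x => f1 x *: basis_vec 2%:R) (solution g f1 f2).
Proof.
have [M HM] := solution_bound gB d1 d2.
split.
  apply: (bounded_energy_class (M := M)) => //.
    exact: solution_periodic.
  by move=> i; exact: measurable_solution.
exists [set (1 : R)]; split=> //; first exact: lebesgue_measure_set1.
move=> t /= nt; apply: contrapT => t1; apply: nt => t02.
have {}t1 : t != 1 by apply/eqP.
have [sg [k [at_ E]]] := time_int_power t02 t1.
rewrite (solution_energy at_) -[time_int 0 t _]/(time_int 0 t power) E.
rewrite (_ : torus_int (fun x => dot (f1 x *: _) _) = torus_int (fun x => f1 x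
  * f1 x)).
  rewrite [leLHS]addrC; apply: lerD; first by case: ifP.
  by rewrite le_eqVlt; apply/orP; left; apply/eqP; field.
by apply: eq_torus_int => x; rewrite dot_one one_basisE eqxx mulr1.
Qed.

End Energy.

(** * Hölder regularity of the force *)

Section Holder.
Context {R : realType}.
Local Notation S := (space3 R).
Local Notation ST := (spacetime R).

Lemma powR_homo (a x y : R) : 0 <= a -> 0 <= x -> x <= y -> x `^ a <= y `^ a.
Proof. by move=> a0 x0 xy; apply: ge0_ler_powR;
  rewrite ?nnegrE// (le_trans x0). Qed.

(** Use the first bound when [ka <= de] and the second one otherwise; in
    both cases the factor [x `^ (1 - al)] of the smaller of [ka], [de] absorbs
    the powers of [4] or [8]. *)
Lemma holder_interpolation (al X Y ka de D : R) (k : nat) :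
  0 < al < 1 -> 0 < ka -> ka `^ (1 - al) <= (8 ^+ k)^-1 ->
  0 <= X -> 0 <= Y -> 0 <= de ->
  D <= X * 4 ^+ k * ka -> D <= Y * 8 ^+ k * de -> D <= (X + Y) * de `^ al.
Proof.
move=> /andP[al0 al1] ka0 kaB X0 Y0 de0 DX DY.
have split (x : R) : 0 < x -> x = x `^ (1 - al) * x `^ al.
  by move=> x0; rewrite -powRD ?subrK ?powRr1 ?ltW// gt_eqF ?implybT.
have p8 : 0 < 8 ^+ k :> R by rewrite exprn_gt0.
have dea0 : 0 <= de `^ al by exact: powR_ge0.
have [kd|dk] := leP ka de.
- apply: le_trans DX _; rewrite {1}(split _ ka0).
  apply: le_trans (_ : X * de `^ al <= _); last by rewrite ler_wpM2r// lerDl.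
  rewrite -mulrA ler_wpM2l// mulrA; apply: le_trans (_ : 1 * ka `^ al <= _).
    apply: ler_wpM2r; first exact: powR_ge0.
    apply: le_trans (_ : 4 ^+ k * (8 ^+ k)^-1 <= _).
      by apply: ler_wpM2l => //; exact: exprn_ge0.
    by rewrite ler_pdivrMr// mul1r; apply: lerXn2r; rewrite ?nnegrE ?ler_nat.
  by rewrite mul1r; apply: powR_homo => //; exact: ltW.
- apply: le_trans DY _.
  have [->|dn0] := eqVneq de 0; first by rewrite mulr0 mulr_ge0// addr_ge0.
  have dp : 0 < de by rewrite lt_neqAle eq_sym dn0.
  rewrite {1}(split _ dp).
  apply: le_trans (_ : Y * de `^ al <= _); last by rewrite ler_wpM2r// lerDr.
  rewrite -mulrA ler_wpM2l// mulrA -[leRHS]mul1r ler_wpM2r//.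
  rewrite -ler_pdivlMl// mulr1.
  apply: le_trans kaB; apply: powR_homo => //; last exact: ltW.
  by rewrite subr_ge0 ltW.
Qed.

Lemma step2_lipschitz (s s' : R) : 0 <= s <= 1 -> 0 <= s' <= 1 ->
  `|step2 s - step2 s'| <= 780 * `|s - s'|.
Proof.
move=> /andP[s0 s1] /andP[t0 t1].
have -> : step2 s - step2 s' =
    (60 - 180 * (s + s') + 120 * (s ^+ 2 + s * s' + s' ^+ 2)) * (s - s').
  by rewrite /step2; ring.
(* 780 = 60 + 2 * 180 + 3 * 120. *)
rewrite normrM; apply: ler_wpM2r => //; rewrite ler_norml; nra.
Qed.

Lemma clip_lipschitz (a b x y : R) :
  `|Num.min b (Num.max a x) - Num.min b (Num.max a y)| <= `|x - y|.
Proof.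
have max1 (u v : R) : `|Num.max a u - Num.max a v| <= `|u - v|.
  rewrite ler_norml /Num.max; have := ler_norm (u - v); have := ler_norm (v - u).
  by rewrite distrC; case: ltP => ?; case: ltP => ? ? ?; apply/andP; split; lra.
apply: le_trans (max1 x y); move: (Num.max a x) (Num.max a y) => u v.
rewrite ler_norml /Num.min; have := ler_norm (u - v); have := ler_norm (v - u).
by rewrite distrC; case: ltP => ?; case: ltP => ? ? ?; apply/andP; split; lra.
Qed.

Lemma phase_lipschitz k (t t' : R) :
  `|phase k t - phase k t'| <= (tau k.+1)^-1 * `|t - t'|.
Proof.
apply: le_trans (clip_lipschitz _ _ _ _) _.
have -> : 2 - `|t - 1| / tau k.+1 - (2 - `|t' - 1| / tau k.+1) =
    (tau k.+1)^-1 * (`|t' - 1| - `|t - 1|) by ring.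
have t0 : 0 <= (tau k.+1)^-1 :> R by rewrite invr_ge0 ltW// tau_gt0.
rewrite normrM (ger0_norm t0); apply: ler_wpM2l => //.
apply: le_trans (ler_dist_dist _ _) _.
have -> : t' - 1 - (t - 1) = t' - t by ring.
by rewrite distrC.
Qed.

(** Outside of its slab a phase is [0] or [1], where [step2] vanishes. *)
Lemma step2_off_slab k (t : R) : slab t <> k -> step2 (phase k t) = 0.
Proof.
move=> nk; have t0 : 0 < tau k.+1 :> R by exact: tau_gt0.
have [|] := leP `|t - 1| (tau k.+1) => [le|gt].
  have -> : phase k t = 1; last by rewrite /step2; ring.
  rewrite /phase; apply/min_idPl; rewrite le_max; apply/orP; right.
  have : `|t - 1| / tau k.+1 <= 1 by rewrite ler_pdivrMr// mul1r.
  lra.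
have {}gt' : tau k < `|t - 1|.
  by rewrite ltNge; apply/negP => le; apply: nk; apply: slabE; rewrite gt.
have -> : phase k t = 0; last by rewrite /step2; ring.
rewrite /phase max_l ?min_r//.
have : 2 <= `|t - 1| / tau k.+1 by rewrite ler_pdivlMr// mulrDl mul1r -tauS ltW.
lra.
Qed.

Lemma le_norm_pair (V W : normedModType R) (x : V * W) :
  `|x.1| <= `|x| /\ `|x.2| <= `|x|.
Proof. by rewrite [`|x|]prod_normE !le_max !lexx orbT. Qed.

Lemma coord_norm j (x y : S) : `|coord j x - coord j y| <= `|x - y|.
Proof.
have [a b] := le_norm_pair (x - y); have [c d] := le_norm_pair (x.1 - y.1).
elim/ord3P: j; rewrite /coord/=; [exact: le_trans c a|exact: le_trans d a|exact: b].
Qed.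

Variable g : nat -> R -> R.
Variables (al K L : R).
Hypothesis al01 : 0 < al < 1.
Hypothesis K1 : 1 <= K.
Hypothesis K8 : forall k, (K ^+ k)^-1 `^ (1 - al) <= (8 ^+ k)^-1.
Hypothesis L0 : 0 <= L.
Hypothesis gK : forall k y, `|g k y| <= (K ^+ k.+1)^-1.
Hypothesis gL : forall k y y', `|g k y - g k y'| <= L * 2 ^+ k * `|y - y'|.

Lemma force_at_holder k (z w : ST) :
  `|force_at g k z - force_at g k w| <=
  (480 + (240 * L + 6240)) * `|z - w| `^ al.
Proof.
have Kp : 0 < K by exact: lt_le_trans K1.
have kp : 0 < (K ^+ k)^-1 by rewrite invr_gt0 exprn_gt0.
have [zw1 zw2] := le_norm_pair (z - w).
have tE1 : (tau k.+1)^-1 = 2 * 2 ^+ k :> R by rewrite /tau exprVn invrK exprS.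
have tE : (tau k.+1 ^+ 2)^-1 = 4 * 4 ^+ k :> R.
  rewrite -exprVn tE1 exprMn -exprM mulnC exprM.
  by have -> : 2 ^+ 2 = 4 :> R by ring.
have gk y : `|g k y| <= (K ^+ k)^-1.
  apply: le_trans (gK k y) _; rewrite lef_pV2 ?posrE ?exprn_gt0//.
  by rewrite exprS ler_peMl// exprn_ge0// ltW.
have kle1 : (K ^+ k)^-1 <= 1 by rewrite invf_le1 ?exprn_gt0// exprn_ege1.
pose A (u : ST) := step2 (phase k u.2); pose B (u : ST) := disp g k u.1.
have AB u : force_at g k u = 4 * 4 ^+ k * (A u * B u).
  by rewrite /force_at tE mulrA.
have A60 u : `|A u| <= 60 by have [] := step_bound (phase01 k u.2).
have Bk u : `|B u| <= (K ^+ k)^-1 by exact: gk.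
have AL : `|A z - A w| <= 780 * (2 * 2 ^+ k * `|z - w|).
  apply: le_trans (step2_lipschitz (phase01 k _) (phase01 k _)) _.
  have c0 : 0 <= 780 :> R by rewrite ler0n.
  apply: (ler_wpM2l c0); apply: le_trans (phase_lipschitz _ _ _) _.
  by rewrite tE1 ler_wpM2l// mulr_ge0// exprn_ge0.
have BL : `|B z - B w| <= L * 2 ^+ k * `|z - w|.
  apply: le_trans (gL _ _ _) _; apply: ler_wpM2l.
    by rewrite mulr_ge0// exprn_ge0.
  exact: le_trans (coord_norm _ _ _) zw1.
have p4 : 0 <= 4 * 4 ^+ k :> R by rewrite mulr_ge0// exprn_ge0.
have p2 : 1 <= 2 ^+ k :> R by rewrite exprn_ege1// ler1n.
have AB60 u : `|A u * B u| <= 60 * (K ^+ k)^-1 by rewrite normrM ler_pM.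
have E8 : 8 ^+ k = 4 ^+ k * 2 ^+ k :> R by rewrite -exprMn; congr (_ ^+ _); ring.
rewrite !AB -mulrBr normrM (ger0_norm p4).
have X0 : 0 <= 480 :> R by rewrite ler0n.
have Y0 : 0 <= 240 * L + 6240.
  by apply: addr_ge0; [apply: mulr_ge0 => //; rewrite ler0n|rewrite ler0n].
(* 480 = 4 * (60 + 60) bounds the difference by the two values; 240 = 4 * 60 and
   6240 = 4 * 780 * 2 come from the product rule. *)
apply: (holder_interpolation al01 kp (K8 k) X0 Y0 (normr_ge0 _)).
- apply: le_trans (_ : 4 * 4 ^+ k * (60 * (K ^+ k)^-1 + 60 * (K ^+ k)^-1) <= _).
    apply: (ler_wpM2l p4); apply: le_trans (ler_normB _ _) _; exact: lerD.
  by rewrite le_eqVlt; apply/orP; left; apply/eqP; ring.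
- have -> : A z * B z - A w * B w = A z * (B z - B w) + (A z - A w) * B w by ring.
  apply: le_trans (_ : 4 * 4 ^+ k * (60 * (L * 2 ^+ k * `|z - w|) +
     780 * (2 * 2 ^+ k * `|z - w|) * 1) <= _).
    apply: (ler_wpM2l p4); apply: le_trans (ler_normD _ _) _.
    rewrite (normrM (A z)) (normrM (A z - A w)); apply: lerD.
      apply: ler_pM; [exact: normr_ge0|exact: normr_ge0|exact: A60|exact: BL].
    apply: ler_pM; [exact: normr_ge0|exact: normr_ge0|exact: AL|].
    exact: le_trans (Bk w) kle1.
  by rewrite E8 le_eqVlt; apply/orP; left; apply/eqP; ring.
Qed.

(** Two points of the same slab are compared by [force_at_holder].  If the
    slabs differ, each of the two values is compared with the value [0] of the
    same slab force at the other point. *)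
Lemma force_holder : exists2 C : R, 0 <= C &
  forall z w : ST, `|force g z - force g w| <= C * `|z - w| `^ al.
Proof.
have [C C0 HC] : exists2 C : R, 0 <= C & forall k (z w : ST),
    `|force_at g k z - force_at g k w| <= C * `|z - w| `^ al.
  eexists; last exact: force_at_holder.
  by apply: addr_ge0; [rewrite ler0n|apply: addr_ge0; [apply: mulr_ge0|];
    rewrite ?ler0n].
have off k (u : ST) : slab u.2 <> k -> force_at g k u = 0.
  by move=> /step2_off_slab u0; rewrite /force_at u0 mulr0 mul0r.
exists (C + C); first exact: addr_ge0.
move=> z w; rewrite mulrDl.
have H0 : 0 <= C * `|z - w| `^ al by rewrite mulr_ge0// powR_ge0.
have [e|/eqP ne] := eqVneq (slab z.2) (slab w.2).
  rewrite /force e -scalerBl; apply: le_trans (_ : C * `|z - w| `^ al <= _).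
    exact: normr_basis_le.
  by rewrite lerDl.
apply: le_trans (ler_normB _ _) _; apply: lerD; apply: normr_basis_le.
  by have := HC (slab z.2) z w; rewrite [force_at g _ w]off ?subr0// => h;
    apply: ne.
by have := HC (slab w.2) z w; rewrite [force_at g _ z]off ?sub0r ?normrN.
Qed.

Lemma holder_continuous (V W : normedModType R) (f : V -> W) (C : R) : 0 <= C ->
  (forall z w, `|f z - f w| <= C * `|z - w| `^ al) -> continuous f.
Proof.
move=> C0 fC z; have [al0 _] := andP al01.
apply/cvgrPdist_le => e e0.
have C1 : 0 < C + 1 by rewrite ltr_wpDl.
pose de := (e / (C + 1)) `^ al^-1.
have de0 : 0 < de by rewrite powR_gt0// divr_gt0.
near=> w.
have zw : `|z - w| <= de.
  by near: w; apply/nbhs_normP; exists de => //= y /ltW.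
have zwa : `|z - w| `^ al <= de `^ al by apply: powR_homo => //; exact: ltW.
apply: le_trans (fC _ _) _; apply: le_trans (ler_wpM2l C0 zwa) _.
rewrite /de -powRrM mulVf ?gt_eqF// powRr1; last by rewrite divr_ge0// ltW.
rewrite mulrA ler_pdivrMr// mulrC; apply: ler_wpM2l; first exact: ltW.
by rewrite lerDl.
Unshelve. all: by end_near. Qed.

End Holder.

(** * Square waves on the line *)

Section SquareWave.
Context {R : realType}.
Implicit Types (x y L : R) (m : nat).
Local Notation floor := Num.floor.

(** The floor makes [square_waveDhalf] exact everywhere; a sign of a cosine
    would fail at its zeros. *)
Definition square_wave x : R := (-1) ^ floor (2 * x + 2^-1).

(** The tent of slope [1], positive at distance less than [1 / 4] from the
    integers and negative beyond; off its zeros its sign is the square wave. *)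
Definition quarter_dist x : R := 4^-1 - `|x - (floor (x + 2^-1))%:~R|.

(** The Lipschitz regularization of [square_wave] used in the shears. *)
Definition trapezoid L x : R := Num.min 1 (Num.max (- 1) (L * quarter_dist x)).

(** The indicator of the points within [1 / (4 * m)] of a jump of
    [square_wave], written with a divisibility so that its [m] translates by
    multiples of [1 / (2 * m)] add up to exactly [1]. *)
Definition notch m x : R :=
  ((m%:Z %| floor (m%:R * (2 * x + 2^-1) + 2^-1))%Z)%:R.

Lemma floorDint x (z : int) : floor (x + z%:~R) = floor x + z.
Proof. by rewrite floorDrz ?intrKfloor// rpred_int_num. Qed.

Lemma floor_bounds x : (floor x)%:~R <= x < (floor x)%:~R + 1.
Proof. by have := floor_itv x; rewrite intrD. Qed.

Lemma intr_lt_le (z n : int) : z < n -> z%:~R + 1 <= n%:~R :> R.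
Proof. by move=> zn; rewrite -(intrD _ z 1) ler_int lezD1. Qed.

Lemma measurable_floor_comp d (T : measurableType d) (h : int -> T) :
  measurable_fun [set: R] (fun x => h (floor x)).
Proof.
move=> _ Y mY; rewrite setTI.
rewrite (_ : _ @^-1` Y = \bigcup_(z : int)
    (if `[< Y (h z) >] then [set x : R | z%:~R <= x < z%:~R + 1] else set0)).
  apply: countable_bigcupT_measurable => // z; case: ifP => // _.
  by rewrite -set_itvco.
apply/seteqP; split=> [x Yx|x [z _]].
  exists (floor x) => //; case: ifPn => [_|/asboolP//].
  exact: floor_bounds.
case: ifPn => // /asboolP Yz zx; rewrite /=.
by rewrite (floor_def (m := z)) ?intrD//.
Qed.

Lemma square_wave_norm x : `|square_wave x| = 1.
Proof. by rewrite /square_wave expN1r normrX normrN1 expr1n. Qed.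

Lemma square_waveDhalf x : square_wave (x + 2^-1) = - square_wave x.
Proof.
rewrite /square_wave (_ : _ + 2^-1 = 2 * x + 2^-1 + (1 : int)%:~R); last by field.
by rewrite floorDint expfzDr// mulrN1.
Qed.

Lemma square_waveD1 x : square_wave (x + 1) = square_wave x.
Proof.
by rewrite -[RHS]opprK -!square_waveDhalf; congr square_wave; field.
Qed.

Lemma measurable_square_wave : measurable_fun [set: R] square_wave.
Proof.
apply: (@measurableT_comp _ _ _ _ _ _ (fun x => (-1 : R) ^ floor x)).
  exact: (measurable_floor_comp (fun z => (-1 : R) ^ z)).
by apply: measurable_funD => //; apply: measurable_funM.
Qed.

(** The maximum over the integers of functions of slope [1], which gives
    the Lipschitz bound at once. *)
Lemma quarter_dist_max x (z : int) : 4^-1 - `|x - z%:~R| <= quarter_dist x.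
Proof.
rewrite /quarter_dist lerD2l lerN2; set n := floor _.
have /andP[n1 n2] : n%:~R <= x + 2^-1 < n%:~R + 1 by exact: floor_bounds.
have xn : `|x - n%:~R| <= 2^-1 by rewrite ler_norml; lra.
have [->//|] := eqVneq z n; rewrite neq_lt => /orP[] /intr_lt_le zn.
  by apply: le_trans xn (le_trans _ (ler_norm _)); lra.
by rewrite (distrC x (z%:~R)); apply: le_trans xn (le_trans _ (ler_norm _)); lra.
Qed.

Lemma quarter_dist_lipschitz x y :
  `|quarter_dist x - quarter_dist y| <= `|x - y|.
Proof.
wlog le : x y / quarter_dist y <= quarter_dist x.
  move=> H; case/orP: (le_total (quarter_dist y) (quarter_dist x)) => /H//.
  by move=> h; rewrite distrC (le_trans h)// distrC.
rewrite ger0_norm ?subr_ge0//.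
have := quarter_dist_max y (floor (x + 2^-1)).
rewrite {2}/quarter_dist; set z := _%:~R.
have : `|y - z| <= `|x - y| + `|x - z|.
  by rewrite [X in _ <= X + _]distrC (le_trans _ (ler_normD _ _))// subrKA.
move: (`|x - y|) (`|x - z|) (`|y - z|) (quarter_dist y) => *; lra.
Qed.

Lemma quarter_distD1 x : quarter_dist (x + 1) = quarter_dist x.
Proof.
rewrite /quarter_dist (_ : x + 1 + 2^-1 = x + 2^-1 + (1 : int)%:~R); last by field.
by rewrite floorDint intrD opprD addrACA subrr addr0.
Qed.

Lemma square_wave_pos x : 0 < quarter_dist x -> square_wave x = 1.
Proof.
rewrite /quarter_dist /square_wave; set n := floor (x + _) => h.
have {h} : `|x - n%:~R| < 4^-1 by move: h; rewrite subr_gt0.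
rewrite ltr_norml => h.
rewrite (floor_def (m := n + n)); last by rewrite !intrD; lra.
by rewrite expfzDr// expN1r -expr2 sqrr_sign.
Qed.

Lemma square_wave_neg x : quarter_dist x < 0 -> square_wave x = - 1.
Proof.
rewrite /quarter_dist; set n := floor (x + _); rewrite subr_lt0 => h.
have /andP[n1 n2] : n%:~R <= x + 2^-1 < n%:~R + 1 by exact: floor_bounds.
have dbl (e : int) : (-1 : R) ^ (n + n + e) = (-1) ^ e.
  by rewrite !expfzDr// !expN1r -[X in X * _]expr2 sqrr_sign mul1r.
rewrite /square_wave; have [xn|xn] := leP 0 (x - n%:~R).
  move: h; rewrite ger0_norm// => h.
  rewrite (floor_def (m := n + n + 1)) ?dbl ?expr1z// !intrD; lra.
move: h; rewrite ltr0_norm// => h.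
rewrite (floor_def (m := n + n - 1)) ?dbl ?exprN1 ?invrN1// !intrD mulrN1z; lra.
Qed.

Lemma measurable_notch m : measurable_fun [set: R] (notch m).
Proof.
apply: (@measurableT_comp _ _ _ _ _ _
  (fun x => ((m%:Z %| floor x)%Z : bool)%:R : R)).
  exact: (measurable_floor_comp (fun z => ((m%:Z %| z)%Z : bool)%:R : R)).
apply: measurable_funD => //; apply: measurable_funM => //.
by apply: measurable_funD => //; apply: measurable_funM.
Qed.

Lemma notch_ge0 m x : 0 <= notch m x <= 1.
Proof. by rewrite /notch; case: (_ %| _)%Z;
  rewrite /= ?lexx ?ler01 ?ler0n ?lern1. Qed.

Lemma notch_period m x (n : nat) : notch m (x + n%:R) = notch m x.
Proof.
rewrite /notch (_ : _ + 2^-1 = m%:R * (2 * x + 2^-1) + 2^-1 +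
  (m%:Z * (n.*2)%:Z)%:~R); last by rewrite intrM -!pmulrn -mul2n natrM; field.
by rewrite floorDint rpredDr ?dvdz_mulr.
Qed.

(** The translation by [j / (2 * m)] adds [j] to the integer whose
    divisibility by [m] is tested, and exactly one of [m] consecutive integers
    is divisible by [m]. *)
Lemma sum_notch m x : (0 < m)%N ->
  \sum_(j < m) notch m (x + j%:R / (2 * m%:R)) = 1.
Proof.
move=> m0; have m0' : m%:R != 0 :> R by rewrite pnatr_eq0 -lt0n.
pose z := floor (m%:R * (2 * x + 2^-1) + 2^-1).
have E (j : nat) : notch m (x + j%:R / (2 * m%:R)) = ((m%:Z %| z + j%:Z)%Z)%:R.
  rewrite /notch (_ : _ + 2^-1 = m%:R * (2 * x + 2^-1) + 2^-1 + j%:Z%:~R).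
    by rewrite floorDint.
  by rewrite -pmulrn; field; rewrite m0'.
under eq_bigr do rewrite E.
have m0z : m%:Z != 0 by rewrite -lt0n.
have r1 : (((- z) %% m%:Z)%Z < m%:Z) by rewrite ltz_mod.
have r0 : 0 <= ((- z) %% m%:Z)%Z by rewrite modz_ge0.
move: r0 r1; case r : ((- z) %% m%:Z)%Z => [p|//] _; rewrite ltz_nat => pm.
have D (j : 'I_m) : ((m%:Z %| z + j%:Z)%Z) = (j == Ordinal pm).
  apply/idP/eqP => [h|->/=].
    apply: val_inj; rewrite /=; apply/eqP; rewrite -(eqz_nat j p) -r.
    have -> : (- z = j%:Z %[mod m%:Z])%Z.
      by apply/eqP; rewrite eqz_mod_dvd -opprD rpredN.
    by rewrite modz_small//= ltz_nat ltn_ord.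
  by rewrite -r addrC -[X in _ + X]opprK -eqz_mod_dvd modz_mod.
under eq_bigr do rewrite D.
by rewrite (bigD1 (Ordinal pm))//= eqxx big1 ?addr0// => j /negPf ->.
Qed.

(** Away from the jumps the tent is at least [1 / (4 * m)] in absolute value,
    so the clipping saturates. *)
Lemma trapezoid_off_notch m x : (0 < m)%N -> notch m x = 0 ->
  trapezoid (4 * m%:R) x = square_wave x.
Proof.
move=> m0 h; have m0' : 0 < m%:R :> R by rewrite ltr0n.
have big : 1 <= (4 * m%:R) * `|quarter_dist x|.
  rewrite leNgt; apply/negP => small; move: h; rewrite /notch.
  suff -> : (m%:Z %| floor (m%:R * (2 * x + 2^-1) + 2^-1))%Z.
    by move/eqP; rewrite oner_eq0.
  have : `|4 * m%:R * quarter_dist x| < 1.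
    by rewrite normrM (gtr0_norm (_ : 0 < 4 * m%:R))// mulr_gt0.
  rewrite ltr_norml /quarter_dist; set n := floor (x + _).
  have [xn|xn] := leP 0 (x - n%:~R).
    rewrite ger0_norm// => h.
    rewrite (floor_def (m := m%:Z * (n + n + 1))) ?dvdz_mulr//.
    rewrite intrD intrM !intrD -!pmulrn; lra.
  rewrite ltr0_norm// => h.
  rewrite (floor_def (m := m%:Z * (n + n))) ?dvdz_mulr//.
  rewrite intrD intrM !intrD -!pmulrn; lra.
rewrite /trapezoid; have [q|q|q] := ltgtP (quarter_dist x) 0.
- move: big; rewrite ltr0_norm// square_wave_neg// => big.
  by rewrite max_l ?min_r//; lra.
- move: big; rewrite gtr0_norm// square_wave_pos// => big.
  by rewrite max_r ?min_l//; lra.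
- by move: big; rewrite q normr0 mulr0 ler10.
Qed.
End SquareWave.

(** * Measure of the bad strips, and the spatial shear *)

Section Notches.
Context {R : realType}.
Local Notation S := (space3 R).

Lemma torus_int_sum n (F : nat -> S -> R) :
  (forall j, bounded_meas (F j)) ->
  torus_int (fun x => \sum_(j < n) F j x) = \sum_(j < n) torus_int (F j)
  /\ bounded_meas (fun x => \sum_(j < n) F j x).
Proof.
move=> bF; elim: n => [|n [IH bn]].
  by rewrite big_ord0; under eq_fun do rewrite big_ord0; split;
    [exact: torus_int_cst|exact: bounded_meas_cst].
rewrite big_ord_recr/= -IH; under eq_fun do rewrite big_ord_recr/=.
by split; [exact: torus_intD|exact: bounded_measD].
Qed.

Lemma measurable_scaled_coord (a : R) j :
  measurable_fun [set: S] (fun x => a * coord j x).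
Proof. by apply: measurable_funM => //; exact: measurable_coord. Qed.

Lemma bounded_meas_notch m (N : nat) j :
  bounded_meas (fun x : S => notch m (N%:R * coord j x)).
Proof.
split; last by exists 1 => x; have /andP[a b] := notch_ge0 m (N%:R * coord j x);
  rewrite ger0_norm.
exact: (measurableT_comp (measurable_notch m) (measurable_scaled_coord _ _)).
Qed.

(** The [m] translates of the strips have the same measure and partition
    the torus, so no description of the strips is needed. *)
Lemma torus_int_notch m (N : nat) j : (0 < m)%N -> (0 < N)%N ->
  torus_int (fun x : S => notch m (N%:R * coord j x)) = m%:R^-1.
Proof.
move=> m0 N0.
have m0' : m%:R != 0 :> R by rewrite pnatr_eq0 -lt0n.
have N0' : N%:R != 0 :> R by rewrite pnatr_eq0 -lt0n.
pose G (x : S) := notch m (N%:R * coord j x).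
have coords (x : S) a : coord j (x + a *: unit_vec j) = coord j x + a.
  by rewrite shiftE; case: x => -[? ?] ?; elim/ord3P: j {G}.
have E (i : nat) : torus_int (fun x => notch m (N%:R * coord j x + i%:R / (2 *
  m%:R)))
    = torus_int G.
  rewrite -(@torus_int_shift _ j (fun=> i%:R / (2 * m%:R * N%:R)) G)//.
  - apply: eq_torus_int => x; rewrite /G coords; congr notch.
    by field; rewrite m0' N0'.
  - by case: (bounded_meas_notch m N j).
  - move=> x; rewrite /G -[unit_vec j]scale1r coords mulrDr mulr1.
    exact: notch_period.
have bF (i : nat) : bounded_meas
    (fun x : S => notch m (N%:R * coord j x + i%:R / (2 * m%:R))).
  split; last first.
    by exists 1 => x; case/andP: (notch_ge0 m (N%:R * coord j x + i%:R / (2 *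
      m%:R))) => a b; rewrite ger0_norm.
  apply: (measurableT_comp (measurable_notch m)); apply: measurable_funD => //.
  exact: measurable_scaled_coord.
have [T _] := torus_int_sum m bF.
move: T; under eq_torus_int do rewrite sum_notch//.
rewrite torus_int_cst; under eq_bigr do rewrite E.
rewrite sumr_const card_ord => T; apply: (mulfI m0').
by rewrite mulfV// mulr_natl -T.
Qed.

(** For [N = 0] the argument is the point [0], at distance [1 / 4] from the
    jumps; the parity of the width parameter places it off the notch. *)
Lemma torus_int_notch_le m (N : nat) j : (0 < m)%N ->
  torus_int (fun x : S => notch m.*2 (N%:R * coord j x)) <= m.*2%:R^-1.
Proof.
move=> m0; have [->|N0] := posnP N; last first.
  by rewrite torus_int_notch// double_gt0.
under eq_torus_int => x.
  rewrite mul0r /notch (_ : _ + 2^-1 = m%:R + 2^-1); last first.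
    by rewrite -muln2 natrM; field.
  rewrite (floor_def (m := m)); last by rewrite intrD -!pmulrn; lra.
  rewrite dvdzE /= gtnNdvd//; last by rewrite -addnn -[ltnLHS]addn0 ltn_add2l.
  over.
by rewrite torus_int_cst invr_ge0.
Qed.

End Notches.

Section Frequencies.
Context {R : realType}.
Implicit Types (x y L : R) (k : nat).

Lemma trapezoid_lipschitz L x y : 0 <= L ->
  `|trapezoid L x - trapezoid L y| <= L * `|x - y|.
Proof.
move=> L0; apply: le_trans (clip_lipschitz _ _ _ _) _.
by rewrite -mulrBr normrM ger0_norm// ler_wpM2l// quarter_dist_lipschitz.
Qed.

Lemma trapezoid_bound L x : `|trapezoid L x| <= 1.
Proof. 
by rewrite /trapezoid ler_norml le_min ge_min le_max !lexx /= !andbT ge0_cp.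
Qed.

Lemma trapezoidDn L x (n : nat) : trapezoid L (x + n%:R) = trapezoid L x.
Proof.
elim: n => [|n IH]; first by rewrite addr0.
by rewrite -natr1 addrA /trapezoid quarter_distD1.
Qed.

Variable K : nat.
Hypothesis K8 : (8 <= K)%N.

(** The frequency [0] makes the first checkerboard a set of stripes,
    correlated with a smooth datum of one variable. *)
Definition freq k : nat := if k is 0 then 0 else (K ^ k)%N.

(** Its inverse is the measure of the bad strips, summable in [k]. *)
Definition sharpness k : nat := (2 ^ (k + 6))%N.

(** Half of the difference of two square waves, regularized, times the half
    period [1 / (2 * freq k.+1)] of the next wave: where the waves of frequencies
    [freq k] and [freq k.+2] differ, the shear exchanges the colours of the wave
    of frequency [freq k.+1], and elsewhere it does nothing. *)
Definition shear_profile k y : R :=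
  (trapezoid (4 * (sharpness k)%:R) ((freq k.+2)%:R * y)
   - trapezoid (4 * (sharpness k)%:R) ((freq k)%:R * y)) / (4 * (freq k.+1)%:R).

Let K0 : 0 < K%:R :> R.
Proof. by rewrite ltr0n; apply: leq_trans K8. Qed.

Let freqS_gt0 k : 0 < (freq k.+1)%:R :> R.
Proof. by rewrite ltr0n expn_gt0; apply/orP; left; apply: leq_trans K8. Qed.

Lemma shear_profile_period k y : shear_profile k (y + 1) = shear_profile k y.
Proof. by rewrite /shear_profile !mulrDr !mulr1 !trapezoidDn. Qed.

Lemma shear_profile_bound k y : `|shear_profile k y| <= (K%:R ^+ k.+1)^-1.
Proof.
rewrite /shear_profile normrM normfV (gtr0_norm (_ : 0 < 4 * _))//; last first.
  by rewrite mulr_gt0.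
rewrite /freq -natrX ler_pdivrMr ?mulr_gt0 ?(freqS_gt0 k)//.
have -> : (K ^ k.+1)%:R^-1 * (4 * (K ^ k.+1)%:R) = 4 :> R.
  by rewrite mulrCA mulVf ?mulr1// gt_eqF// (freqS_gt0 k).
rewrite (le_trans (ler_normB _ _))//.
have := trapezoid_bound (4 * (sharpness k)%:R) ((freq k.+2)%:R * y).
have := trapezoid_bound (4 * (sharpness k)%:R) ((freq k)%:R * y).
rewrite /freq/=; move: `|_| `|_| => *; lra.
Qed.

Lemma shear_profile_le_tau k y : `|shear_profile k y| <= tau k.+1 ^+ 2.
Proof.
apply: le_trans (shear_profile_bound k y) _.
rewrite /tau -exprM mulnC exprM -exprVn lerXn2r ?nnegrE ?invr_ge0 ?exprn_ge0//.
rewrite exprVn lef_pV2 ?posrE// -natrX ler_nat.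
exact: leq_trans K8.
Qed.

Lemma shear_profile_lipschitz k y y' :
  `|shear_profile k y - shear_profile k y'| <= (128 * K%:R) * 2 ^+ k * `|y - y'|.
Proof.
rewrite /shear_profile -mulrBl normrM normfV (gtr0_norm (_ : 0 < 4 * _))//;
  last first.
  by rewrite mulr_gt0.
rewrite ler_pdivrMr ?mulr_gt0//.
set L := 4 * _; have L0 : 0 <= L by rewrite mulr_ge0.
set a := (freq k.+2)%:R; set b := (freq k)%:R.
have ha := trapezoid_lipschitz (a * y) (a * y') L0.
have hb := trapezoid_lipschitz (b * y) (b * y') L0.
rewrite -mulrBr normrM ger0_norm ?ler0n// in ha.
rewrite -mulrBr normrM ger0_norm ?ler0n// in hb.
have le : `|trapezoid L (a * y) - trapezoid L (b * y)
     - (trapezoid L (a * y') - trapezoid L (b * y'))|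
    <= L * (a * `|y - y'|) + L * (b * `|y - y'|).
  rewrite opprD opprK addrACA [X in _ + X]addrC.
  by rewrite (le_trans (ler_normD _ _))// lerD// distrC.
apply: le_trans le _.
rewrite [leRHS]mulrAC -mulrDr -mulrDl [leLHS]mulrA ler_wpM2r// mulrA.
have aE : a = K%:R * (freq k.+1)%:R by rewrite /a /= expnS natrM.
have bE : b <= K%:R * (freq k.+1)%:R.
  rewrite -natrM ler_nat /freq; case: k {ha hb a b L L0 aE} => [//|k].
  rewrite -expnS leq_pexp2l//; first exact: leq_trans K8.
  by rewrite leqW// leqW.
have LE : L = 256 * 2 ^+ k.
  by rewrite /L /sharpness natrX exprD; ring.
rewrite LE aE.
have -> : 128 * K%:R * 2 ^+ k * 4 * (freq k.+1)%:R
   = 256 * 2 ^+ k * (K%:R * (freq k.+1)%:R + K%:R * (freq k.+1)%:R) :> R by ring.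
by rewrite ler_wpM2l ?mulr_ge0 ?exprn_ge0// lerD2l.
Qed.

Lemma measurable_trapezoid L : measurable_fun [set: R] (trapezoid L).
Proof.
apply: measurable_minr => //; apply: measurable_maxr => //.
apply: measurable_funM => //; apply: measurable_funB => //.
apply: measurableT_comp => //; apply: measurable_funB => //.
apply: (@measurableT_comp _ _ _ _ _ _ (fun x => (Num.floor x)%:~R : R)).
  exact: (measurable_floor_comp (fun z => z%:~R : R)).
exact: measurable_funD.
Qed.

Lemma measurable_shear_profile k : measurable_fun [set: R] (shear_profile k).
Proof.
apply: measurable_funM => //; apply: measurable_funB;
  by apply: (measurableT_comp (measurable_trapezoid _)); apply: measurable_funM.
Qed.

End Frequencies.

(** * Limits of sequences of signs *)

Section StableSign.
Context {R : realType}.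
Local Notation S := (space3 R).
Variable d : nat -> S -> R.
Hypothesis dP : forall m x, d m x = 1 \/ d m x = -1.
Hypothesis md : forall m, measurable_fun [set: S] (d m).

(** The limit of a sequence of signs, where it is eventually constant; only
    convergence to [1] has to be tested. *)
Definition stable_sign x : R :=
  if `[< exists n, forall m, (n <= m)%N -> d m x = 1 >] then 1 else - 1.

Lemma stable_signP x : stable_sign x = 1 \/ stable_sign x = - 1.
Proof. by rewrite /stable_sign; case: ifP; [left|right]. Qed.

Lemma bounded_meas_sign (f : S -> R) : measurable_fun [set: S] f ->
  (forall x, f x = 1 \/ f x = - 1) -> bounded_meas f.
Proof.
move=> mf fP; split => //; exists 1 => x.
by have [->|->] := fP x; rewrite ?normrN normr1.
Qed.

Lemma measurable_stable_sign : measurable_fun [set: S] stable_sign.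
Proof.
have mA : measurable (\bigcup_n \bigcap_(m in [set m | (n <= m)%N])
    (d m @^-1` [set 1])).
  apply: bigcup_measurable => n _; apply: bigcap_measurable.
    by exists n => /=.
  by move=> m _; rewrite -[X in measurable X]setTI; exact: md.
have := measurable_indic mA.
move=> /(_ R) m1.
rewrite (_ : stable_sign = (fun x => 2 * \1_(\bigcup_n \bigcap_(m in [set m |
  (n <= m)%N])
    (d m @^-1` [set 1])) x - 1)).
  by apply: measurable_funB => //; apply: measurable_funM.
apply/funext => x; rewrite /stable_sign indicE.
case: ifPn => /asboolP h.
  rewrite mem_set/=; last first.
    by case: h => n h; exists n => // m /= nm; exact: h.
  by lra.
rewrite memNset/=; first by lra.
by move=> [n _ hn]; apply: h; exists n => m nm; exact: hn.
Qed.

(** If some later increment is not zero then it has absolute value [2],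
    which bounds the left-hand side; otherwise the sequence is constant from [n]
    on. *)
Lemma stable_sign_dist n x : (`|stable_sign x - d n x|%:E <=
  \sum_(0 <= m <oo) `|d (n + m).+1 x - d (n + m)%N x|%:E)%E.
Proof.
have ge0 (m : nat) : (0 <= m)%N -> true ->
  (0 <= `|d (n + m).+1 x - d (n + m)%N x|%:E)%E by move=> *; rewrite lee_fin.
have [[m Dm]|D] := pselect (exists m, d (n + m).+1 x <> d (n + m)%N x).
  apply: (@le_trans _ _ (`|d (n + m).+1 x - d (n + m)%N x|%:E)).
    have -> : `|d (n + m).+1 x - d (n + m)%N x| = 1 + 1.
      move: Dm; have [->|->] := dP (n + m).+1 x;
        have [->|->] := dP (n + m)%N x => // _; first by rewrite opprK ger0_norm.
      by rewrite -opprD normrN ger0_norm.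
    rewrite lee_fin (le_trans (ler_normB _ _))// lerD//.
      by have [->|->] := stable_signP x; rewrite ?normrN normr1.
    by have [->|->] := dP n x; rewrite ?normrN normr1.
  have := nneseries_lim_ge m.+1 ge0; apply: le_trans.
  rewrite big_nat_recr//= leeDr// sume_ge0// => i _.
rewrite [X in (X%:E <= _)%E](_ : _ = 0); first by apply: nneseries_ge0.
have dn m : d (n + m)%N x = d n x.
  elim: m => [|m IH]; first by rewrite addn0.
  by rewrite addnS -[RHS]IH; apply: contrapT => h; apply: D; exists m.
apply/eqP; rewrite normr_eq0 subr_eq0; apply/eqP.
rewrite /stable_sign; case: ifPn => /asboolP h.
  have [p hp] := h; rewrite -(dn p) hp// leq_addl//.
have [h1|//] := dP n x; case: h; exists n => m nm.
by rewrite -(subnKC nm) dn.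
Qed.

(** Integrate [stable_sign_dist] term by term and sum the geometric series. *)
Lemma torus_int_stable_sign (e : R) n : 0 <= e ->
  (forall m, torus_int (fun x => `|d (n + m).+1 x - d (n + m)%N x|)
     <= e / (2 ^ m.+1)%:R) ->
  torus_int (fun x => `|stable_sign x - d n x|) <= e.
Proof.
move=> e0 H.
have bd m := bounded_meas_sign (md m) (dP m).
have bs := bounded_meas_sign measurable_stable_sign stable_signP.
have fineE (f : S -> R) : bounded_meas f ->
    (\int[mu_space]_(x in cube) (f x)%:E = (torus_int f)%:E)%E.
  move=> bf; rewrite /torus_int /Rintegral fineK//.
  apply: integrable_fin_num; first exact: measurable_cube.
  exact: torus_integrable.
have bD := bounded_meas_norm (bounded_measB bs (bd n)).
have bE m := bounded_meas_norm (bounded_measB (bd (n + m).+1) (bd (n + m)%N)).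
rewrite -lee_fin -fineE//; apply: le_trans (epsilon_trick0 xpredT e0).
apply: (@le_trans _ _ (\int[mu_space]_(x in cube)
  \sum_(0 <= m <oo) `|d (n + m).+1 x - d (n + m)%N x|%:E)%E).
  apply: ge0_le_integral => //.
  - exact: measurable_cube.
  - by apply/measurable_EFinP; apply: measurable_funS (bD.1).
  - apply: ge0_emeasurable_sum => m.
      by move=> x _ _; rewrite lee_fin.
    by move=> _; apply/measurable_EFinP; apply: measurable_funS (bE m).1.
  - by move=> x _; exact: stable_sign_dist.
rewrite integral_nneseries//=; last 2 first.
- exact: measurable_cube.
- by move=> m; apply/measurable_EFinP; apply: measurable_funS (bE m).1.
apply: lee_nneseries => [m _ _|m _].
  by apply: integral_ge0 => x _; rewrite lee_fin.
by rewrite fineE// lee_fin.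
Qed.

End StableSign.

(** * Checkerboards *)

Section Checkerboards.
Context {R : realType}.
Local Notation S := (space3 R).
Variable K : nat.
Hypothesis K8 : (8 <= K)%N.
Local Notation g := (@shear_profile R K).
Local Notation freq := (freq K).
Local Notation g1 := (@shear_profile_period R K).
Local Notation mg := (@measurable_shear_profile R K).

Definition checker k (x : S) : R :=
  square_wave ((freq k)%:R * perp k x) * square_wave ((freq k.+1)%:R * perp k.+1 x).

Lemma square_waveP (y : R) : square_wave y = 1 \/ square_wave y = - 1.
Proof.
have /eqP := square_wave_norm y; rewrite eqr_norml ler01 andbT.
by case/orP => /eqP; [left|right].
Qed.

Lemma checkerP k x : checker k x = 1 \/ checker k x = - 1.
Proof.
rewrite /checker; have [->|->] := square_waveP ((freq k)%:R * perp k x);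
have [->|->] := square_waveP ((freq k.+1)%:R * perp k.+1 x);
by rewrite ?mulrNN ?mulr1 ?mul1r; auto.
Qed.

Lemma measurable_checker k : measurable_fun [set: S] (checker k).
Proof.
by apply: measurable_funM; apply: (measurableT_comp measurable_square_wave);
  exact: measurable_scaled_coord.
Qed.

Lemma square_waveDn (y : R) (n : nat) : square_wave (y + n%:R) = square_wave y.
Proof.
by elim: n => [|n IH]; rewrite ?addr0// -natr1 addrA square_waveD1.
Qed.

Lemma checker_periodic k : torus_periodic (checker k).
Proof.
move=> j x; rewrite /checker /perp !coord_unit_vec !mulrDr.
by congr (_ * _); case: (_ == _); rewrite ?mulr1 ?mulr0 ?addr0 ?square_waveDn.
Qed.

Lemma checker_free2 k : coord_free 2%:R (checker k).
Proof.
by move=> x s; rewrite /checker /perp /dirn /=; case: odd; case: x => -[].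
Qed.

Lemma dirnSS k : dirn k.+2 = dirn k.
Proof. by rewrite /dirn /= negbK. Qed.

Lemma perpSS k (x : S) : perp k.+2 x = perp k x.
Proof. by rewrite /perp dirnSS. Qed.

Lemma perpS_shift k (x : S) c :
  perp k.+1 (x + c *: unit_vec (dirn k)) = perp k.+1 x + c.
Proof.
rewrite /perp dirnSS shiftE.
by move: (dirn k) => j; case: x => -[? ?] ?; elim/ord3P: j.
Qed.

(** Half a period of the finer wave. *)
Lemma checker_half_shift k (x : S) :
  checker k (x + (2^-1 / (freq k.+1)%:R) *: unit_vec (dirn k)) = - checker k x.
Proof.
rewrite /checker perp_shift perpS_shift mulrDr mulrCA mulfV ?mulr1; last first.
  by rewrite pnatr_eq0 -lt0n expn_gt0; apply/orP; left; apply: leq_trans K8.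
by rewrite square_waveDhalf mulrN.
Qed.

(** The strips on which one of the two trapezoids of [shear_profile] is not
    yet equal to its square wave. *)
Definition defect k (x : S) : R :=
  notch (sharpness k) ((freq k.+2)%:R * perp k x)
  + notch (sharpness k) ((freq k)%:R * perp k x).

(** Off the strips let [p], [q] be the values of the waves of frequencies
    [freq k.+2] and [freq k].  The shear moves the argument of the middle wave
    by [(p - q) / 4], that is by [0] or by half a period, and so multiplies that
    wave by [p * q].  Hence it turns [p] times the middle wave into [q] times
    it. *)
Lemma checker_shear k (x : S) :
  `|checker k.+1 (shear g k 1 x) - checker k x| <= 2 * defect k x.
Proof.
have m0 : (0 < sharpness k)%N by rewrite expn_gt0.
have n01 y : notch (sharpness k) y = 0 \/ notch (sharpness k) y = 1 :> R.
  by rewrite /notch; case: (_ %| _)%Z; [right|left].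
have triv : 1 <= defect k x ->
    `|checker k.+1 (shear g k 1 x) - checker k x| <= 2 * defect k x.
  move=> d1; apply: (@le_trans _ _ (1 + 1)); last by lra.
  rewrite (le_trans (ler_normB _ _))// lerD//.
    by have [->|->] := checkerP k.+1 (shear g k 1 x); rewrite ?normrN normr1.
  by have [->|->] := checkerP k x; rewrite ?normrN normr1.
have [na|na] := n01 ((freq k.+2)%:R * perp k x); last first.
  apply: triv; rewrite /defect na lerDl.
  by have [->|->] := n01 ((freq k)%:R * perp k x).
have [nb|nb] := n01 ((freq k)%:R * perp k x); last first.
  by apply: triv; rewrite /defect na nb add0r.
rewrite /defect na nb addr0 mulr0 normr_le0 subr_eq0; apply/eqP.
rewrite /checker perpSS /shear perp_shift perpS_shift mul1r /disp /shear_profile.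
rewrite !trapezoid_off_notch//.
set M := (freq k.+1)%:R; have M0 : M != 0.
  by rewrite pnatr_eq0 -lt0n expn_gt0; apply/orP; left; apply: leq_trans K8.
set z := perp k.+1 x.
have [->|->] := square_waveP ((freq k.+2)%:R * perp k x);
have [->|->] := square_waveP ((freq k)%:R * perp k x).
- by rewrite subrr mul0r addr0 mulr1 mul1r.
- rewrite mulr1 mulN1r -square_waveDhalf; congr square_wave; by field; rewrite M0.
- rewrite mulrN1 mul1r -square_waveDhalf; congr square_wave; by field; rewrite M0.
- by rewrite subrr mul0r addr0 mulrN1 mulN1r.
Qed.

Lemma bounded_meas_defect k : bounded_meas (defect k).
Proof. by apply: bounded_measD; exact: bounded_meas_notch. Qed.

Lemma defect_periodic k : torus_periodic (defect k).
Proof.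
move=> j x; rewrite /defect /perp !coord_unit_vec !mulrDr.
by congr (_ + _); case: (_ == _); rewrite ?mulr1 ?mulr0 ?addr0 ?notch_period.
Qed.

Lemma torus_int_defect k : torus_int (defect k) <= 2 / (2 ^ (k + 6))%:R.
Proof.
rewrite torus_intD; [|exact: bounded_meas_notch..].
have -> : sharpness k = (2 ^ (k + 5)).*2 by rewrite /sharpness -mul2n -expnS -addnS.
have m0 : (0 < 2 ^ (k + 5))%N by rewrite expn_gt0.
have := lerD (@torus_int_notch_le R _ (freq k.+2) (dirn k.+1) m0)
  (@torus_int_notch_le R _ (freq k) (dirn k.+1) m0).
move=> /le_trans; apply.
by rewrite -mul2n -expnS -addnS -mulr2n mulr_natl.
Qed.

Lemma flow_free2 (h : nat -> R -> R) k (U : Type) (f : S -> U) :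
  coord_free 2%:R f -> coord_free 2%:R (f \o flow h k).
Proof.
elim: k f => [//|k IH] f f2; exact: IH (shear_free2 h k 1 f2).
Qed.

Definition pattern k (x : S) : R := checker k (flow g k x).

Lemma patternP k x : pattern k x = 1 \/ pattern k x = - 1.
Proof. exact: checkerP. Qed.

Lemma measurable_pattern k : measurable_fun [set: S] (pattern k).
Proof.
exact: (measurableT_comp (measurable_checker k) (measurable_flow mg k)).
Qed.

Lemma bounded_meas_pattern k : bounded_meas (pattern k).
Proof. exact: bounded_meas_sign (measurable_pattern k) (patternP k). Qed.

(** Volume preservation reduces this to [checker_shear]. *)
Lemma torus_int_patternS k :
  torus_int (fun x => `|pattern k.+1 x - pattern k x|) <= 4 / (2 ^ (k + 6))%:R.
Proof.
have bdf : bounded_meas (fun x => defect k (flow g k x)).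
  exact: bounded_meas_comp (measurable_flow mg k) (bounded_meas_defect k).
apply: (@le_trans _ _ (torus_int (fun x => 2 * defect k (flow g k x)))).
  apply: le_torus_int.
  - apply: bounded_meas_norm; apply: bounded_measB; exact: bounded_meas_pattern.
  - by apply: bounded_measM => //; exact: bounded_meas_cst.
  - by move=> x; exact: checker_shear.
rewrite torus_intZ// -(@torus_int_back_flow R g g1 mg k (fun x => defect k
  (flow g k x))).
- under eq_torus_int => x.
    have -> : ((fun x => defect k (flow g k x)) \o back_flow g k) x = defect k x.
      by rewrite /= back_flowK.
    over.
  by have := torus_int_defect k; move: (torus_int _) => *; lra.
- by case: bdf.
- by move=> j x; rewrite (flow_periodic g1) defect_periodic.
Qed.

(** The scalar whose transport by the shears is finer and finer
    checkerboards. *)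
Definition mixed_sign : S -> R := stable_sign pattern.

Lemma mixed_signP x : mixed_sign x = 1 \/ mixed_sign x = - 1.
Proof. exact: stable_signP. Qed.

Lemma mixed_sign_datum : datum mixed_sign.
Proof.
split.
- exact: bounded_meas_sign (measurable_stable_sign measurable_pattern) mixed_signP.
- move=> j x; rewrite /mixed_sign /stable_sign.
  have E m : pattern m (x + unit_vec j) = pattern m x.
    by rewrite /pattern (flow_periodic g1) checker_periodic.
  by congr (if `[< _ >] then _ else _); apply/propext; split=> -[n h];
    exists n => m nm;
    rewrite -(h m nm) E.
- move=> x s; rewrite /mixed_sign /stable_sign.
  have E m : pattern m (set_coord 2%:R x s) = pattern m x.
    exact: (flow_free2 g m (checker_free2 m)).
  by congr (if `[< _ >] then _ else _); apply/propext; split=> -[n h];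
    exists n => m nm;
    rewrite -(h m nm) E.
Qed.

Lemma torus_int_mixed_sign_pattern k :
  torus_int (fun x => `|mixed_sign x - pattern k x|) <= (2 ^ (k + 3))%:R^-1.
Proof.
apply: (torus_int_stable_sign patternP measurable_pattern);
  first by rewrite invr_ge0.
move=> m; apply: le_trans (torus_int_patternS _) _.
rewrite le_eqVlt; apply/orP; left; apply/eqP.
have n0 (n : nat) : 2 ^+ n != 0 :> R by rewrite expf_neq0.
rewrite !natrX !exprD (exprS _ m); field.
by rewrite !n0.
Qed.

(** Change variables by [back_flow g k], which brings the pulled back
    checkerboard to its original form. *)
Lemma mixed_sign_back_flow k :
  torus_int (fun x => `|mixed_sign (back_flow g k x) - checker k x|) <= tau k.
Proof.
have [bh hper _] := mixed_sign_datum.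
pose f x := `|mixed_sign x - pattern k x|.
have bf : bounded_meas f.
  by apply: bounded_meas_norm; apply: bounded_measB => //;
    exact: bounded_meas_pattern.
have := @torus_int_back_flow R g g1 mg k f bf.1.
rewrite /comp.
under eq_torus_int do rewrite {1}/f /pattern back_flowK.
move=> ->; last first.
  by move=> j x; rewrite /f /pattern (flow_periodic g1) checker_periodic hper.
apply: le_trans (torus_int_mixed_sign_pattern k) _.
rewrite /tau natrX -exprVn ler_wiXn2l ?leq_addr//; lra.
Qed.

End Checkerboards.

(** * Weak convergence to zero of the mixed sign *)

Section Mixing.
Context {R : realType}.
Local Notation S := (space3 R).
Variable K : nat.
Hypothesis K8 : (8 <= K)%N.
Local Notation g := (@shear_profile R K).
Local Notation freq := (freq K).
Local Notation g1 := (@shear_profile_period R K).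
Local Notation mg := (@measurable_shear_profile R K).

(** Mean value theorem along the direction [j]. *)
Lemma C1_shift_bound (psi : spacetime R -> R) j : C1_periodic psi ->
  exists2 B : R, 0 <= B & forall x t a, 0 <= t <= 2 -> 0 <= a ->
    `|psi (x, t)| <= B /\ `|psi (x + a *: unit_vec j, t) - psi (x, t)| <= B * a.
Proof.
move=> Cpsi; have [B hB] := C1_bounded (unit_vec j, 0 : R) 0 2 Cpsi.
exists B.
  have [] := hB 0 0 _; first by rewrite lexx ler0n.
  by move=> h _; apply: le_trans h.
move=> x t a t02 a0; split; first by have [] := hB x t t02.
have E s : (x, t) + s *: (unit_vec j, 0 : R) = (x + s *: unit_vec j, t).
  transitivity ((x + s *: unit_vec j, t + s *: 0) : spacetime R); first by [].
  by rewrite scaler0 addr0.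
pose f (s : R) := psi ((x, t) + s *: (unit_vec j, 0 : R)).
pose df (s : R) := 'D_(unit_vec j, 0 : R) psi ((x, t) + s *: (unit_vec j, 0 : R)).
have dpsi : forall z, differentiable psi z by case: Cpsi.
have fD s : is_derive s (1 : R) f (df s) := is_derive_line (x, t) (unit_vec j,
  0 : R) s dpsi.
have cf : continuous f.
  move=> s; apply: differentiable_continuous; apply/derivable1_diffP.
  by have [] := fD s.
have [c _] := MVT_segment a0 (fun s _ => fD s) (continuous_subspaceT cf).
rewrite subr0 /f !E scale0r addr0 => ->; rewrite normrM (ger0_norm a0).
by rewrite ler_wpM2r// /df E; have [] := hB (x + c *: unit_vec j) t t02.
Qed.

(** A translation by half a period changes the sign of the checkerboard, so
    the integral is half of its pairing with the increment of [psi] over that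
    half period. *)
Lemma checker_weak (psi : spacetime R -> R) B k t : C1_periodic psi ->
  (forall x a, 0 <= a -> `|psi (x + a *: unit_vec (dirn k), t) - psi (x, t)| <=
    B * a) ->
  `|torus_int (fun x => checker K k x * psi (x, t))| <= B * (2^-1 / (freq k.+1)%:R).
Proof.
move=> Cpsi hB; set a := _ / _.
have a0 : 0 <= a by rewrite divr_ge0.
have bc := bounded_meas_sign (measurable_checker (R := R) K k) (checkerP K k).
have [bp _] := C1_slice 0 t Cpsi.
have perpsi : torus_periodic (fun x => psi (x, t)) by case: Cpsi => _ _; exact.
have bG := bounded_measM bc bp.
have mc : measurable_fun [set: S] (fun x : S => x + a *: unit_vec (dirn k)).
  exact: measurable_shift.
have sh := @torus_int_shift _ (dirn k) (fun=> a) (fun x => checker K k x * psi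
  (x, t))
  (measurable_cst _) (fun _ _ => erefl) bG.1.
have {}sh := sh (fun x => congr2 _ (checker_periodic K k (dirn k) x) (perpsi
  (dirn k) x)).
pose I := torus_int (fun x => checker K k x * psi (x, t)).
rewrite -/I in sh *.
have bps : bounded_meas (fun x => psi (x + a *: unit_vec (dirn k), t)).
  exact: (bounded_meas_comp mc bp).
have E : I + I = torus_int (fun x => checker K k x *
     (psi (x, t) - psi (x + a *: unit_vec (dirn k), t))).
  rewrite -{2}sh /I -torus_intD//; last exact: (bounded_meas_comp mc bG).
  apply: eq_torus_int => x; rewrite checker_half_shift//; ring.
have : `|I + I| <= B * a.
  rewrite E; apply: torus_int_bound.
    by have [] := bounded_measM bc (bounded_measB bp bps).
  move=> x; rewrite normrM; have -> : `|checker K k x| = 1.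
    by have [->|->] := checkerP K k x; rewrite ?normrN normr1.
  by rewrite mul1r distrC; exact: hB.
have := normr_ge0 I; rewrite -mulr2n normrMn mulr2n; move: (`|I|) => *; lra.
Qed.

(** Split the transported sign into a checkerboard, for which
    [checker_weak] applies, and a remainder that is small in L^1. *)
Lemma mixed_sign_weak (c : R) (psi : spacetime R -> R) : C1_periodic psi ->
  torus_int (fun x => (c * mixed_sign K (back_flow g k x)) * psi (x, 1 + tau k))
    @[k --> \oo] --> (0 : R).
Proof.
move=> Cpsi.
have [B0 B00 hB0] := C1_shift_bound 0 Cpsi.
have [B1 B10 hB1] := C1_shift_bound 1 Cpsi.
pose B := B0 + B1.
have tau2 k : 0 <= 1 + @tau R k <= 2.
  apply/andP; split; first by rewrite addr_ge0// ltW// tau_gt0.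
  by rewrite (_ : 2 = 1 + 1)// lerD2l tau_le1.
apply/norm_cvg0P.
apply: (squeeze_cvgr (f := fun=> 0) (h := fun k => `|c| * (B + B) * tau k));
  last 2 first.
- exact: cvg_cst.
- rewrite -[X in _ --> X](mulr0 (`|c| * (B + B))); apply: cvgM;
  first exact: cvg_cst.
  exact: cvg_tau.
near=> k; rewrite normr_ge0/=.
have [bp _] := C1_slice 0 (1 + tau k) Cpsi.
have bc := bounded_meas_sign (measurable_checker (R := R) K k) (checkerP K k).
have bm : bounded_meas (fun x => mixed_sign K (back_flow g k x)).
  apply: (bounded_meas_comp (measurable_back_flow mg k)).
  by have [] := @mixed_sign_datum R K.
rewrite (@eq_torus_int _ _ (fun x => c * (mixed_sign K (back_flow g k x) * psi
  (x, 1 + tau k)))); last first.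
  by move=> x; rewrite mulrA.
rewrite torus_intZ; last exact: bounded_measM.
rewrite normrM -!mulrA ler_wpM2l//.
have split x : mixed_sign K (back_flow g k x) * psi (x, 1 + tau k) =
  (mixed_sign K (back_flow g k x) - checker K k x) * psi (x, 1 + tau k)
  + checker K k x * psi (x, 1 + tau k) by rewrite -mulrDl subrK.
rewrite (eq_torus_int split) torus_intD; [|by apply: bounded_measM => //;
  exact: bounded_measB|exact: bounded_measM].
rewrite (le_trans (ler_normD _ _))// mulrDl lerD//.
  apply: le_trans (normr_torus_int _) _.
    by apply: bounded_measM => //; exact: bounded_measB.
  apply: (@le_trans _ _ (torus_int (fun x => B * `|mixed_sign K (back_flow g k
    x) - checker K k x|))).
    apply: le_torus_int.
    - by apply: bounded_meas_norm; apply: bounded_measM => //; exact: bounded_measB.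
    - apply: bounded_measM; first exact: bounded_meas_cst.
      by apply: bounded_meas_norm; exact: bounded_measB.
    - move=> x; rewrite normrM mulrC ler_wpM2r//.
      have [h _] := hB0 x _ 0 (tau2 k) (lexx _).
      by rewrite (le_trans h)// lerDl.
  rewrite torus_intZ; last by apply: bounded_meas_norm; exact: bounded_measB.
  by rewrite ler_wpM2l ?addr_ge0//; exact: mixed_sign_back_flow.
apply: le_trans (@checker_weak psi B k _ Cpsi _) _.
  move=> x a a0; rewrite /dirn; case: odd.
    have [_ h] := hB0 x _ a (tau2 k) a0; rewrite (le_trans h)// ler_wpM2r//.
    by rewrite lerDl.
  have [_ h] := hB1 x _ a (tau2 k) a0; rewrite (le_trans h)// ler_wpM2r//.
  by rewrite lerDr.
rewrite ler_wpM2l ?addr_ge0//.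
have -> : (freq k.+1)%:R = K%:R ^+ k.+1 :> R by rewrite natrX.
apply: (@le_trans _ _ ((2^-1) * (2^-1 ^+ k))).
  rewrite ler_wpM2l// -exprVn.
  have K2 : K%:R^-1 <= 2^-1 :> R.
    rewrite lef_pV2 ?posrE ?ltr0n// ?ler_nat; first exact: leq_trans K8.
    exact: leq_trans K8.
  rewrite exprS -[leRHS]mul1r ler_pM ?exprn_ge0 ?invr_ge0//.
    by rewrite (le_trans K2)// invf_le1 ?ler1n.
  by rewrite lerXn2r ?nnegrE ?invr_ge0.
rewrite /tau ler_piMl ?exprn_ge0// ?invf_le1 ?ler1n//.
Unshelve. all: by end_near.
Qed.

End Mixing.

(** * The initial datum *)

Section InitialDatum.
Context {R : realType}.
Local Notation S := (space3 R).

(** The phase [th] is there because the derivatives of a wave are multiples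
    of waves with the phase moved by [pi / 2]. *)
Definition wave (w th : R) (x : S) : R := cos (th + w * x.1.2).

Lemma cosDint (y : R) (m : int) : cos (y + pi * m%:~R) = (-1) ^ m * cos y.
Proof.
have nat_case (n : nat) z : cos (z + pi * n%:R) = (-1) ^+ n * cos z :> R.
  elim: n z => [|n IH] z; first by rewrite mulr0 addr0 expr0 mul1r.
  by rewrite -natr1 mulrDr mulr1 addrA cosDpi IH exprS -mulrA mulN1r.
case: m => n; first by rewrite -pmulrn nat_case.
rewrite expN1r /= NegzE mulrNz -pmulrn mulrN -[in RHS](subrK (pi * n.+1%:R) y).
by rewrite nat_case mulrA -expr2 sqrr_sign mul1r.
Qed.

(** Both factors are [(-1) ^ m] times something nonnegative, where [m]
    numbers the half period that contains [u]. *)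
Lemma cos_square_wave (u : R) : 0 <= cos (2 * pi * u) * square_wave u.
Proof.
rewrite /square_wave; set m := Num.floor _.
have /andP[m1 m2] : m%:~R <= 2 * u + 2^-1 < m%:~R + 1 by exact: floor_bounds.
pose th : R := pi * (2 * u - m%:~R).
have -> : 2 * pi * u = th + pi * m%:~R by rewrite /th; ring.
rewrite cosDint mulrAC -expfzDr//.
have -> : (-1 : R) ^ (m + m) = 1 by rewrite expfzDr// expN1r -expr2 sqrr_sign.
rewrite mul1r; apply: cos_ge0_pihalf; rewrite /th.
have pi0 := pi_gt0 R.
rewrite -mulrN ler_pM2l// [X in _ && X]ler_pM2l//; lra.
Qed.

Lemma is_derive_wave (w th y : R) :
  is_derive y (1 : R) (fun s : R => cos (th + w * s)) (- sin (th + w * y) * w).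
Proof.
exact: (@is_derive1_comp _ cos (fun s => th + w * s) y _ _
  (is_derive_cos (th + w * y)) (is_derive_affine w th y)).
Qed.

Lemma differentiable_wave w th x : differentiable (wave w th) x.
Proof.
have d1 : differentiable (snd \o fst : S -> R) x.
  by apply: differentiable_comp; apply: linear_differentiable => z;
    [exact: cvg_fst|exact: cvg_snd].
apply: (@differentiable_comp _ _ _ _ (snd \o fst : S -> R)
  (fun y : R => cos (th + w * y))) => //.
by apply/derivable1_diffP; have [] := is_derive_wave w th (snd (fst x)).
Qed.

Lemma derive_wave w th (u x : S) :
  'D_u (wave w th) x = w * u.1.2 * wave w (th + pi / 2) x.
Proof.
have -> : 'D_u (wave w th) x = 'D_(u.1.2) (fun y : R => cos (th + w * y)) x.1.2
  by [].
rewrite deriveE; last by apply/derivable1_diffP;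
  have [] := is_derive_wave w th x.1.2.
rewrite -[u.1.2 in LHS]mulr1 -[_ * 1]/(_ *: 1) linearZ.
rewrite -deriveE; last by apply/derivable1_diffP;
  have [] := is_derive_wave w th x.1.2.
have [_ ->] := is_derive_wave w th x.1.2.
rewrite /wave addrAC cosDpihalf -[LHS]/(u.1.2 * _); ring.
Qed.

(** All the iterated derivatives have the same form. *)
Lemma smooth_wave w th (A : vec3 R) : smooth (fun x => wave w th x *: A).
Proof.
move=> s; suff [c [th' ->]] : exists c th', foldr (fun u (f : S -> vec3 R) =>
  'D_u f)
    (fun x => wave w th x *: A) s = (fun x => wave w th' x *: (c *: A)).
  by move=> x; apply: differentiableZl; exact: differentiable_wave.
elim: s => [|u s [c [th' /= ->]]].
  by exists 1, th; apply/funext => x; rewrite scale1r.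
exists (w * u.1.2 * c), (th' + pi / 2); apply/funext => x.
rewrite deriveE; last by apply: differentiableZl; exact: differentiable_wave.
rewrite diffZl; last exact: differentiable_wave.
rewrite -deriveE; last exact: differentiable_wave.
by rewrite derive_wave !scalerA; congr (_ *: _); ring.
Qed.

Variable K : nat.
Hypothesis K8 : (8 <= K)%N.

Definition init_wave (x : S) : R := wave (2 * pi * K%:R) 0 x.

Lemma init_waveE x : init_wave x = cos (2 * pi * (K%:R * x.1.2)).
Proof. by rewrite /init_wave /wave add0r !mulrA. Qed.

Lemma init_wave_norm x : `|init_wave x| <= 1.
Proof. by rewrite ler_norml cos_geN1 cos_le1. Qed.

Lemma bounded_meas_cos (f : S -> R) : measurable_fun [set: S] f ->
  bounded_meas (fun x => cos (f x)).
Proof.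
move=> mf; split; last by exists 1 => x; rewrite ler_norml cos_geN1 cos_le1.
exact: (measurableT_comp (continuous_measurable_fun (@continuous_cos R)) mf).
Qed.

Lemma measurable_x2 : measurable_fun [set: S] (fun x : S => x.1.2).
Proof. exact: (measurable_coord (R := R) 1). Qed.

Lemma cos_periodic (y : R) (n : nat) :
  cos (2 * pi * (y + n%:R)) = cos (2 * pi * y).
Proof.
rewrite (_ : 2 * pi * (y + n%:R) = 2 * pi * y + pi * (2 * n%:Z)%:~R).
  by rewrite cosDint expN1r abszM /= exprM sqrrN !expr1n mul1r.
by rewrite intrM -pmulrn; ring.
Qed.

Lemma init_wave_datum : datum init_wave.
Proof.
split.
- apply: bounded_meas_cos; apply: measurable_funD => //.
  by apply: measurable_funM => //; exact: measurable_x2.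
- move=> j x; rewrite !init_waveE.
  have := coord_unit_vec 1 j x; rewrite /coord /= => ->.
  rewrite [K%:R * (_ + _)]mulrDr; case: (_ == _);
    last by rewrite mulr0n mulr0 addr0.
  by rewrite mulr1n mulr1 cos_periodic.
- by move=> x s; case: x => -[].
Qed.

(** A translation by a quarter of a period exchanges cosine and sine. *)
Lemma torus_int_init_wave_sqr : torus_int (fun x => init_wave x * init_wave x)
  = 2^-1.
Proof.
have [bs per _] := init_wave_datum.
have bS := bounded_measM bs bs.
have K0 : K%:R != 0 :> R.
  by rewrite pnatr_eq0 -lt0n; apply: leq_trans K8.
have sh := @torus_int_shift R 1 (fun=> 2^-1 / 2 / K%:R) (fun x => init_wave x *
  init_wave x)
  (measurable_cst _) (fun _ _ => erefl) bS.1.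
have {}sh := sh (fun x => congr2 _ (per 1 x) (per 1 x)).
have E x : init_wave (x + (2^-1 / 2 / K%:R) *: unit_vec 1) = - sin (2 * pi *
  (K%:R * x.1.2)).
  rewrite init_waveE shiftE /= -cosDpihalf; congr cos.
  by rewrite /coord/=; field; rewrite K0.
have bp := bounded_measM (bounded_meas_comp (measurable_shift 1 (@measurable_id
  _ _ setT)
  (measurable_cst (2^-1 / 2 / K%:R : R))) bs)
  (bounded_meas_comp (measurable_shift 1 (@measurable_id _ _ setT)
  (measurable_cst (2^-1 / 2 / K%:R : R))) bs).
set I := torus_int _ in sh *.
have : torus_int (fun x => init_wave x * init_wave x) + torus_int (fun x =>
  init_wave x * init_wave x) = 1.
  rewrite -{2}sh /I -torus_intD// -[RHS](@torus_int_cst R);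
    apply: eq_torus_int => x.
  by rewrite E init_waveE mulrNN -!expr2 cos2Dsin2.
move: (torus_int _) => *; lra.
Qed.

(** Against the first checkerboard the integral is that of the absolute
    value of the cosine, at least that of its square, [1 / 2]; the distance from
    [mixed_sign] to the first checkerboard is at most [1 / 8]. *)
Lemma init_wave_mixed_sign_gt0 : 0 < torus_int (fun x => init_wave x *
  mixed_sign K x).
Proof.
have [bs _ _] := init_wave_datum.
have [bm _ _] := @mixed_sign_datum R K.
have bp := @bounded_meas_pattern R K 0.
have bd := bounded_meas_norm (bounded_measB bm bp).
apply: (@lt_le_trans _ _ (torus_int (fun x => init_wave x * init_wave x -
  `|mixed_sign K x - pattern K 0 x|))).
  rewrite torus_intB//; last exact: bounded_measM.
  rewrite torus_int_init_wave_sqr.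
  have := torus_int_mixed_sign_pattern (R := R) K8 0; rewrite add0n natrX;
    move: (torus_int _) => I h.
  rewrite subr_gt0 (le_lt_trans h)// ltf_pV2 ?posrE// ?exprn_gt0//.
  by rewrite -natrX ltr_nat.
apply: le_torus_int.
- by apply: bounded_measB => //; exact: bounded_measM.
- exact: bounded_measM.
move=> x.
have p0 : pattern K 0 x = square_wave (K%:R * x.1.2).
  rewrite /pattern /= /checker /= mul0r expn1.
  rewrite square_wave_pos ?mul1r//.
  rewrite /quarter_dist add0r (floor_def (m := 0)).
    by rewrite mulr0z oppr0 normr0 subr0.
  rewrite add0r mulr0z mulr1z; lra.
have sp : init_wave x * init_wave x <= init_wave x * pattern K 0 x.
  have h : 0 <= init_wave x * pattern K 0 x by rewrite p0 init_waveE
    cos_square_wave.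
  rewrite -(ger0_norm h) normrM p0 square_wave_norm mulr1.
  rewrite -expr2 -(real_normK (num_real (init_wave x))) expr2 -[leRHS]mul1r.
  by rewrite ler_wpM2r// init_wave_norm.
rewrite lerBlDr (le_trans sp)// -lerBlDl -mulrBr.
rewrite (le_trans (ler_norm _))// normrM distrC.
by rewrite -[leRHS]mul1r ler_wpM2r// init_wave_norm.
Qed.

End InitialDatum.

(** * Non-uniqueness *)

Section NonUniqueness.
Context {R : realType}.
Local Notation S := (space3 R).

(** [K] is a power [8 ^ n] with [n * (1 - al) >= 1]. *)
Lemma exists_frequency_ratio (al : R) : 0 < al < 1 ->
  exists2 K : nat, (8 <= K)%N &
    forall k, (K%:R ^+ k)^-1 `^ (1 - al) <= (8 ^+ k)^-1.
Proof.
move=> /andP[al0 al1]; have b0 : 0 < 1 - al by rewrite subr_gt0.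
pose n := (Num.truncn (1 - al)^-1).+1.
have nb : 1 <= n%:R * (1 - al).
  by rewrite -ler_pdivrMr// div1r ltW// truncnS_gt.
exists (8 ^ n)%N; first by rewrite -[X in (X <= _)%N](expn1 8) leq_pexp2l.
move=> k; set x := (8 ^+ k)^-1.
have x0 : 0 < x by rewrite invr_gt0 exprn_gt0.
have x1 : x <= 1 by rewrite invf_le1 ?exprn_ege1 ?exprn_gt0 ?ler1n.
have -> : ((8 ^ n)%:R ^+ k)^-1 = x `^ n%:R.
  by rewrite powR_mulrn ?ltW// natrX -exprM mulnC exprM -exprVn.
have x01 : 0 < x <= 1 by rewrite x0.
rewrite -powRrM; apply: le_trans (ger_powR x01 nb) _.
by rewrite powRr1// ltW.
Qed.

(** The square of [h] is [1], so [c * h] is the orthogonal projection of [f]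
    on [h]. *)
Lemma projection_energy_le (c : R) (f h : S -> R) : bounded_meas f ->
  bounded_meas h ->
  (forall x, h x = 1 \/ h x = - 1) -> c = torus_int (fun x => f x * h x) ->
  torus_int (fun x => (f x - c * h x) * (f x - c * h x))
    <= torus_int (fun x => f x * f x).
Proof.
move=> bf bh h1 cE.
have bff := bounded_measM bf bf; have bfh := bounded_measM bf bh.
have E x : (f x - c * h x) * (f x - c * h x) = f x * f x - (2 * c) * (f x * h
  x) + c ^+ 2.
  by have [->|->] := h1 x; ring.
rewrite (eq_torus_int E) torus_intD; [|apply: bounded_measB => //;
  apply: bounded_measM => //; exact: bounded_meas_cst|exact: bounded_meas_cst].
rewrite torus_intB//; last by apply: bounded_measM => //; exact: bounded_meas_cst.
rewrite torus_int_cst torus_intZ// -cE.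
have := sqr_ge0 c; move: (torus_int _) => I *; rewrite expr2; nra.
Qed.

Variable K : nat.
Hypothesis K8 : (8 <= K)%N.
Local Notation g := (@shear_profile R K).
Local Notation g1 := (@shear_profile_period R K).
Local Notation mg := (@measurable_shear_profile R K).
Local Notation gB := (@shear_profile_le_tau R K K8).

Definition v_in (x : S) : vec3 R := init_wave K x *: basis_vec 2%:R.

(** Vertical, and independent of the vertical variable. *)
Lemma v_in_smooth_div_free : smooth_div_free_datum v_in.
Proof.
have [_ per f2] := init_wave_datum (R := R) K.
split; first exact: smooth_wave.
  by move=> j x; rewrite /v_in per.
move=> x.
have D (u : S) : 'D_u v_in x = 'D_u (init_wave K) x *: basis_vec 2%:R.
  have dw := differentiable_wave (2 * pi * K%:R) (0 : R) x.
  rewrite deriveE; last exact: (differentiableZl (basis_vec 2%:R : vec3 R) dw).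
  rewrite (diffZl (basis_vec 2%:R : vec3 R) dw) -deriveE//.
have E j : ('D_(unit_vec j) v_in x) 0 j = 0.
  rewrite D one_basisE derive_wave.
  by elim/ord3P: j => /=; rewrite ?mulr0 ?mul0r.
by rewrite big1.
Qed.

Section Solutions.
Variables f2 : S -> R.
Hypothesis d2 : datum f2.
Hypothesis energy_le :
  torus_int (fun x => f2 x * f2 x) <= torus_int (fun x => init_wave K x *
    init_wave K x).
Hypothesis mix : forall psi : spacetime R -> R, C1_periodic psi ->
  torus_int (fun x => (init_wave K (back_flow g k x) - f2 (back_flow g k x))
    * psi (x, 1 + tau k)) @[k --> \oo] --> (0 : R).

Lemma solution_admissible_bounded :
  admissible_bounded_solution 2 (force g) v_in (solution g (init_wave K) f2).
Proof.
have d1 := init_wave_datum (R := R) K.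
have [M HM] := solution_bound gB d1 d2.
have sper := solution_periodic g1 d1 d2.
have ms i := measurable_solution mg i d1 d2.
split.
- split; first exact: (bounded_measurable_field sper ms).
    exact: (solution_weakly_div_free g1 mg gB d1 d2).
  by move=> phi tphi; exact: (solution_weak g1 mg gB d1 d2 mix tphi).
- exact: (solution_admissible g1 mg gB d1 d2 energy_le).
- exact: (bounded_bounded_field sper ms HM).
Qed.

End Solutions.

Definition late_cylinder : set (spacetime R) := cube `*` `]1, 2[.

Lemma mu_late_cylinder : mu_spacetime late_cylinder = 1%E.
Proof.
rewrite /late_cylinder.
rewrite -[LHS]/((mu_solid \x mu_time)%E _).
rewrite product_measure1E//=; last exact: measurable_cube.
rewrite -[X in (X * _)%E]/(mu_space (@cube R)) mu_cube mul1e.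
by rewrite /mu_time/= lebesgue_measure_itv/= lte_fin ltr1n -EFinB (_ : 2 - 1 =
  1)//; ring.
Qed.

(** For [t > 1] the vertical components are the transports of [f] and of
    [f'], which differ at every point. *)
Lemma solutions_differ (f f' : S -> R) : (forall x, f x != f' x) ->
  ~ ae_eq mu_spacetime (torus_cylinder 2) (solution g f f) (solution g f f').
Proof.
move=> ff' [N [mN N0 sub]].
have mA : measurable late_cylinder.
  by apply: measurableX => //; exact: measurable_cube.
have : (mu_spacetime late_cylinder <= mu_spacetime N)%E.
  apply: le_measure; rewrite ?inE// => -[x t] [cx /=];
    rewrite in_itv/= => /andP[t1 t2].
  apply: sub => /= h.
  have : solution g f f (x, t) = solution g f f' (x, t).
    apply: h; split => //=; rewrite in_itv/= t2 andbT (lt_trans _ t1)//.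
  rewrite /solution => /addrI; rewrite /scalar /scalar_at /= ltNge (ltW t1) /=.
  move/(congr1 (fun w : vec3 R => w 0 2%:R)); rewrite !one_basisE /=.
  rewrite !mulr1; apply/eqP; exact: ff'.
by rewrite N0 mu_late_cylinder lee_fin ler10.
Qed.

(** The second state after [t = 1] is the first one minus its projection on
    [mixed_sign]. *)
Lemma admissible_nonuniqueness :
  exists v1 v2 : spacetime R -> vec3 R,
    [/\ admissible_bounded_solution 2 (force g) v_in v1,
        admissible_bounded_solution 2 (force g) v_in v2 &
        ~ ae_eq mu_spacetime (torus_cylinder 2) v1 v2].
Proof.
have d1 := init_wave_datum (R := R) K.
have [b1 p1 fr1] := d1.
have dm := @mixed_sign_datum R K.
have [bm pm frm] := dm.
pose c : R := torus_int (fun x => init_wave K x * mixed_sign K x).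
have c0 : 0 < c by exact: init_wave_mixed_sign_gt0.
pose f2 (x : S) := init_wave K x - c * mixed_sign K x.
have d2 : datum f2.
  split.
  - by apply: bounded_measB => //; apply: bounded_measM => //;
    exact: bounded_meas_cst.
  - by move=> j x; rewrite /f2 p1 pm.
  - by move=> x s; rewrite /f2 fr1 frm.
exists (solution g (init_wave K) (init_wave K)), (solution g (init_wave K) f2);
  split.
- apply: solution_admissible_bounded => // psi Cpsi.
  under eq_fun do under eq_torus_int do rewrite subrr mul0r.
  under eq_fun do rewrite torus_int_cst.
  exact: cvg_cst.
- apply: solution_admissible_bounded => //.
    by apply: projection_energy_le => //; exact: mixed_signP.
  move=> psi Cpsi.
  under eq_fun => k.
    under eq_torus_int => x do rewrite /f2 opprB addrC subrK.
    over.
  exact: mixed_sign_weak.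
- apply: solutions_differ => x; rewrite /f2 -subr_eq0 opprB addrC subrK.
  apply: mulf_neq0; first by rewrite gt_eqF.
  by have [->|->] := mixed_signP K x; rewrite ?oppr_eq0 oner_eq0.
Qed.

End NonUniqueness.

Theorem corollary1p5 (R : realType) (alpha' : R) (halpha' : 0 <= alpha' < 1) :
  exists (F0 : spacetime R -> vec3 R) (vin : space3 R -> vec3 R),
    [/\ holder_field 2 alpha' F0,
        weakly_div_free 2 F0,
        smooth_div_free_datum vin &
        exists v1 v2 : spacetime R -> vec3 R,
          [/\ admissible_bounded_solution 2 F0 vin v1,
              admissible_bounded_solution 2 F0 vin v2 &
              ~ ae_eq mu_spacetime (torus_cylinder 2) v1 v2]].
Proof.
pose al : R := if alpha' == 0 then 2^-1 else alpha'.
have al01 : 0 < al < 1.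
  rewrite /al; case: eqVneq => [_|a0];
    first by rewrite invr_gt0 ltr0n invf_lt1 ?ltr1n.
  by rewrite lt_neqAle eq_sym a0 halpha'.
have [K K8 HK] := exists_frequency_ratio al01.
have gB := shear_profile_le_tau (R := R) K8.
have K1 : 1 <= K%:R :> R by rewrite ler1n; apply: leq_trans K8.
have L0 : 0 <= 128 * K%:R :> R by rewrite mulr_ge0.
have [C C0 HC] := force_holder al01 K1 HK L0 (shear_profile_bound K8)
  (shear_profile_lipschitz K8).
exists (force (shear_profile K)), (v_in K); split.
- split.
  + exact: force_periodic (@shear_profile_period R K).
  + by exists 60 => z _; exact: force_bound.
  + case: eqVneq => [_|a0].
      exact: continuous_subspaceT (holder_continuous al01 C0 HC).
    exists C => z w _ _; have := HC z w; by rewrite /al (negPf a0).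
- exact: (force_weakly_div_free (@measurable_shear_profile R K) gB).
- exact: v_in_smooth_div_free.
- exact: admissible_nonuniqueness.
Qed.
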